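(* There exist universal positive constants $C,C',c_1,c_2$ such that the following holds. Let $\mathcal{X}^\star\in\mathbb{R}^{d_1\times\cdots\times d_N}$ be a tensor with TT ranks $\mathbf{r}=(r_1,\dots,r_{N-1})$, $\overline{r}=\max_i r_i$, $\overline{d}=\max_i d_i$, and let $\{\boldsymbol{X}_i^\star\}_{i=1}^N$ be left-orthogonal form factors of a minimal TT decomposition of $\mathcal{X}^\star$. Assume that the linear map $\mathcal{A}:\mathbb{R}^{d_1\times\cdots\times d_N}\to\mathbb{R}^m$ obeys the $(N+3)\overline{r}$-RIP with a constant $\delta_{(N+3)\overline{r}}\le\frac{7}{30}$. Let $\widehat{\boldsymbol{y}}=\mathcal{A}(\mathcal{X}^\star)+\boldsymbol{\epsilon}$, where $\boldsymbol{\epsilon}\in\mathbb{R}^m$ is a Gaussian random vector with mean zero and covariance $\gamma^2\mathbf{I}_m$, let $G(\boldsymbol{X}_1,\dots,\boldsymbol{X}_N)=\frac{1}{2m}\|\mathcal{A}([\boldsymbol{X}_1,\dots,\boldsymbol{X}_N])-\widehat{\boldsymbol{y}}\|_2^2$ for factors $\boldsymbol{X}_i\in\mathbb{R}^{r_{i-1}\times d_i\times r_i}$, and let $\{\boldsymbol{X}_i^{(t)}\}_{t\ge0}$ be the iterates generated by the Riemannian gradient descent (RGD) algorithm (defined in the context) applied to $G$ with step size $\mu>0$, started from factors $\{\boldsymbol{X}_i^{(0)}\}$ with $L(\boldsymbol{X}_i^{(0)})^\top L(\boldsymbol{X}_i^{(0)})=\mathbf{I}_{r_i}$ for $i=1,\dots,N-1$.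 Suppose that $$\operatorname{dist}^2(\{\boldsymbol{X}_i^{(0)}\},\{\boldsymbol{X}_i^\star\})\le\frac{(7-30\delta_{(N+3)\overline{r}})\,\underline{\sigma}^2(\mathcal{X}^\star)}{8\left(N+1+\sum_{i=2}^{N-1}r_i\right)(129N^2+7231N-7360)},$$ that $\mu\le\frac{7-30\delta_{(N+3)\overline{r}}}{20(9N-5)(1+\delta_{(N+3)\overline{r}})^2}$, and that $$m\ge C\,\frac{N^5\,\overline{d}\,\overline{r}^3(\log N)\,\kappa^2(\mathcal{X}^\star)\,\gamma^2}{\underline{\sigma}^2(\mathcal{X}^\star)}.$$ Then, with probability at least $1-2Ne^{-c_1N\overline{d}\,\overline{r}^2\log N}-2e^{-c_2N^3\overline{d}\,\overline{r}^2\log N}$, for all $t\ge 0$, $$\begin{aligned}\operatorname{dist}^2(\{\boldsymbol{X}_i^{(t+1)}\},\{\boldsymbol{X}_i^\star\})\le{}&\left(1-\frac{7-30\delta_{(N+3)\overline{r}}}{1280\left(N+1+\sum_{i=2}^{N-1}r_i\right)\kappa^2(\mathcal{X}^\star)}\,\mu\right)^{t+1}\operatorname{dist}^2(\{\boldsymbol{X}_i^{(0)}\},\{\boldsymbol{X}_i^\star\})\\&+C'\,\frac{(N+\mu)\left(N+1+\sum_{i=2}^{N-1}r_i\right)(1+\delta_{(N+3)\overline{r}})N^2\,\overline{d}\,\overline{r}^2(\log N)\,\kappa^2(\mathcal{X}^\star)\,\gamma^2}{m\,(7-30\delta_{(N+3)\overline{r}})}.\end{aligned}$$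
   Context: Let $N\ge 2$. TT format: for factors $\boldsymbol{X}_i\in\mathbb{R}^{r_{i-1}\times d_i\times r_i}$, $i=1,\dots,N$, with $r_0=r_N=1$, write $\boldsymbol{X}_i(s_i)=\boldsymbol{X}_i(:,s_i,:)\in\mathbb{R}^{r_{i-1}\times r_i}$, and let $[\boldsymbol{X}_1,\dots,\boldsymbol{X}_N]\in\mathbb{R}^{d_1\times\cdots\times d_N}$ be the tensor with entries $\boldsymbol{X}_1(s_1)\boldsymbol{X}_2(s_2)\cdots\boldsymbol{X}_N(s_N)$. The left unfolding $L(\boldsymbol{X}_i)\in\mathbb{R}^{(r_{i-1}d_i)\times r_i}$ stacks $\boldsymbol{X}_i(1),\dots,\boldsymbol{X}_i(d_i)$ vertically; the right unfolding is $R(\boldsymbol{X}_i)=[\boldsymbol{X}_i(1)\ \cdots\ \boldsymbol{X}_i(d_i)]\in\mathbb{R}^{r_{i-1}\times(d_ir_i)}$. A decomposition $\mathcal{X}=[\boldsymbol{X}_1,\dots,\boldsymbol{X}_N]$ is minimal if $\operatorname{rank}L(\boldsymbol{X}_i)=r_i$ and $\operatorname{rank}R(\boldsymbol{X}_i)=r_{i-1}$ for all $i$; then $(r_1,\dots,r_{N-1})$ are the TT ranks of $\mathcal{X}$. Equivalently, $r_i$ is the rank of the $i$-th unfolding matrix $\mathcal{X}^{\langle i\rangle}\in\mathbb{R}^{(d_1\cdots d_i)\times(d_{i+1}\cdots d_N)}$, whose entry in the row indexed by $(s_1,\dots,s_i)$ and column indexed by $(s_{i+1},\dots,s_N)$ is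 $\mathcal{X}(s_1,\dots,s_N)$. Factors are in left-orthogonal form if $L(\boldsymbol{X}_i)^\top L(\boldsymbol{X}_i)=\mathbf{I}_{r_i}$ for $i=1,\dots,N-1$ (such minimal decompositions always exist). For a tensor $\mathcal{X}$ with TT ranks $(r_1,\dots,r_{N-1})$: $\underline{\sigma}(\mathcal{X})=\min_{1\le i\le N-1}\sigma_{r_i}(\mathcal{X}^{\langle i\rangle})$, $\overline{\sigma}(\mathcal{X})=\max_{1\le i\le N-1}\sigma_1(\mathcal{X}^{\langle i\rangle})$, $\kappa(\mathcal{X})=\overline{\sigma}(\mathcal{X})/\underline{\sigma}(\mathcal{X})$, where $\sigma_j$ denotes the $j$-th largest singular value. Distance: for orthogonal matrices $\boldsymbol{R}_i\in\mathbb{O}^{r_i\times r_i}$, $i=1,\dots,N-1$, with $\boldsymbol{R}_0=\boldsymbol{R}_N=1$, let $L_{\boldsymbol{R}}(\boldsymbol{X}_i^\star)$ be the vertical stack of $\boldsymbol{R}_{i-1}^\top\boldsymbol{X}_i^\star(s)\boldsymbol{R}_i$, $s=1,\dots,d_i$. Then $$\operatorname{dist}^2(\{\boldsymbol{X}_i\},\{\boldsymbol{X}_i^\star\})=\min_{\boldsymbol{R}_i\in\mathbb{O}^{r_i\times r_i},\,i\in[N-1]}\ \sum_{i=1}^{N-1}\overline{\sigma}^2(\mathcal{X}^\star)\|L(\boldsymbol{X}_i)-L_{\boldsymbol{R}}(\boldsymbol{X}_i^\star)\|_F^2+\|L(\boldsymbol{X}_N)-L_{\boldsymbol{R}}(\boldsymbol{X}_N^\star)\|_2^2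 .$$ RIP: the linear map $\mathcal{A}$ satisfies the $q$-RIP with constant $\delta_q$ if $(1-\delta_q)\|\mathcal{X}\|_F^2\le\frac1m\|\mathcal{A}(\mathcal{X})\|_2^2\le(1+\delta_q)\|\mathcal{X}\|_F^2$ for all tensors $\mathcal{X}\in\mathbb{R}^{d_1\times\cdots\times d_N}$ all of whose TT ranks are at most $q$. RGD applied to an objective $F(\boldsymbol{X}_1,\dots,\boldsymbol{X}_N)$ with step size $\mu>0$: for each $t\ge 0$, with all gradients evaluated at $(\boldsymbol{X}_1^{(t)},\dots,\boldsymbol{X}_N^{(t)})$, $$L(\boldsymbol{X}_i^{(t+1)})=\operatorname{Retr}\Big(L(\boldsymbol{X}_i^{(t)})-\tfrac{\mu}{\overline{\sigma}^2(\mathcal{X}^\star)}\mathcal{P}_{L(\boldsymbol{X}_i^{(t)})}\big(\nabla_{L(\boldsymbol{X}_i)}F\big)\Big),\ i\in[N-1],\qquad L(\boldsymbol{X}_N^{(t+1)})=L(\boldsymbol{X}_N^{(t)})-\mu\nabla_{L(\boldsymbol{X}_N)}F,$$ where $\nabla_{L(\boldsymbol{X}_i)}F$ is the Euclidean gradient of $F$ with respect to $L(\boldsymbol{X}_i)$, $\mathcal{P}_{\boldsymbol{Y}}(\boldsymbol{B})=\boldsymbol{B}-\frac12\boldsymbol{Y}(\boldsymbol{B}^\top\boldsymbol{Y}+\boldsymbol{Y}^\top\boldsymbol{B})$ is the projection onto the tangent space of the Stiefel manifold at $\boldsymbol{Y}$, and $\operatorname{Retr}(\widehat{\boldsymbol{Y}})=\widehat{\boldsymbol{Y}}(\widehat{\boldsymbol{Y}}^\top\widehat{\boldsymbol{Y}})^{-1/2}$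 is the polar retraction. *)

(* Defs.v *)
From HB Require Import structures.
From mathcomp Require Import all_boot all_order all_algebra.
From mathcomp Require Import all_classical all_reals all_analysis.
From mathcomp.real_closed Require Import complex.

Set Implicit Arguments.
Unset Strict Implicit.
Unset Printing Implicit Defensive.

Import Order.TTheory GRing.Theory Num.Theory.
Import numFieldNormedType.Exports.

Local Open Scope classical_set_scope.
Local Open Scope ring_scope.

(** Indexing.  The modes 1, ..., N are numbered 0, ..., N-1: mode k has size
    [d k], and the core of mode k has slices of shape r_k x r_(k+1).  The rank
    indices 0, ..., N are not shifted; [r 0 = r N = 1] is always a hypothesis
    of the statements.  Only [d 0], ..., [d N.-1] and [r 0], ..., [r N] matter. *)

Section Matrices.
Context {R : realType}.

Definition frob2 m n (M : 'M[R]_(m, n)) : R := \sum_i \sum_j M i j ^+ 2.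

(** The square roots of the eigenvalues (with multiplicity) of the Gram matrix,
    in nonincreasing order.  [spectral_diag] needs a closed field; over R[i]
    the eigenvalues of the symmetric matrix [M^T *m M] are real. *)
Definition singular_values m n (M : 'M[R]_(m, n)) : seq R :=
  let ev := spectral_diag (map_mx (real_complex R) (M^T *m M)) in
  sort (fun x y => y <= x) [seq Num.sqrt (complex.Re (ev 0 j)) | j <- enum 'I_n].

(** j-th largest singular value, j >= 1 *)
Definition sigma (j : nat) m n (M : 'M[R]_(m, n)) : R :=
  nth 0 (singular_values M) j.-1.

Definition posdefmx n (W : 'M[R]_n) : Prop :=
  W^T = W /\ forall v : 'rV[R]_n, v != 0 -> 0 < (v *m W *m v^T) 0 0.

(** S^(-1/2), unique for S positive definite, and 0 otherwise *)
Definition invsqrtmx n (S : 'M[R]_n) : 'M[R]_n :=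
  xget 0 [set W | posdefmx W /\ W *m W *m S = 1%:M].

Definition retr m n (Y : 'M[R]_(m, n)) : 'M[R]_(m, n) :=
  Y *m invsqrtmx (Y^T *m Y).

Definition stiefel_proj m n (Y B : 'M[R]_(m, n)) : 'M[R]_(m, n) :=
  B - 2^-1 *: (Y *m (B^T *m Y + Y^T *m B)).

Definition gradient m n (f : 'M[R]_(m, n) -> R) (M : 'M[R]_(m, n)) :
    'M[R]_(m, n) :=
  \matrix_(i, j) 'D_(delta_mx i j) (f : 'M[R]_(m, n) -> R^o) M.

(** M 0 *m M 1 *m ... *m M k.-1 *)
Fixpoint chain_mx (r : nat -> nat) (k : nat) :
    (forall j : 'I_k, 'M[R]_(r j, r j.+1)) -> 'M[R]_(r 0%N, r k) :=
  match k with
  | 0 => fun=> 1%:M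
  | k'.+1 => fun M =>
      chain_mx (fun j : 'I_k' => M (widen_ord (leqnSn k') j)) *m M ord_max
  end.

End Matrices.

Section Tensors.
Context {R : realType} {N : nat} {d : nat -> nat}.

Notation mindex := {dffun forall k : 'I_N, 'I_(d k)}.

(** [R^o] rather than [R] so that tensors form a vector space *)
Definition tensor : Type := {ffun mindex -> R^o}.

HB.instance Definition _ := GRing.Lmodule.on tensor.

Definition tnorm2 (T : tensor) : R := \sum_s (T s : R) ^+ 2.

(** Multi-indices over the modes satisfying p; the rows and columns of the i-th
    unfolding are indexed by those over the first i and the last N - i modes. *)
Definition pindex (p : pred nat) : Type :=
  {dffun forall k : {k : 'I_N | p k}, 'I_(d (val k))}.

HB.instance Definition _ (p : pred nat) := Finite.on (pindex p).

Definition glue (i : nat) (a : pindex (fun k => (k < i)%N))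
    (b : pindex (fun k => ~~ (k < i)%N)) : mindex :=
  [ffun k : 'I_N => match @idP (k < i)%N with
    | ReflectT h => a (exist _ k h)
    | ReflectF h => b (exist _ k (introN idP h))
    end].

Definition unfolding (i : nat) (T : tensor) :=
  \matrix_(a < #|{: pindex (fun k => (k < i)%N)}|,
           b < #|{: pindex (fun k => ~~ (k < i)%N)}|)
    (T (glue (enum_val a) (enum_val b)) : R).

Definition tt_rank (i : nat) (T : tensor) : nat := \rank (unfolding i T).

Definition sigma_tt (i : nat) (T : tensor) : R :=
  sigma (tt_rank i T) (unfolding i T).

Definition sigma_min (T : tensor) : R :=
  \big[Num.min/sigma_tt 1 T]_(1 <= i < N) sigma_tt i T.

Definition sigma_max (T : tensor) : R :=
  \big[Num.max/sigma 1 (unfolding 1 T)]_(1 <= i < N) sigma 1 (unfolding i T).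

Definition kappa (T : tensor) : R := sigma_max T / sigma_min T.

Definition RIP m (A : tensor -> 'cV[R]_m) (q : nat) (delta : R) : Prop :=
  forall T : tensor, (forall i, (0 < i < N)%N -> (tt_rank i T <= q)%N) ->
    (1 - delta) * tnorm2 T <= m%:R^-1 * frob2 (A T) <= (1 + delta) * tnorm2 T.

Section Factors.
Context {r : nat -> nat}.

Definition core (k : 'I_N) : Type := 'I_(d k) -> 'M[R]_(r k, r k.+1).
Definition factors : Type := forall k : 'I_N, core k.

(** For [r 0 = r N = 1] the chain product is 1 x 1, and the double sum is its
    only entry. *)
Definition tt_tensor (X : factors) : tensor :=
  [ffun s : mindex => \sum_a \sum_b chain_mx (fun k : 'I_N => X k (s k)) a b].

Definition Lunf (X : factors) (k : 'I_N) :
    'M[R]_(\sum_(s < d k) r k, r k.+1) :=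
  \mxcol_(s < d k) X k s.

Definition Runf (X : factors) (k : 'I_N) :
    'M[R]_(r k, \sum_(s < d k) r k.+1) :=
  \mxrow_(s < d k) X k s.

Definition core_of_Lunf (k : 'I_N) (M : 'M[R]_(\sum_(s < d k) r k, r k.+1)) :
    core k :=
  fun s => submxcol M s.

Definition minimal (X : factors) : Prop :=
  forall k : 'I_N, \rank (Lunf X k) = r k.+1 /\ \rank (Runf X k) = r k.

Definition left_orthogonal (X : factors) : Prop :=
  forall k : 'I_N, (k.+1 < N)%N -> (Lunf X k)^T *m Lunf X k = 1%:M.

Definition gauge (Q : forall i, 'M[R]_(r i)) : Prop :=
  [/\ Q 0%N = 1%:M, Q N = 1%:M &
      forall i, (0 < i < N)%N -> (Q i)^T *m Q i = 1%:M].

Definition gauged (Q : forall i, 'M[R]_(r i)) (X : factors) : factors :=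
  fun k s => (Q k)^T *m X k s *m Q k.+1.

(** Squared distance to the factors [Xs] of a tensor with sigma_max = [sb].  The
    infimum is attained, the orthogonal groups being compact.  As [r N = 1], the
    last left unfolding is a column vector and [frob2] its squared 2-norm. *)
Definition dist2 (sb : R) (X Xs : factors) : R :=
  inf [set x | exists2 Q, gauge Q &
    x = \sum_(k < N | (k.+1 < N)%N)
          sb ^+ 2 * frob2 (Lunf X k - Lunf (gauged Q Xs) k)
      + \sum_(k < N | k.+1 == N) frob2 (Lunf X k - Lunf (gauged Q Xs) k)].

Definition grad (F : factors -> R) (X : factors) (k : 'I_N) :
    'M[R]_(\sum_(s < d k) r k, r k.+1) :=
  gradient (fun M => F (dfwith X k (core_of_Lunf M))) (Lunf X k).

Definition RGD (F : factors -> R) (sb mu : R) (X : nat -> factors) : Prop :=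
  forall (t : nat) (k : 'I_N),
    ((k.+1 < N)%N ->
      Lunf (X t.+1) k =
        retr (Lunf (X t) k
              - (mu / sb ^+ 2) *: stiefel_proj (Lunf (X t) k) (grad F (X t) k)))
    /\ (k.+1 = N ->
      Lunf (X t.+1) k = Lunf (X t) k - mu *: grad F (X t) k).

Definition sensing_loss m (A : tensor -> 'cV[R]_m) (y : 'cV[R]_m) (X : factors)
    : R :=
  (2 * m%:R)^-1 * frob2 (A (tt_tensor X) - y).

End Factors.
End Tensors.

Arguments tensor : clear implicits.
Arguments factors : clear implicits.

Section Gaussian.
Context {R : realType}.

(** N(mu, v); [normal_prob] is not Gaussian for the standard deviation 0. *)
Definition gaussian_law (mu v : R) (B : set R) : \bar R :=
  if v == 0 then \d_mu B else normal_prob mu (Num.sqrt v) B.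

(** Every linear functional of eps is Gaussian with the mean and the variance
    given by [mu] and [Sigma]; this covers singular covariance matrices. *)
Definition gaussian_vector dsp (Omega : measurableType dsp)
    (P : probability Omega R) m (mu : 'cV[R]_m) (Sigma : 'M[R]_m)
    (eps : Omega -> 'cV[R]_m) : Prop :=
  (forall i, measurable_fun setT (fun w => eps w i 0)) /\
  forall (a : 'cV[R]_m) (B : set R), measurable B ->
    P ((fun w => (a^T *m eps w) 0 0) @^-1` B) =
      gaussian_law ((a^T *m mu) 0 0) ((a^T *m Sigma *m a) 0 0) B.

End Gaussian.

(* Main.v *)
(* Let E = [X] - X* and let V be the sum minimized in dist^2, at a fixed gauge.

   Descent.  The polar retraction is nonexpansive towards the Stiefel manifold,
   so V decreases as in a Euclidean gradient step.  The projections of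
   the differences of the left unfoldings onto the tangent spaces assemble into
   the tensor E + H with |H| <= 2 N V / sigma_max, so the first-order decrease is the value of the
   residual form at E + H.  With the RIP, V drops by at least mu |E|^2 / 2, up
   to terms of the order of V^2 and of mu tau^2, where tau bounds the noise on
   normalized tangent tensors.

   Error bound.  If V is small, the polar factors of the cross Gram matrices of
   the left interface matrices are gauges showing dist^2 <= 5 N kappa^2 |E|^2.
   Hence dist^2 contracts with rate 1 - mu / (50 N kappa^2) towards a multiple
   of N kappa^2 tau^2.

   Noise.  A tangent tensor has a TT decomposition with doubled ranks, which can
   be put in left form.  The unit ball of such decompositions has a finite net
   made of the cells of a cubic lattice that meet it; a Gaussian tail bound on
   the net and multilinearity bound the noise on all tangent tensors. *)

Require Import Defs.
From mathcomp Require Import all_boot all_order all_algebra.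
From mathcomp Require Import all_classical all_reals all_analysis.
From mathcomp Require Import measurable_realfun.
From mathcomp Require Import ring lra zify.
From mathcomp.real_closed Require complex.

Set Implicit Arguments.
Unset Strict Implicit.
Unset Printing Implicit Defensive.

Import Order.TTheory GRing.Theory Num.Theory.
Import numFieldNormedType.Exports.

Local Open Scope classical_set_scope.
Local Open Scope ring_scope.

(** * Frobenius geometry *)

(** Left-orthogonality makes the left interface matrices isometries, so the singular values of the
    unfoldings sit in the right ones. [good] records this for the target and survives a change of
    gauge. The weights of dist^2 bound the squared norm of the right interface behind each core;
    hence the step sizes [mu / wt] suit all modes at once, and a core difference is comparable with
    the tensor that it produces. The iterates depend on the noise, so a tail bound at a fixed tensor
    says nothing about them: the noise must be bounded on all tangent tensors simultaneously. The
    net consists of left contractions instead of left-orthogonal cores, since decompositions with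
    doubled ranks may be rank deficient. Each step is analysed at a nearly optimal gauge; the gap
    between the radii sl^2 / (140 N^3) and sl^2 / (145 N^3) pays for this. The power N^3 balances
    the squared second-order error, of order N^2 V^2 / sb^2, against a rate of order 1 / N. A single
    entropy bound with min(rbar, D) serves both the sample size (through rbar) and the final error
    (through D). *)

Section Frobenius.
Context {R : realType}.

Definition mxdot m n (A B : 'M[R]_(m, n)) : R := \tr (A *m B^T).
Definition fnorm m n (A : 'M[R]_(m, n)) : R := Num.sqrt (frob2 A).

Lemma mxdotE m n (A B : 'M[R]_(m, n)) :
  mxdot A B = \sum_i \sum_j A i j * B i j.
Proof.
rewrite /mxdot /mxtrace; apply: eq_bigr => i _; rewrite mxE.
by apply: eq_bigr => j _; rewrite mxE.
Qed.

Lemma frob2E m n (A : 'M[R]_(m, n)) : frob2 A = mxdot A A.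
Proof.
by rewrite mxdotE; apply: eq_bigr => i _; apply: eq_bigr => j _; rewrite expr2.
Qed.

Lemma mxdotC m n (A B : 'M[R]_(m, n)) : mxdot A B = mxdot B A.
Proof. by rewrite /mxdot -mxtrace_tr trmx_mul trmxK. Qed.

Lemma mxdot_tr m n (A B : 'M[R]_(m, n)) : mxdot A^T B^T = mxdot A B.
Proof. by rewrite /mxdot mxtrace_mulC -mxtrace_tr trmx_mul !trmxK mxtrace_mulC. Qed.

Lemma mxdotDl m n (A B C : 'M[R]_(m, n)) : mxdot (A + B) C = mxdot A C + mxdot B C.
Proof. by rewrite /mxdot mulmxDl mxtraceD. Qed.

Lemma mxdotDr m n (A B C : 'M[R]_(m, n)) : mxdot A (B + C) = mxdot A B + mxdot A C.
Proof. by rewrite mxdotC mxdotDl !(mxdotC A). Qed.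

Lemma mxdotZl m n a (A B : 'M[R]_(m, n)) : mxdot (a *: A) B = a * mxdot A B.
Proof. by rewrite /mxdot -scalemxAl mxtraceZ. Qed.

Lemma mxdotZr m n a (A B : 'M[R]_(m, n)) : mxdot A (a *: B) = a * mxdot A B.
Proof. by rewrite mxdotC mxdotZl mxdotC. Qed.

Lemma mxdotNl m n (A B : 'M[R]_(m, n)) : mxdot (- A) B = - mxdot A B.
Proof. by rewrite -scaleN1r mxdotZl mulN1r. Qed.

Lemma mxdotNr m n (A B : 'M[R]_(m, n)) : mxdot A (- B) = - mxdot A B.
Proof. by rewrite mxdotC mxdotNl mxdotC. Qed.

Lemma mxdotBl m n (A B C : 'M[R]_(m, n)) : mxdot (A - B) C = mxdot A C - mxdot B C.
Proof. by rewrite mxdotDl mxdotNl. Qed.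

Lemma mxdotBr m n (A B C : 'M[R]_(m, n)) : mxdot A (B - C) = mxdot A B - mxdot A C.
Proof. by rewrite mxdotDr mxdotNr. Qed.

Lemma mxdot_suml m n (I : Type) (s : seq I) (P : pred I) (F : I -> 'M[R]_(m, n)) B :
  mxdot (\sum_(i <- s | P i) F i) B = \sum_(i <- s | P i) mxdot (F i) B.
Proof. by rewrite /mxdot mulmx_suml raddf_sum. Qed.

Lemma mxdot_sumr m n (I : Type) (s : seq I) (P : pred I) (F : I -> 'M[R]_(m, n)) B :
  mxdot B (\sum_(i <- s | P i) F i) = \sum_(i <- s | P i) mxdot B (F i).
Proof. by rewrite mxdotC mxdot_suml; apply: eq_bigr => i _; rewrite mxdotC. Qed.

Lemma mxdot_mull m n p (A : 'M[R]_(m, n)) (B : 'M[R]_(n, p)) C :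
  mxdot (A *m B) C = mxdot B (A^T *m C).
Proof. by rewrite /mxdot trmx_mul trmxK -mulmxA mxtrace_mulC mulmxA. Qed.

Lemma mxdot_mulr m n p (A : 'M[R]_(m, n)) (B : 'M[R]_(n, p)) C :
  mxdot (A *m B) C = mxdot A (C *m B^T).
Proof. by rewrite /mxdot trmx_mul trmxK mulmxA. Qed.

Lemma mxdot0r m n (A : 'M[R]_(m, n)) : mxdot A 0 = 0.
Proof. by rewrite -(scale0r 0) mxdotZr mul0r. Qed.

Lemma frob2_ge0 m n (A : 'M[R]_(m, n)) : 0 <= frob2 A.
Proof. by apply: sumr_ge0 => i _; apply: sumr_ge0 => j _; apply: sqr_ge0. Qed.

Lemma frob2_eq0 m n (A : 'M[R]_(m, n)) : frob2 A = 0 -> A = 0.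
Proof.
move=> /eqP; rewrite psumr_eq0; last first.
  by move=> i _; apply: sumr_ge0 => j _; apply: sqr_ge0.
move=> /allP h; apply/matrixP => i j; rewrite mxE.
have := h i (mem_index_enum _); rewrite implyTb psumr_eq0; last first.
  by move=> k _; apply: sqr_ge0.
by move=> /allP/(_ j (mem_index_enum _)); rewrite implyTb sqrf_eq0 => /eqP.
Qed.

Lemma frob2_0 m n : frob2 (0 : 'M[R]_(m, n)) = 0.
Proof. by rewrite frob2E mxdotE; apply: big1 => i _; apply: big1 => j _; rewrite mxE mul0r. Qed.

Lemma frob2_gt0 m n (A : 'M[R]_(m, n)) : (0 < frob2 A) = (A != 0).
Proof.
rewrite lt_neqAle frob2_ge0 andbT eq_sym; congr (~~ _).
by apply/eqP/eqP => [/frob2_eq0|->]; rewrite ?frob2_0.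
Qed.

Lemma frob2_tr m n (A : 'M[R]_(m, n)) : frob2 A^T = frob2 A.
Proof. by rewrite !frob2E mxdot_tr. Qed.

Lemma frob2Z m n a (A : 'M[R]_(m, n)) : frob2 (a *: A) = a ^+ 2 * frob2 A.
Proof. by rewrite !frob2E mxdotZl mxdotZr mulrA expr2. Qed.

Lemma frob2N m n (A : 'M[R]_(m, n)) : frob2 (- A) = frob2 A.
Proof. by rewrite -scaleN1r frob2Z sqrrN expr1n mul1r. Qed.

Lemma frob2D m n (A B : 'M[R]_(m, n)) :
  frob2 (A + B) = frob2 A + 2 * mxdot A B + frob2 B.
Proof. by rewrite !frob2E !(mxdotDl, mxdotDr) (mxdotC B A); ring. Qed.

Lemma frob2B m n (A B : 'M[R]_(m, n)) :
  frob2 (A - B) = frob2 A - 2 * mxdot A B + frob2 B.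
Proof. by rewrite frob2D mxdotNr frob2N; ring. Qed.

Lemma frob2BC m n (A B : 'M[R]_(m, n)) : frob2 (A - B) = frob2 (B - A).
Proof. by rewrite -frob2N opprB. Qed.

Lemma mxdot_CS2 m n (A B : 'M[R]_(m, n)) : mxdot A B ^+ 2 <= frob2 A * frob2 B.
Proof.
have [->|B0] := eqVneq B 0.
  by rewrite frob2_0 mulr0 mxdot0r expr0n.
have pB : 0 < frob2 B by rewrite frob2_gt0.
have := frob2_ge0 (frob2 B *: A - mxdot A B *: B).
rewrite frob2B !frob2Z mxdotZl mxdotZr => h.
rewrite -subr_ge0 -(pmulr_rge0 _ pB); apply: le_trans h _.
by rewrite le_eqVlt; apply/orP; left; apply/eqP; ring.
Qed.

Lemma fnorm_ge0 m n (A : 'M[R]_(m, n)) : 0 <= fnorm A. Proof. exact: sqrtr_ge0. Qed.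

Lemma sqr_fnorm m n (A : 'M[R]_(m, n)) : fnorm A ^+ 2 = frob2 A.
Proof. by rewrite sqr_sqrtr// frob2_ge0. Qed.

Lemma mxdot_CS m n (A B : 'M[R]_(m, n)) : mxdot A B <= fnorm A * fnorm B.
Proof.
rewrite (le_trans (ler_norm _))// -sqrtr_sqr /fnorm -sqrtrM ?frob2_ge0//.
by rewrite ler_sqrt ?mxdot_CS2// mulr_ge0 ?frob2_ge0.
Qed.

Lemma fnormD m n (A B : 'M[R]_(m, n)) : fnorm (A + B) <= fnorm A + fnorm B.
Proof.
rewrite -(@ler_pXn2r _ 2) ?nnegrE ?addr_ge0 ?fnorm_ge0//.
rewrite sqr_fnorm frob2D sqrrD !sqr_fnorm.
by have := mxdot_CS A B; lra.
Qed.

Lemma fnorm_le m n p q (A : 'M[R]_(m, n)) (B : 'M[R]_(p, q)) a :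
  0 <= a -> frob2 A <= a ^+ 2 * frob2 B -> fnorm A <= a * fnorm B.
Proof.
move=> a0 h; rewrite -(@ler_pXn2r _ 2) ?nnegrE ?mulr_ge0 ?fnorm_ge0//.
by rewrite exprMn !sqr_fnorm.
Qed.

Lemma frob2_rows m n (A : 'M[R]_(m, n)) : frob2 A = \sum_i frob2 (row i A).
Proof.
apply: eq_bigr => i _; rewrite /frob2 big_ord1; apply: eq_bigr => j _.
by rewrite mxE.
Qed.

(** [rbound M c] and [cbound M c] both say that the squared spectral norm of M is at most c. Letting
    x have any number of rows or columns makes them apply directly to Frobenius norms of
    products. *)
Definition rbound m n (M : 'M[R]_(m, n)) (c : R) :=
  forall p (x : 'M[R]_(p, m)), frob2 (x *m M) <= c * frob2 x.
Definition cbound m n (M : 'M[R]_(m, n)) (c : R) :=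
  forall p (x : 'M[R]_(n, p)), frob2 (M *m x) <= c * frob2 x.

Lemma rbound_row m n (M : 'M[R]_(m, n)) c :
  (forall x : 'rV_m, frob2 (x *m M) <= c * frob2 x) -> rbound M c.
Proof.
move=> h p x; rewrite frob2_rows (frob2_rows x) mulr_sumr.
by apply: ler_sum => i _; rewrite row_mul.
Qed.

Lemma rbound_tr m n (M : 'M[R]_(m, n)) c : cbound M c -> rbound M^T c.
Proof. by move=> h p x; rewrite -frob2_tr trmx_mul trmxK -(frob2_tr x). Qed.

Lemma cbound_tr m n (M : 'M[R]_(m, n)) c : rbound M c -> cbound M^T c.
Proof. by move=> h p x; rewrite -frob2_tr trmx_mul trmxK -(frob2_tr x). Qed.

(** With y = x M, one has |y|^2 = <x, y M^T> <= |x| |y M^T|, and M^T inherits the bound of M. *)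
Lemma cbound_rbound m n (M : 'M[R]_(m, n)) c : 0 <= c -> cbound M c -> rbound M c.
Proof.
move=> c0 h p x; have [->|y0] := eqVneq (x *m M) 0.
  by rewrite frob2_0 mulr_ge0 ?frob2_ge0.
set y := x *m M; have py : 0 < frob2 y by rewrite frob2_gt0.
have h1 : frob2 y ^+ 2 <= frob2 x * frob2 (y *m M^T).
  by rewrite {1}frob2E mxdot_mulr mxdot_CS2.
have h2 : frob2 (y *m M^T) <= c * frob2 y.
  by rewrite -frob2_tr trmx_mul trmxK -(frob2_tr y).
by rewrite -(ler_pM2r py); have := ler_wpM2l (frob2_ge0 x) h2; lra.
Qed.

Lemma rbound_cbound m n (M : 'M[R]_(m, n)) c : 0 <= c -> rbound M c -> cbound M c.
Proof.
by move=> c0 /cbound_tr /(cbound_rbound c0) /cbound_tr; rewrite trmxK.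
Qed.

Lemma rbound_frob m n (M : 'M[R]_(m, n)) : rbound M (frob2 M).
Proof.
apply: rbound_row => x.
have -> : frob2 (x *m M) = \sum_j mxdot x (col j M)^T ^+ 2.
  rewrite /frob2 big_ord1; apply: eq_bigr => j _; congr (_ ^+ 2).
  by rewrite mxE mxdotE big_ord1; apply: eq_bigr => k _; rewrite !mxE.
rewrite -(frob2_tr M) (frob2_rows M^T) mulrC mulr_sumr; apply: ler_sum => j _.
by rewrite -tr_col mxdot_CS2.
Qed.

Lemma cbound_frob m n (M : 'M[R]_(m, n)) : cbound M (frob2 M).
Proof. exact: rbound_cbound (frob2_ge0 _) (@rbound_frob _ _ _). Qed.

Lemma cboundM m n p (M : 'M[R]_(m, n)) (M' : 'M[R]_(n, p)) c c' : 0 <= c ->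
  cbound M c -> cbound M' c' -> cbound (M *m M') (c * c').
Proof.
by move=> c0 h h' k x; rewrite -mulmxA (le_trans (h _ _))// -mulrA ler_wpM2l.
Qed.

Lemma cboundD m n (A B : 'M[R]_(m, n)) a b : 0 <= a -> 0 <= b ->
  cbound A (a ^+ 2) -> cbound B (b ^+ 2) -> cbound (A + B) ((a + b) ^+ 2).
Proof.
move=> a0 b0 hA hB p x; rewrite mulmxDl -!sqr_fnorm -exprMn.
rewrite ler_pXn2r ?nnegrE ?mulr_ge0 ?addr_ge0 ?fnorm_ge0//.
by rewrite (le_trans (fnormD _ _))// mulrDl lerD// fnorm_le.
Qed.

Lemma cbound_isom m n (M : 'M[R]_(m, n)) p (x : 'M[R]_(n, p)) :
  M^T *m M = 1%:M -> frob2 (M *m x) = frob2 x.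
Proof. by move=> h; rewrite !frob2E mxdot_mull mulmxA h mul1mx. Qed.

Lemma cbound_orth m n (M : 'M[R]_(m, n)) : M^T *m M = 1%:M -> cbound M 1.
Proof. by move=> h p x; rewrite (cbound_isom _ h) mul1r. Qed.

Lemma frob2_mxcol n p q (F : 'I_n -> 'M[R]_(p, q)) :
  frob2 (\mxcol_s F s) = \sum_s frob2 (F s).
Proof.
rewrite frob2E -mxdot_tr /mxdot trmxK tr_mxcol mul_mxrow_mxcol raddf_sum.
by apply: eq_bigr => s _; rewrite /= frob2E -mxdot_tr /mxdot trmxK.
Qed.

Lemma mxcolZ n p q a (F : 'I_n -> 'M[R]_(p, q)) :
  a *: (\mxcol_s F s) = \mxcol_s (a *: F s).
Proof. by apply/matrixP => i j; rewrite !mxE. Qed.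

Lemma mxdot_mxcol n p q (F G : 'I_n -> 'M[R]_(p, q)) :
  mxdot (\mxcol_s F s) (\mxcol_s G s) = \sum_s mxdot (F s) (G s).
Proof.
rewrite -mxdot_tr /mxdot trmxK tr_mxcol mul_mxrow_mxcol raddf_sum.
by apply: eq_bigr => s _; rewrite -[RHS]mxdot_tr /mxdot trmxK.
Qed.

Lemma mxdot_mxrow n p q (F G : 'I_n -> 'M[R]_(p, q)) :
  mxdot (\mxrow_s F s) (\mxrow_s G s) = \sum_s mxdot (F s) (G s).
Proof.
by rewrite -mxdot_tr !tr_mxrow mxdot_mxcol; apply: eq_bigr => s _; rewrite mxdot_tr.
Qed.

Lemma frob2_mxrow n p q (F : 'I_n -> 'M[R]_(p, q)) :
  frob2 (\mxrow_s F s) = \sum_s frob2 (F s).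
Proof.
by rewrite frob2E mxdot_mxrow; apply: eq_bigr => s _; rewrite frob2E.
Qed.

End Frobenius.

(** * Singular values *)

Lemma rank_diag_le (F : fieldType) n (d : 'rV[F]_n) :
  (\rank (diag_mx d) <= count (fun j => d 0%R j != 0%R) (enum 'I_n))%N.
Proof.
have -> : diag_mx d = \sum_j d 0 j *: delta_mx j j.
  apply/matrixP => i k; rewrite summxE (bigD1 i)//= big1 ?addr0 => [|j ji].
    by rewrite !mxE eqxx/= eq_sym; case: eqP => _; rewrite ?mulr1n ?mulr1 ?mulr0.
  by rewrite !mxE eq_sym (negbTE ji) mulr0.
rewrite -big_enum/=; elim: (enum _) => [|j s IH]; first by rewrite big_nil mxrank0.
rewrite big_cons (leq_trans (mxrank_add _ _))//= leq_add//.
have [->|dj] := eqVneq (d 0 j) 0; first by rewrite scale0r mxrank0.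
by rewrite (leq_trans (mxrank_scale _ _))// mxrank_delta.
Qed.

(** For the lower bound, add the diagonal indicator of the zeros of d: the sum is invertible, and
    the rank of the indicator is at most the number of these zeros. *)
Lemma rank_diag (F : fieldType) n (d : 'rV[F]_n) :
  \rank (diag_mx d) = count (fun j => d 0%R j != 0%R) (enum 'I_n).
Proof.
apply/eqP; rewrite eqn_leq rank_diag_le /=.
pose e : 'rV[F]_n := \row_j (d 0 j == 0)%:R.
have he := rank_diag_le e.
have hn : (n <= \rank (diag_mx d) + \rank (diag_mx e))%N.
  apply: leq_trans (mxrank_add _ _); rewrite -raddfD /=.
  rewrite mxrank_unit// unitmxE det_diag unitfE; apply/prodf_neq0 => j _.
  by rewrite !mxE; have [->|] := eqVneq (d 0 j) 0; rewrite ?add0r ?oner_eq0 ?addr0.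
rewrite -(leq_add2r (\rank (diag_mx e))) (leq_trans _ hn)//.
rewrite (leq_trans (leq_add (leqnn _) he))//.
rewrite -[leqRHS](size_enum_ord n) -(count_predC (fun j => d 0 j != 0) (enum 'I_n)).
rewrite leq_add2l; apply: sub_count => j /=; rewrite !mxE negbK.
by case: (d 0 j == 0); rewrite ?eqxx.
Qed.

(** The positive entries of a nonincreasing sequence form a prefix. The index is unrestricted
    because the default value 0 is not positive. *)
Lemma sorted_nth_gt0 (R : realType) (s : seq R) : sorted (fun x y => y <= x) s ->
  forall i, (0 < nth 0 s i) = (i < count (fun x : R => (0 < x)%R) s)%N.
Proof.
elim: s => [_ i|x s IH /= hs i]; first by rewrite nth_nil ltxx.
have ss := path_sorted hs.
case: (ltP 0 x) => x0; last first.
  have -> : count (fun x : R => (0 < x)%R) s = 0%N.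
    apply/eqP; rewrite -leqn0 leqNgt -has_count; apply/hasPn => y ys.
    have /allP/(_ y ys) := order_path_min (fun a b c (h1 : a <= b) h2 => le_trans h2 h1) hs.
    by rewrite -leNgt => /le_trans; apply.
  case: i => [|i] /=; first by rewrite addn0 ltn0 ltNge x0.
  have [lt|ge] := ltnP i (size s); last by rewrite nth_default ?ltxx ?addn0.
  have /allP/(_ _ (mem_nth 0 lt)) := order_path_min (fun a b c (h1 : a <= b) h2 => le_trans h2 h1) hs.
  by move=> /le_trans/(_ x0); rewrite addn0 ltn0 ltNge => ->.
by case: i => [|i] /=; rewrite add1n ?ltnS ?x0 ?IH.
Qed.

Lemma interpolate (F : fieldType) (f : F -> F) (s : seq F) :
  exists p : {poly F}, forall x, x \in s -> p.[x] = f x.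
Proof.
elim: s => [|x s [p hp]]; first by exists 0.
have [xs|xs] := boolP (x \in s).
  by exists p => y; rewrite inE => /orP[/eqP->|]; apply: hp.
pose q := \prod_(y <- s) ('X - y%:P).
have qx : q.[x] != 0 by rewrite -[_ == 0]/(root q x) root_prod_XsubC.
exists (p + ((f x - p.[x]) / q.[x]) *: q) => y; rewrite inE => /orP[/eqP->|ys].
  by rewrite !hornerE divfK// addrC subrK.
by rewrite !hornerE hp// (rootP (_ : root q y)) ?mulr0 ?addr0// root_prod_XsubC.
Qed.

(** * Functional calculus of real symmetric matrices *)

Section Diagonalized.
Local Open Scope sesquilinear_scope.
Context {R : realType} {C : numClosedFieldType} (toC : {rmorphism R -> C}).
Hypothesis conj_toC : forall x, (toC x)^* = toC x.
Hypothesis norm_toC : forall z : C, exists w : R, 0 <= w /\ z * z^* = toC w.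

(** The matrix f(G), when G becomes U^-1 diag(lam) U over the closed field. The eigenvalues [lam]
    are kept in R, so that f is a real function. *)
Definition fdiag n (U : 'M[C]_n) (lam : 'I_n -> R) (f : R -> R) : 'M[C]_n :=
  invmx U *m diag_mx (\row_j toC (f (lam j))) *m U.

Lemma real_conj m p (A : 'M[R]_(m, p)) : (map_mx toC A) ^t* = map_mx toC A^T.
Proof. by apply/matrixP => i j; rewrite !mxE conj_toC. Qed.

Context {n : nat} (U : 'M[C]_n) (lam : 'I_n -> R) (Uunitary : U \is unitarymx).
Local Notation fd := (fdiag U lam).

Lemma Uunit : U \in unitmx. Proof. exact: unitarymx_unit. Qed.

Lemma fdiagM f g : fd f *m fd g = fd (fun x => f x * g x).
Proof.
rewrite /fdiag !mulmxA mulmxK ?Uunit// -(mulmxA _ (diag_mx _) (diag_mx _)) mulmx_diag.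
congr (_ *m _ *m _); congr diag_mx; apply/rowP => j; rewrite !mxE.
by rewrite rmorphM.
Qed.

Lemma fdiag1 : fd (fun=> 1) = 1%:M.
Proof.
rewrite /fdiag; have -> : \row_j toC 1 = const_mx 1 :> 'rV[C]_n.
  by apply/rowP => j; rewrite !mxE rmorph1.
by rewrite diag_const_mx mulmx1 mulVmx ?Uunit.
Qed.

Lemma eq_fdiag f g : (forall j, f (lam j) = g (lam j)) -> fd f = fd g.
Proof. by move=> h; congr (_ *m diag_mx _ *m _); apply/rowP => j; rewrite !mxE h. Qed.

(** The weights are the squared moduli of the coordinates of v in the eigenbasis. They do not depend
    on f, so different functions of the same matrix can be compared term by term. *)
Lemma quad_weights (v : 'rV[R]_n) : exists2 w : 'I_n -> R,
  (forall j, 0 <= w j) /\ frob2 v = \sum_j w j &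
  forall (F : 'M[R]_n) f, map_mx toC F = fd f ->
    (v *m F *m v^T) 0 0 = \sum_j f (lam j) * w j.
Proof.
suff [w w0 hw] : exists2 w : 'I_n -> R, (forall j, 0 <= w j) &
    forall (F : 'M[R]_n) f, map_mx toC F = fd f ->
    (v *m F *m v^T) 0 0 = \sum_j f (lam j) * w j.
  exists w => //; split=> //; have h1 : map_mx toC 1%:M = fd (fun=> 1).
    by rewrite fdiag1 map_mx1.
  have := hw _ _ h1; rewrite mulmx1 frob2E /mxdot /mxtrace big_ord1 => ->.
  by apply: eq_bigr => j _; rewrite mul1r.
pose c := map_mx toC v *m invmx U.
have [w hw] := choice (fun j => norm_toC (c 0 j)).
exists w => [j|F f hF]; first by have [] := hw j.
apply: (fmorph_inj toC).
have hc (A : 'M[R]_1) : toC (A 0 0) = (map_mx toC A) 0 0 by rewrite [RHS]mxE.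
rewrite hc !map_mxM hF /fdiag !mulmxA -/c -real_conj.
have -> : c *m diag_mx (\row_j toC (f (lam j))) *m U *m (map_mx toC v) ^t* =
    c *m diag_mx (\row_j toC (f (lam j))) *m c ^t*.
  rewrite -mulmxA; congr (_ *m _).
  by rewrite /c trmx_mul map_mxM (invmx_unitary Uunitary) trmxCK.
clearbody c; rewrite mul_mx_diag mxE rmorph_sum; apply: eq_bigr => j _.
rewrite !mxE rmorphM; have [_ <-] := hw j.
by rewrite mulrAC mulrC.
Qed.

(** On a finite spectrum f agrees with a polynomial p, taken over R; hence f(G) = p(G) has real
    entries although U is complex. *)
Lemma fun_calculus (G : 'M[R]_n) f : map_mx toC G = fd id ->
   exists F : 'M[R]_n, map_mx toC F = fd f.
Proof.
move=> hG; have [p hp] := interpolate f [seq lam j | j <- enum 'I_n].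
have hU := Uunit; move: hG hp; rewrite /fdiag.
move: (U) lam hU G; case: (n) => [|k] V l hV G hG hp.
  by exists 1%:M; apply/matrixP => -[].
exists (horner_mx G p); rewrite map_horner_mx hG horner_mx_uconjC// horner_mx_diag.
congr (_ *m diag_mx _ *m _); apply/rowP => j; rewrite !mxE horner_map /=.
by rewrite hp// map_f// mem_enum.
Qed.

Lemma fdiag_inj (F F' : 'M[R]_n) f : map_mx toC F = fd f ->
  map_mx toC F' = fd f -> F = F'.
Proof.
move=> <- /matrixP h; apply/matrixP => i j; have := h i j; rewrite !mxE.
by move=> /fmorph_inj.
Qed.

Lemma fdiag_sym (F : 'M[R]_n) f : map_mx toC F = fd f -> F^T = F.
Proof.
move=> hF; apply: (fdiag_inj _ hF); rewrite -real_conj hF /fdiag.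
rewrite (invmx_unitary Uunitary) !trmx_mul !map_mxM trmxCK !mulmxA.
congr (_ *m _ *m _); apply/matrixP => i j; rewrite !mxE.
rewrite eq_sym; case: eqP => [->|_]; last by rewrite !mulr0n rmorph0.
by rewrite !mulr1n; apply: conj_toC.
Qed.

Lemma fdiag_mx1 : map_mx toC (1%:M : 'M[R]_n) = fd (fun=> 1).
Proof. by rewrite fdiag1 map_mx1. Qed.

Context (G : 'M[R]_n) (hG : map_mx toC G = fd id).

(** Yields real test vectors: v is a nonzero row of the spectral projector onto the eigenvalues
    satisfying P, which is real by [fun_calculus], and all the weight of v lies on these
    eigenvalues. *)
Lemma eigen_vec (P : pred R) j : P (lam j) ->
  exists v : 'rV[R]_n, v != 0 /\ exists2 w : 'I_n -> R, (forall j, 0 <= w j) &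
    (v *m G *m v^T) 0 0 = \sum_(k | P (lam k)) lam k * w k /\
    frob2 v = \sum_(k | P (lam k)) w k.
Proof.
move=> Pj; pose f x : R := (P x)%:R.
have [F hF] := fun_calculus f hG.
have ff x : f x * f x = f x by rewrite /f; case: (P x); rewrite ?mulr1 ?mulr0.
have F0 : F != 0.
  apply/eqP => F0; move: hF; rewrite F0 map_mx0 /fdiag => h.
  have : U *m (invmx U *m diag_mx (\row_j0 toC (f (lam j0))) *m U) *m invmx U = 0.
    by rewrite -h mulmx0 mul0mx.
  rewrite !mulmxA mulmxV ?Uunit// mul1mx mulmxK ?Uunit// => /matrixP/(_ j j).
  by rewrite !mxE eqxx mulr1n /f Pj rmorph1 => /eqP; rewrite oner_eq0.
have [i vi] : exists i, row i F != 0.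
  apply/existsP; rewrite -negb_forall; apply: contra F0 => /forallP h.
  by apply/eqP/row_matrixP => i; rewrite row0; apply/eqP.
exists (row i F); split => //.
have [w [w0 _] hw] := quad_weights (delta_mx 0 i).
exists w => //; rewrite rowE; set e := delta_mx 0 i.
have FT := fdiag_sym hF.
split.
  rewrite trmx_mul !mulmxA -(mulmxA _ F) -(mulmxA _ (F *m G)) FT.
  rewrite (hw _ (fun x => f x * x * f x)); last first.
    by rewrite !map_mxM hF hG !fdiagM.
  rewrite [RHS]big_mkcond; apply: eq_bigr => k _; rewrite /f; case: (P _).
    by rewrite mul1r mulr1.
  by rewrite !mul0r.
rewrite frob2E /mxdot /mxtrace big_ord1 trmx_mul !mulmxA -(mulmxA _ F) FT.
rewrite (hw _ (fun x => f x * f x)); last by rewrite !map_mxM hF !fdiagM.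
rewrite [RHS]big_mkcond; apply: eq_bigr => k _; rewrite ff /f; case: (P _).
  by rewrite mul1r.
by rewrite mul0r.
Qed.

Lemma eigen_ge0 j : (forall v : 'rV[R]_n, 0 <= (v *m G *m v^T) 0 0) -> 0 <= lam j.
Proof.
move=> h; rewrite leNgt; apply/negP => l.
have [v [v0 [w w0 [h1 h2]]]] := @eigen_vec (fun x => x < 0) j l.
have := h v; rewrite h1 leNgt => /negP; apply.
have : \sum_(k | lam k < 0) w k <> 0.
  by rewrite -h2; apply/eqP; rewrite gt_eqF// frob2_gt0.
move=> /(psumr_neq0P (fun i _ => w0 i)) [k /andP[Pk wk]].
rewrite (bigD1 k)//= -[ltRHS]addr0 ltr_leD ?nmulr_rlt0//.
by apply: sumr_le0 => i /andP[Pi _]; rewrite mulr_le0_ge0// ltW.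
Qed.

Lemma eigen_gt0 j : posdefmx G -> 0 < lam j.
Proof.
move=> [_ h]; rewrite ltNge; apply/negP => l.
have [v [v0 [w w0 [h1 _]]]] := @eigen_vec (fun x => x <= 0) j l.
have := h v v0; rewrite h1 ltNge => /negP; apply.
by apply: sumr_le0 => i Pi; rewrite mulr_le0_ge0.
Qed.

Lemma rank_lam : \rank G = count (fun j => lam j != 0%R) (enum 'I_n).
Proof.
rewrite -(mxrank_map toC) hG /fdiag mxrankMfree ?row_free_unit ?Uunit//.
rewrite (eqmxMfull _ (_ : row_full (invmx U))) ?row_full_unit ?unitmx_inv ?Uunit//.
rewrite rank_diag; apply: eq_count => j; rewrite mxE.
by rewrite fmorph_eq0.
Qed.

Lemma invsqrt_diagonalized : posdefmx G ->
  exists2 W, posdefmx W & W *m W *m G = 1%:M.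
Proof.
move=> pG; have pos j := eigen_gt0 j pG.
have [W hW] := fun_calculus (fun x => (Num.sqrt x)^-1) hG.
exists W; last first.
  apply: (fdiag_inj _ fdiag_mx1).
  rewrite !map_mxM hW hG !fdiagM//; apply: eq_fdiag => j.
  by rewrite -expr2 exprVn sqr_sqrtr ?ltW// mulVf// gt_eqF.
split; first exact: fdiag_sym hW.
move=> v v0; have [w [w0 vv] hw] := quad_weights v.
rewrite (hw _ _ hW).
have : \sum_j w j <> 0 by rewrite -vv; apply/eqP; rewrite gt_eqF// frob2_gt0.
move=> /(psumr_neq0P (fun i _ => w0 i)) [k /andP[Pk wk]].
rewrite (bigD1 k)//= ltr_wpDr ?mulr_gt0 ?invr_gt0 ?sqrtr_gt0//.
by apply: sumr_ge0 => i _; rewrite mulr_ge0// invr_ge0 sqrtr_ge0.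
Qed.

End Diagonalized.

Section Gram.
Context {R : realType}.

Lemma rank_gram m n (M : 'M[R]_(m, n)) : \rank (M^T *m M) = \rank M.
Proof.
apply/eqP; rewrite eqn_leq mxrankM_maxr /= -(mxrank_tr M).
have : (kermx (M^T *m M) <= kermx M^T)%MS.
  apply/sub_kermxP; apply: frob2_eq0.
  by rewrite frob2E mxdot_mulr trmxK -mulmxA mulmx_ker mxdot0r.
move=> /mxrankS; rewrite !mxrank_ker => h.
apply: contraLR h; rewrite -!ltnNge => h; apply: ltn_sub2l => //; exact: leq_trans h (rank_leq_row _).
Qed.

Lemma gram_quad m n (M : 'M[R]_(m, n)) (x : 'rV[R]_n) :
  (x *m (M^T *m M) *m x^T) 0 0 = frob2 (x *m M^T).
Proof. by rewrite frob2E /mxdot /mxtrace big_ord1 trmx_mul trmxK !mulmxA. Qed.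

End Gram.

(** * Singular values from a diagonalized Gram matrix *)

Section Singular.
Context {R : realType} {C : numClosedFieldType} (toC : {rmorphism R -> C}).
Hypothesis conj_toC : forall x, (toC x)^* = toC x.
Hypothesis norm_toC : forall z : C, exists w : R, 0 <= w /\ z * z^* = toC w.
Context {m n : nat} (M : 'M[R]_(m, n)) (U : 'M[C]_n) (lam : 'I_n -> R).
Hypothesis hU : U \is unitarymx.
Hypothesis hG : map_mx toC (M^T *m M) = fdiag toC U lam id.
Hypothesis hs : singular_values M =
  sort (fun x y => y <= x) [seq Num.sqrt (lam j) | j <- enum 'I_n].

Let geT : transitive (fun x y : R => y <= x).
Proof. by move=> a b c h1 h2; apply: le_trans h2 h1. Qed.

Lemma gram_eigen_ge0 j : 0 <= lam j.
Proof. by apply: (eigen_ge0 conj_toC norm_toC hU hG) => v; rewrite gram_quad frob2_ge0. Qed.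

Lemma singular_sorted : sorted (fun x y => y <= x) (singular_values M).
Proof. by rewrite hs; apply: sort_sorted => x y; apply: real_leVge; rewrite num_real. Qed.

Lemma mem_singular j : Num.sqrt (lam j) \in singular_values M.
Proof. by rewrite hs mem_sort; apply/mapP; exists j; rewrite ?mem_enum. Qed.

Lemma count_singular : count (fun x : R => (0 < x)%R) (singular_values M) = \rank M.
Proof.
rewrite -(rank_gram M) (rank_lam hU hG) hs count_sort count_map.
apply: eq_count => j /=; rewrite sqrtr_gt0 lt_neqAle gram_eigen_ge0 andbT.
by rewrite eq_sym.
Qed.

Lemma sigma1_ge0_aux : 0 <= sigma 1 M.
Proof.
rewrite /sigma /=; case E : (singular_values M) => [|x s] //=.
have : x \in singular_values M by rewrite E mem_head.
by rewrite hs mem_sort => /mapP[j _ ->]; apply: sqrtr_ge0.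
Qed.

Lemma le_sigma1 j : Num.sqrt (lam j) <= sigma 1 M.
Proof.
have := mem_singular j; have := singular_sorted; rewrite /sigma /=.
case: (singular_values M) => [|x s] //= hs'; rewrite inE => /orP[/eqP->//|js].
by have /allP/(_ _ js) := order_path_min geT hs'.
Qed.

Lemma sigma1_bound_aux : cbound M (sigma 1 M ^+ 2).
Proof.
rewrite -[M]trmxK; apply: cbound_tr; rewrite trmxK; apply: rbound_row => x.
rewrite -gram_quad; have [w [w0 ->] hw] := quad_weights conj_toC norm_toC lam hU x.
rewrite (hw _ _ hG) mulr_sumr; apply: ler_sum => j _; rewrite ler_wpM2r//.
rewrite -[leLHS]sqr_sqrtr ?gram_eigen_ge0//.
by rewrite ler_pXn2r ?nnegrE ?sqrtr_ge0 ?sigma1_ge0_aux// le_sigma1.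
Qed.

Lemma sigma_rank_gt0_aux : (0 < \rank M)%N -> 0 < sigma (\rank M) M.
Proof.
move=> r0; rewrite /sigma (sorted_nth_gt0 singular_sorted) count_singular.
by rewrite prednK.
Qed.

(** Exactly [\rank M] singular values are positive and they come first, so a positive one has an
    index at most [(\rank M).-1]. *)
Lemma sigma_rank_le j : lam j != 0 -> sigma (\rank M) M <= Num.sqrt (lam j).
Proof.
move=> ej; have js := mem_singular j.
have pj : 0 < Num.sqrt (lam j) by rewrite sqrtr_gt0 lt_neqAle eq_sym ej gram_eigen_ge0.
rewrite /sigma -[leRHS](nth_index 0 js).
have : (index (Num.sqrt (lam j)) (singular_values M) < \rank M)%N.
  by rewrite -count_singular -(sorted_nth_gt0 singular_sorted) nth_index.
set i := index _ _ => hi.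
have hr : (\rank M <= size (singular_values M))%N by rewrite -count_singular count_size.
apply: (sorted_leq_nth geT (fun a => lexx a) 0 singular_sorted); rewrite ?inE.
- exact: leq_trans hi hr.
- by rewrite prednK// (leq_ltn_trans _ hi).
- by rewrite -ltnS prednK// (leq_ltn_trans _ hi).
Qed.

(** The vector x = y M lies in the row space of M. It has no weight on the zero eigenvalues of the
    Gram matrix, because M annihilates the spectral projector F onto them; all other eigenvalues are
    at least [sigma (\rank M) M ^+ 2]. *)
Lemma sigma_rank_bound_aux (y : 'rV[R]_m) : (0 < \rank M)%N ->
  sigma (\rank M) M ^+ 2 * frob2 (y *m M) <= frob2 (y *m M *m M^T).
Proof.
move=> r0; set x := y *m M.
rewrite -gram_quad; have [w [w0 ->] hw] := quad_weights conj_toC norm_toC lam hU x.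
rewrite (hw _ _ hG).
have w_eq0 j : lam j == 0 -> w j = 0.
  pose f (x : R) : R := (x == 0)%:R.
  have [F hF] := fun_calculus hU f hG.
  have FT := fdiag_sym conj_toC hU hF.
  have MF : M *m F = 0.
    apply: frob2_eq0; rewrite -frob2_tr frob2E trmx_mul FT.
    rewrite /mxdot trmx_mul trmxK FT mulmxA -(mulmxA F).
    suff -> : F *m (M^T *m M) *m F = 0 by rewrite mxtrace0.
    apply: (@fdiag_inj _ _ toC _ U lam _ _ (fun=> 0)).
      rewrite !map_mxM -map_mxM hF hG !fdiagM//; apply: eq_fdiag => k.
      by rewrite /f; case: eqP => [->|]; rewrite ?mulr0 ?mul0r.
    rewrite map_mx0 /fdiag; have -> : \row_(j < n) toC 0 = 0 :> 'rV[C]_n.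
      by apply/rowP => k; rewrite !mxE rmorph0.
    by rewrite raddf0 mulmx0 mul0mx.
  move=> ej; have := hw _ _ hF.
  rewrite /x -(mulmxA y) MF mulmx0 mul0mx mxE => /esym/eqP.
  rewrite psumr_eq0; last by move=> k _; rewrite mulr_ge0// /f ler0n.
  by move=> /allP/(_ j (mem_index_enum _)); rewrite /f ej mul1r => /eqP.
rewrite mulr_sumr; apply: ler_sum => j _.
have [e|e] := eqVneq (lam j) 0; first by rewrite (w_eq0 j) ?e// !mulr0.
rewrite ler_wpM2r// -[leRHS]sqr_sqrtr ?gram_eigen_ge0//.
by rewrite ler_pXn2r ?nnegrE ?sqrtr_ge0 ?sigma_rank_le// ltW// sigma_rank_gt0_aux.
Qed.

End Singular.

Section RealSpectral.
Import complex.
Context {R : realType}.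
Local Notation C := (complex R).
Local Notation toC := (real_complex R).

Lemma conj_real_complex (x : R) : (toC x)^* = toC x :> C.
Proof. exact: conjc_real. Qed.

Lemma norm_real_complex (z : C) : exists w : R, 0 <= w /\ z * z^* = toC w.
Proof.
exists (complex.Re z ^+ 2 + complex.Im z ^+ 2).
by split; [rewrite addr_ge0 ?sqr_ge0|rewrite add_Re2_Im2 sqr_normc].
Qed.

(** Over R[i] the matrix is Hermitian, so its eigenvalues are real and taking their real parts loses
    nothing. *)
Lemma spectral_fdiag n (G : 'M[R]_n) : G^T = G ->
  map_mx toC G = fdiag toC (spectralmx (map_mx toC G))
    (fun j => complex.Re (spectral_diag (map_mx toC G) 0 j)) id.
Proof.
move=> symG; have hGc : map_mx toC G \is hermsymmx.
  by apply/is_hermitianmxP; rewrite expr0 scale1r (real_conj conj_real_complex) symG.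
have h := hermitian_spectral_diag_real hGc.
have e (D : 'rV[C]_n) : D \is a mxOver Num.real -> \row_j toC (complex.Re (D 0 j)) = D.
  by move=> /mxOverP hD; apply/rowP => j; rewrite mxE; apply: RRe_real (hD 0 j).
rewrite /fdiag /= (e _ h).
by have /orthomx_spectralP := hermitian_normalmx hGc.
Qed.

Lemma invsqrt_exists n (G : 'M[R]_n) : posdefmx G ->
  exists2 W, posdefmx W & W *m W *m G = 1%:M.
Proof.
move=> pG; apply: (invsqrt_diagonalized conj_real_complex norm_real_complex _ (spectral_fdiag pG.1) pG).
exact: spectral_unitarymx.
Qed.

Lemma sigma1_ge0 m n (M : 'M[R]_(m, n)) : 0 <= sigma 1 M.
Proof. exact: sigma1_ge0_aux (erefl _). Qed.

Lemma sigma1_bound m n (M : 'M[R]_(m, n)) : cbound M (sigma 1 M ^+ 2).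
Proof.
apply: (sigma1_bound_aux conj_real_complex norm_real_complex _
  (spectral_fdiag _) (erefl _)); last first.
  by rewrite trmx_mul trmxK.
exact: spectral_unitarymx.
Qed.

Lemma sigma_rank_gt0 m n (M : 'M[R]_(m, n)) :
  (0 < \rank M)%N -> 0 < sigma (\rank M) M.
Proof.
apply: (sigma_rank_gt0_aux conj_real_complex norm_real_complex _
  (spectral_fdiag _) (erefl _)); last first.
  by rewrite trmx_mul trmxK.
exact: spectral_unitarymx.
Qed.

Lemma sigma_rank_bound m n (M : 'M[R]_(m, n)) (y : 'rV[R]_m) : (0 < \rank M)%N ->
  sigma (\rank M) M ^+ 2 * frob2 (y *m M) <= frob2 (y *m M *m M^T).
Proof.
apply: (sigma_rank_bound_aux conj_real_complex norm_real_complex _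
  (spectral_fdiag _) (erefl _)); last first.
  by rewrite trmx_mul trmxK.
exact: spectral_unitarymx.
Qed.

End RealSpectral.

(** * Polar factors and retractions *)

Section Polar.
Context {R : realType}.

Lemma posdef_psd n (W : 'M[R]_n) : posdefmx W -> forall p (x : 'M[R]_(p, n)),
  0 <= mxdot (x *m W) x.
Proof.
move=> [_ h] p x; rewrite /mxdot /mxtrace; apply: sumr_ge0 => i _.
have -> : (x *m W *m x^T) i i = (row i x *m W *m (row i x)^T) 0 0.
  by rewrite -row_mul [LHS]mxE [RHS]mxE; apply: eq_bigr => j _; rewrite !mxE.
have [->|/h/ltW//] := eqVneq (row i x) 0.
by rewrite mul0mx mul0mx mxE.
Qed.

Section Sqrt.
Context {n : nat} (W G : 'M[R]_n) (pW : posdefmx W) (hWG : W *m W *m G = 1%:M).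
(** W is G^(-1/2), so S is the square root of G; its properties follow algebraically from those of
    W. *)
Let S := W *m G.

Lemma invsqrt_mulS : W *m S = 1%:M. Proof. by rewrite mulmxA. Qed.
Lemma sqrt_mulW : S *m W = 1%:M. Proof. exact/mulmx1C/invsqrt_mulS. Qed.

Lemma sqrt_sqr : S *m S = G.
Proof.
have h : S *m S *m (W *m W) = 1%:M.
  by rewrite mulmxA -(mulmxA S) sqrt_mulW mulmx1 sqrt_mulW.
by rewrite -[LHS]mulmx1 -hWG mulmxA h mul1mx.
Qed.

Lemma sqrt_sym : S^T = S.
Proof.
have h : S^T *m W = 1%:M.
  by have := congr1 trmx invsqrt_mulS; rewrite trmx_mul trmx1 pW.1.
by rewrite -[LHS]mulmx1 -invsqrt_mulS mulmxA h mul1mx.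
Qed.

Lemma sqrt_psd p (x : 'M[R]_(p, n)) : 0 <= mxdot (x *m S) x.
Proof.
have {2}-> : x = x *m S *m W by rewrite -mulmxA sqrt_mulW mulmx1.
by rewrite mxdotC; apply: posdef_psd.
Qed.

(** Expanding <(x - x W) S, x - x W> >= 0 gives <x S, x> >= 2 |x|^2 - <x, x W>, and G >= 1 implies
    |x W| <= |x|. *)
Lemma sqrt_ge1 : (forall p (x : 'M[R]_(p, n)), frob2 x <= mxdot (x *m G) x) ->
  forall p (x : 'M[R]_(p, n)), frob2 x <= mxdot (x *m S) x.
Proof.
move=> h p x; have := sqrt_psd (x - x *m W).
have e1 : mxdot (x *m S) (x *m W) = frob2 x.
  by rewrite mxdotC mxdot_mulr pW.1 -mulmxA sqrt_mulW mulmx1 -frob2E.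
have e2 : mxdot x (x *m W) <= frob2 x.
  have h1 : frob2 (x *m W) <= frob2 x.
    apply: le_trans (h _ _) _; rewrite mxdotC mxdot_mulr pW.1 -/S.
    by rewrite -(mulmxA x) -mulmxA -/S sqrt_mulW mulmx1 -frob2E.
  apply: le_trans (mxdot_CS _ _) _.
  rewrite -(sqr_fnorm x) expr2 ler_wpM2l ?fnorm_ge0//.
  by rewrite /fnorm ler_sqrt// frob2_ge0.
rewrite mulmxBl -mulmxA invsqrt_mulS mulmx1 mxdotBl !mxdotBr e1 -frob2E.
lra.
Qed.

(** 1 - G = (1 - S) (1 + S), and multiplication by 1 + S with S >= 0 does not decrease the norm. *)
Lemma sub1_sqrt_le : frob2 (1%:M - S) <= frob2 (1%:M - G).
Proof.
have -> : 1%:M - G = (1%:M - S) *m (1%:M + S).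
  by rewrite mulmxDr mulmx1 mulmxBl mul1mx sqrt_sqr addrA subrK.
rewrite mulmxDr mulmx1 (frob2D (1%:M - S)) (mxdotC (1%:M - S)).
have h1 := sqrt_psd (1%:M - S); have h2 := frob2_ge0 ((1%:M - S) *m S).
lra.
Qed.

End Sqrt.

(** P = M (M^T M)^(-1/2). The last bound controls the distance of S from the identity by the defect
    of orthogonality of M, which is quadratic in the interface error in the application. *)
Lemma polar_factor n (M : 'M[R]_n) : posdefmx (M^T *m M) ->
  exists P : 'M[R]_n, exists S : 'M[R]_n, [/\ P^T *m P = 1%:M, P *m S = M,
    M^T *m P = S, S^T = S & frob2 (1%:M - S) <= frob2 (1%:M - M^T *m M)].
Proof.
move=> pG; have [W pW hW] := invsqrt_exists pG.
exists (M *m W), (W *m (M^T *m M)).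
have sS := sqrt_sym pW hW; have SW := sqrt_mulW hW.
have GW : M^T *m M *m W = W *m (M^T *m M).
  by rewrite -[RHS]sS trmx_mul pW.1 trmx_mul trmxK.
split => //.
- by rewrite trmx_mul pW.1 !mulmxA -!mulmxA (mulmxA M^T) (mulmxA W).
- by rewrite -mulmxA (mulmxA W) hW mulmx1.
- by rewrite mulmxA.
- exact: sub1_sqrt_le.
Qed.

(* With [Y = T S] polar and [F = S - 1 >= 0],
   [|Y - U|^2 - |T - U|^2 = |F|^2 + <(T - U) F, T - U>]. *)
Lemma retr_spec m n (Y U : 'M[R]_(m, n)) : U^T *m U = 1%:M ->
  (forall p (x : 'M[R]_(p, n)), frob2 x <= mxdot (x *m (Y^T *m Y)) x) ->
  (retr Y)^T *m retr Y = 1%:M /\ frob2 (retr Y - U) <= frob2 (Y - U).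
Proof.
move=> UU hY; set G := Y^T *m Y.
have pG : posdefmx G.
  split; first by rewrite /G trmx_mul trmxK.
  move=> v v0; apply: lt_le_trans (_ : frob2 v <= _); first by rewrite frob2_gt0.
  by apply: le_trans (hY _ _) _; rewrite /mxdot /mxtrace big_ord1.
have [W [pW hW] eW] : exists2 W, posdefmx W /\ W *m W *m G = 1%:M & invsqrtmx G = W.
  have [W0 p0 h0] := invsqrt_exists pG; exists (invsqrtmx G) => //.
  by rewrite /invsqrtmx; case: xgetP => [W _ //|/(_ W0)[]].
rewrite /retr -/G eW; set T := Y *m W; set S := W *m G.
have SW : S *m W = 1%:M := sqrt_mulW hW.
have sS : S^T = S := sqrt_sym pW hW.
have TT : T^T *m T = 1%:M.
  by rewrite /T trmx_mul pW.1 mulmxA -(mulmxA W) -/G.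
have YE : Y = T *m S.
  by rewrite /T -mulmxA (invsqrt_mulS hW) mulmx1.
split => //.
have iso (A B : 'M[R]_n) (V : 'M[R]_(m, n)) : V^T *m V = 1%:M ->
    mxdot (V *m A) (V *m B) = mxdot A B.
  by move=> VV; rewrite mxdot_mull mulmxA VV mul1mx.
pose F := S - 1%:M.
have SF : S = 1%:M + F by rewrite /F addrC subrK.
have FT : F^T = F by rewrite /F linearB /= sS trmx1.
have psdF p (x : 'M[R]_(p, n)) : 0 <= mxdot (x *m F) x.
  rewrite /F mulmxBr mulmx1 mxdotBl -frob2E subr_ge0.
  exact: (sqrt_ge1 pW hW).
have h1 := psdF _ (T - U).
have eT : mxdot (T *m F) T = mxdot F 1%:M by rewrite -{2}(mulmx1 T) iso.
have eU : mxdot (U *m F) U = mxdot F 1%:M by rewrite -{2}(mulmx1 U) iso.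
have eC : mxdot (U *m F) T = mxdot (T *m F) U.
  by rewrite mxdot_mulr FT mxdotC.
move: h1; rewrite mulmxBl mxdotBl !mxdotBr eT eU eC => h1.
rewrite {1}YE !frob2B SF mulmxDr mulmx1 frob2D mxdotDl (frob2E (T *m F)) iso//.
rewrite -frob2E (mxdotC T (T *m F)) eT.
by have := frob2_ge0 F; lra.
Qed.

(* A QR decomposition for possibly rank-deficient [L]: [Q] is only a partial
   isometry, whose initial space contains the range of [S]. *)
Lemma partial_isometry_factor m n (L : 'M[R]_(m, n)) :
  exists Q : 'M[R]_(m, n), exists S : 'M[R]_n,
    [/\ Q *m S = L, cbound Q 1 & forall p (x : 'M[R]_(n, p)),
      frob2 (Q *m (S *m x)) = frob2 (S *m x)].
Proof.
pose C := col_base L; pose rho := \rank L.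
have pG : posdefmx (C^T *m C).
  split; first by rewrite trmx_mul trmxK.
  move=> v v0; rewrite gram_quad frob2_gt0; apply: contraNneq v0 => h.
  apply/eqP; have hC : row_free C^T.
    by rewrite /row_free mxrank_tr; exact: col_base_full.
  by move/(congr1 (mulmx^~ (pinvmx C^T))): h; rewrite mulmxKp// mul0mx.
have [W pW hW] := invsqrt_exists pG.
(* Pads the orthonormal basis [Q0] of the column space with zero columns, so that Q has the shape of
   L. *)
pose J : 'M[R]_(rho, n) := pid_mx rho.
have JJ : J *m J^T = 1%:M.
  rewrite tr_pid_mx mul_pid_mx minnn (minn_idPr (rank_leq_col L)).
  exact: pid_mx_1.
pose Q0 := C *m W.
have QQ : Q0^T *m Q0 = 1%:M.
  rewrite trmx_mul pW.1 mulmxA -(mulmxA W).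
  exact: (sqrt_mulW hW).
exists (Q0 *m J), (J^T *m (W *m (C^T *m C) *m row_base L)); split.
- rewrite mulmxA -(mulmxA Q0) JJ mulmx1 mulmxA /Q0 -(mulmxA C) (mulmxA W) hW.
  by rewrite mulmx1 mulmx_base.
- rewrite -[1]mulr1; apply: cboundM => //; first exact: cbound_orth.
  rewrite -[J]trmxK; apply: cbound_tr; apply: cbound_rbound => //.
  by apply: cbound_orth; rewrite trmxK.
- move=> p x; set B := _ *m row_base L.
  rewrite -(mulmxA J^T) -(mulmxA Q0 J) (mulmxA J) JJ mul1mx (cbound_isom _ QQ).
  by rewrite [RHS]cbound_isom ?trmxK.
Qed.

(** As L and U both have orthonormal columns, (L - U)^T L + L^T (L - U) = (L - U)^T (L - U): the
    normal part of L - U is quadratic in it. *)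
Lemma stiefel_proj_normal m n (L U : 'M[R]_(m, n)) : L^T *m L = 1%:M ->
  U^T *m U = 1%:M ->
  stiefel_proj L (L - U) = L - U - 2^-1 *: (L *m ((L - U)^T *m (L - U))).
Proof.
move=> LL UU; rewrite /stiefel_proj; congr (_ - _ *: (_ *m _)).
rewrite linearB /= mulmxBl !mulmxBr !mulmxBl LL UU.
by rewrite opprB addrACA.
Qed.

Lemma stiefel_proj_selfadjoint m n (L A B : 'M[R]_(m, n)) :
  mxdot (stiefel_proj L A) B = mxdot A (stiefel_proj L B).
Proof.
rewrite /stiefel_proj mxdotBl mxdotBr mxdotZl mxdotZr; congr (_ - _ * _).
rewrite mxdot_mull (mxdotC A) mxdot_mull 2!mxdotDl; congr (_ + _).
  by rewrite -mxdot_tr !trmx_mul !trmxK mxdotC.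
by rewrite mxdotC.
Qed.

Lemma stiefel_proj_tangent m n (L B : 'M[R]_(m, n)) : L^T *m L = 1%:M ->
  (stiefel_proj L B)^T *m L + L^T *m stiefel_proj L B = 0.
Proof.
move=> LL; set T := stiefel_proj L B.
have -> : T = B - 2^-1 *: (L *m (B^T *m L + L^T *m B)) by [].
set K := B^T *m L + L^T *m B.
have KT : K^T = K by rewrite linearD /= !trmx_mul !trmxK addrC.
rewrite linearB /= linearZ /= mulmxBl mulmxBr trmx_mul KT -scalemxAl -scalemxAr.
rewrite -mulmxA LL mulmx1 mulmxA LL mul1mx addrACA -/K -opprD -scalerDl.
by rewrite -div1r -splitr scale1r addrN.
Qed.

(** The projection is self-adjoint and fixes tangent vectors, so <B, T> = |T|^2 for the image T of
    B. *)
Lemma stiefel_proj_le m n (L B : 'M[R]_(m, n)) : L^T *m L = 1%:M ->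
  frob2 (stiefel_proj L B) <= frob2 B.
Proof.
move=> LL; set T := stiefel_proj L B.
have T0 : T^T *m L + L^T *m T = 0 := stiefel_proj_tangent B LL.
have TT : mxdot B T = frob2 T.
  have e : stiefel_proj L T = T by rewrite {1}/stiefel_proj T0 mulmx0 scaler0 subr0.
  by rewrite frob2E {2}/T stiefel_proj_selfadjoint e.
by have := frob2_ge0 (B - T); rewrite frob2B TT; lra.
Qed.

End Polar.

(** * Tensors in TT format *)

Notation mindex n d := {dffun forall k : 'I_n, 'I_(d (nat_of_ord k))}.

Lemma card_mindex n (d : nat -> nat) : #|{: mindex n d}| = (\prod_(j < n) d j)%N.
Proof.
rewrite card_dep_ffun foldrE big_image /=; apply: eq_bigr => j _.
exact: card_ord.
Qed.

Lemma sum_enum_val (V : nmodType) (T : finType) (F : T -> V) :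
  \sum_(i < #|{: T}|) F (enum_val i) = \sum_x F x.
Proof. by rewrite -(big_enum_val F); apply: eq_bigl. Qed.

Section Restriction.
Context {I J : finType} (f : I -> nat) (g : J -> I) (d : nat -> nat).
Hypothesis bij_g : bijective g.

Definition restr (a : {dffun forall i : I, 'I_(d (f i))}) :
  {dffun forall j : J, 'I_(d (f (g j)))} := [ffun j => a (g j)].

Lemma restr_bij : bijective restr.
Proof.
have [g' gK g'K] := bij_g.
have inj : injective restr.
  move=> a b /ffunP h; apply/ffunP => i; rewrite -(g'K i).
  by have := h (g' i); rewrite !ffunE.
apply: (inj_card_bij inj).
rewrite !card_dep_ffun !foldrE !big_image /= [leqRHS](reindex g) /=.
  by apply: eq_leq; apply: eq_bigr => j _; rewrite !card_ord.
exact: onW_bij.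
Qed.

Lemma sum_restr (V : nmodType) (F : {dffun forall j : J, 'I_(d (f (g j)))} -> V) :
  \sum_a F (restr a) = \sum_c F c.
Proof. by rewrite [RHS](reindex restr)//; exact: onW_bij restr_bij. Qed.

End Restriction.

Definition mprefix d n (s : mindex n.+1 d) : mindex n d :=
  [ffun j : 'I_n => s (widen_ord (leqnSn n) j)].

Lemma sum_mindexS (V : nmodType) d n (F : mindex n d -> 'I_(d n) -> V) :
  \sum_(s : mindex n.+1 d) F (mprefix s) (s ord_max) = \sum_p \sum_j F p j.
Proof.
pose h (s : mindex n.+1 d) : mindex n d * 'I_(d n) := (mprefix s, s ord_max).
have inj : injective h.
  move=> s s' [/ffunP e1 e2]; apply/ffunP => j.
  have [jn|jn] := ltnP j n.
    have -> : j = widen_ord (leqnSn n) (Ordinal jn) by apply: val_inj.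
    by have := e1 (Ordinal jn); rewrite !ffunE.
  have -> : j = ord_max by apply/val_inj/eqP; rewrite eqn_leq jn -ltnS ltn_ord.
  by [].
have hb : bijective h.
  apply: (inj_card_bij inj).
  by rewrite card_prod !card_mindex big_ord_recr /= card_ord.
rewrite pair_big /= [RHS](reindex h)//; exact: onW_bij.
Qed.

Lemma sum_mindex0 (V : nmodType) d (F : V) : \sum_(s : mindex 0 d) F = F.
Proof. by rewrite sumr_const card_mindex big_ord0. Qed.

Section Cores.
Context {R : realType} {d : nat -> nat}.

(** Indexed by all natural numbers, so that partial products can be defined by recursion; [TT N]
    depends only on the cores below N. *)
Definition cores (q : nat -> nat) := forall k, 'I_(d k) -> 'M[R]_(q k, q k.+1).

Fixpoint rows (k : nat) : nat :=
  if k is k'.+1 then (\sum_(s < d k') rows k')%N else 1%N.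
Fixpoint cols (n k : nat) : nat :=
  if n is n'.+1 then (\sum_(s < d k) cols n' k.+1)%N else 1%N.

(* With [Σ_{a,b}] as in [tt_tensor], the k-th unfolding of the tensor with cores
   [C] is [pre C k *m suf C (N - k) k], up to the enumeration of its indices. *)
Fixpoint pre q (C : cores q) (k : nat) : 'M[R]_(rows k, q k) :=
  if k is k'.+1 then \mxcol_(s < d k') (pre C k' *m C k' s) else const_mx 1.
Fixpoint suf q (C : cores q) (n k : nat) : 'M[R]_(q k, cols n k) :=
  if n is n'.+1 then \mxrow_(s < d k) (C k s *m suf C n' k.+1) else const_mx 1.

Definition chain q (C : cores q) k (s : mindex k d) : 'M[R]_(q 0%N, q k) :=
  chain_mx (fun j : 'I_k => C j (s j)).
(** The row of the left interface matrix at the multi-index s; the factor [const_mx 1] performs the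
    sum over a of [tt_tensor]. *)
Definition lvec q (C : cores q) k (s : mindex k d) : 'rV[R]_(q k) :=
  const_mx 1 *m chain C s.
Definition TT q N (C : cores q) : tensor R N d :=
  [ffun s : mindex N d => \sum_a \sum_b chain C s a b].

Lemma chainS q (C : cores q) k (s : mindex k.+1 d) :
  chain C s = chain C (mprefix s) *m C k (s ord_max).
Proof.
rewrite /chain /=; congr (chain_mx _ *m _); apply: functional_extensionality_dep => j.
by rewrite ffunE.
Qed.

Lemma lvec0 q (C : cores q) (s : mindex 0 d) : lvec C s = const_mx 1.
Proof. by rewrite /lvec /chain /= mulmx1. Qed.

Lemma lvecS q (C : cores q) k (s : mindex k.+1 d) :
  lvec C s = lvec C (mprefix s) *m C k (s ord_max).
Proof. by rewrite /lvec chainS mulmxA. Qed.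

Lemma TTE q N (C : cores q) (s : mindex N d) :
  TT N C s = (lvec C s *m (const_mx 1 : 'cV_(q N))) 0 0 :> R.
Proof.
rewrite ffunE !mxE exchange_big /=; apply: eq_bigr => b _.
by rewrite !mxE mulr1; apply: eq_bigr => a _; rewrite !mxE mul1r.
Qed.

(** The rows of [pre C k] are the vectors [lvec C s] in some order, and a Gram matrix does not
    depend on that order. *)
Lemma pre_gram q q' (C : cores q) (C' : cores q') k :
  \sum_s (lvec C s)^T *m lvec C' s = (pre C k)^T *m pre C' k.
Proof.
elim: k => [|k IH].
  under eq_bigr do rewrite !lvec0.
  by rewrite sum_mindex0.
under eq_bigr do rewrite !lvecS trmx_mul.
rewrite (sum_mindexS (fun p j => (C k j)^T *m (lvec C p)^T *m (lvec C' p *m C' k j))).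
rewrite exchange_big /= tr_mxcol mul_mxrow_mxcol; apply: eq_bigr => j _.
rewrite trmx_mul mulmxA -(mulmxA _ (pre C k)^T) -IH mulmx_sumr mulmx_suml.
by apply: eq_bigr => p _; rewrite !mulmxA.
Qed.

Definition tip N (T T' : tensor R N d) : R := \sum_s (T s : R) * T' s.

(** The inner product can be read off any unfolding. Associativity moves core k from the right
    interface to the left one; the induction is on the number n of cores to the right of the cut. *)
Lemma tip_TT q q' N (C : cores q) (C' : cores q') n k : (n + k)%N = N ->
  tip (TT N C) (TT N C') = mxdot (pre C k *m suf C n k) (pre C' k *m suf C' n k).
Proof.
elim: n k => [|n IH] k e.
  rewrite add0n in e; subst k; rewrite /= mxdot_mull mulmxA -pre_gram mulmx_suml.
  rewrite mxdot_sumr; apply: eq_bigr => s _.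
  by rewrite !TTE -mulmxA -[X in X *m (_ *m _)]trmxK -mxdot_mull trmxK mxdotE !big_ord1.
rewrite (IH k.+1) -?e ?addnS// !mul_mxrow !mxcol_mul mxdot_mxcol mxdot_mxrow.
by apply: eq_bigr => s _; rewrite !mulmxA.
Qed.

Lemma tnorm2E N (T : tensor R N d) : tnorm2 T = tip T T.
Proof. by apply: eq_bigr => s _; rewrite expr2. Qed.

Lemma tipDl N (T T' U : tensor R N d) : tip (T + T') U = tip T U + tip T' U.
Proof. by rewrite -big_split; apply: eq_bigr => s _; rewrite ffunE mulrDl. Qed.

Lemma tipC N (T U : tensor R N d) : tip T U = tip U T.
Proof. by apply: eq_bigr => s _; rewrite mulrC. Qed.

Lemma tipZl N a (T U : tensor R N d) : tip (a *: T) U = a * tip T U.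
Proof. by rewrite mulr_sumr; apply: eq_bigr => s _; rewrite ffunE mulrA. Qed.

Lemma tnorm2D N (T U : tensor R N d) : tnorm2 (T + U) = tnorm2 T + 2 * tip T U + tnorm2 U.
Proof. by rewrite !tnorm2E tipDl !(tipC _ (T + U)) !tipDl (tipC U T); ring. Qed.

Lemma tnorm2Z N a (T : tensor R N d) : tnorm2 (a *: T) = a ^+ 2 * tnorm2 T.
Proof. by rewrite !tnorm2E tipZl tipC tipZl mulrA expr2. Qed.

Lemma tnorm2B N (T U : tensor R N d) : tnorm2 (T - U) = tnorm2 T - 2 * tip T U + tnorm2 U.
Proof.
by rewrite tnorm2D -scaleN1r tnorm2Z tipC tipZl (tipC U); ring.
Qed.

Definition tvec N (T : tensor R N d) : 'rV[R]_#|{: mindex N d}| := \row_j T (enum_val j).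

Lemma frob2_tvec N (T : tensor R N d) : frob2 (tvec T) = tnorm2 T.
Proof.
rewrite /frob2 big_ord1 /tnorm2 -[RHS]sum_enum_val.
by apply: eq_bigr => j _; rewrite mxE.
Qed.

Lemma tvecD N (T U : tensor R N d) : tvec (T + U) = tvec T + tvec U.
Proof. by apply/rowP => j; rewrite !mxE ffunE. Qed.

Definition tnorm N (T : tensor R N d) : R := Num.sqrt (tnorm2 T).

Lemma tnorm_fnorm N (T : tensor R N d) : tnorm T = fnorm (tvec T).
Proof. by rewrite /fnorm frob2_tvec. Qed.

Lemma tnorm2_ge0 N (T : tensor R N d) : 0 <= tnorm2 T.
Proof. by rewrite -frob2_tvec frob2_ge0. Qed.

Lemma tnorm_ge0 N (T : tensor R N d) : 0 <= tnorm T.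
Proof. exact: sqrtr_ge0. Qed.

Lemma sqr_tnorm N (T : tensor R N d) : tnorm T ^+ 2 = tnorm2 T.
Proof. by rewrite sqr_sqrtr// tnorm2_ge0. Qed.

Lemma tnormD N (T U : tensor R N d) : tnorm (T + U) <= tnorm T + tnorm U.
Proof. by rewrite !tnorm_fnorm tvecD fnormD. Qed.

Lemma tnorm2_0 N : tnorm2 (0 : tensor R N d) = 0.
Proof. by apply: big1 => s _; rewrite ffunE expr0n. Qed.

Lemma tnorm2_eq0 N (T : tensor R N d) : tnorm2 T = 0 -> T = 0.
Proof.
move=> /eqP; rewrite psumr_eq0 => [/allP h|s _]; last exact: sqr_ge0.
apply/ffunP => s; rewrite ffunE; apply/eqP.
by have := h s (mem_index_enum _); rewrite implyTb sqrf_eq0.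
Qed.

Lemma tnorm_sum N (I : finType) (P : pred I) (F : I -> tensor R N d) :
  tnorm (\sum_(i | P i) F i) <= \sum_(i | P i) tnorm (F i).
Proof.
elim/big_rec2: _ => [|i x y _ h]; first by rewrite /tnorm tnorm2_0 sqrtr0.
by rewrite (le_trans (tnormD _ _))// lerD2l.
Qed.

Lemma tnorm2_TT q N (C : cores q) n k : (n + k)%N = N ->
  tnorm2 (TT N C) = frob2 (pre C k *m suf C n k).
Proof. by move=> e; rewrite tnorm2E (tip_TT _ _ e) frob2E. Qed.

Lemma tnorm2_TTB q q' N (C : cores q) (C' : cores q') n k : (n + k)%N = N ->
  tnorm2 (TT N C - TT N C') = frob2 (pre C k *m suf C n k - pre C' k *m suf C' n k).
Proof.
by move=> e; rewrite tnorm2B !(tnorm2_TT _ e) (tip_TT _ _ e) frob2B.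
Qed.

Lemma pre_ext q (C C' : cores q) k :
  (forall j, (j < k)%N -> C j = C' j) -> pre C k = pre C' k.
Proof.
elim: k => [//|k IH] h /=; rewrite IH => [|j jk]; last by rewrite h// ltnW.
by rewrite h.
Qed.

Lemma suf_ext q (C C' : cores q) n k :
  (forall j, (k <= j < n + k)%N -> C j = C' j) -> suf C n k = suf C' n k.
Proof.
elim: n k => [//|n IH] k h /=; rewrite (IH k.+1) => [|j /andP[h1 h2]].
  by rewrite h// leqnn addSn ltnS leq_addl.
by rewrite h// (ltnW h1) addSnnS.
Qed.

Lemma lvec_ext q (C C' : cores q) k (s : mindex k d) :
  (forall j, (j < k)%N -> C j = C' j) -> lvec C s = lvec C' s.
Proof.
elim: k s => [s h|k IH s h]; first by rewrite !lvec0.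
by rewrite !lvecS h// (IH (mprefix s))// => j jk; rewrite h// ltnW.
Qed.

Lemma TT_ext q N (C C' : cores q) :
  (forall j, (j < N)%N -> C j = C' j) -> TT N C = TT N C'.
Proof.
by move=> h; apply/ffunP => s; rewrite !TTE (lvec_ext _ h).
Qed.

(** For D = X - Y these are the terms of the telescoping expansion of [TT N X - TT N Y]; for Y = X
    they are the partial derivatives of [TT N] at X along D. *)
Definition mix q i (X D Y : cores q) : cores q :=
  fun k => if (k < i)%N then X k else if k == i then D k else Y k.

Arguments mix {q} i X D Y k _.

Lemma mix_lt q i (X D Y : cores q) k : (k < i)%N -> mix i X D Y k = X k.
Proof. by rewrite /mix => ->. Qed.

Lemma mix_eq q i (X D Y : cores q) : mix i X D Y i = D i.
Proof. by rewrite /mix ltnn eqxx. Qed.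

Lemma mix_gt q i (X D Y : cores q) k : (i < k)%N -> mix i X D Y k = Y k.
Proof. by move=> ik; rewrite /mix ltnNge (ltnW ik) /= gtn_eqF. Qed.

Lemma lvec_telescope q (X Y : cores q) k (s : mindex k d) :
  lvec X s - lvec Y s =
  \sum_(i < k) lvec (mix i X (fun j t => X j t - Y j t) Y) s.
Proof.
elim: k s => [s|k IH s]; first by rewrite !lvec0 subrr big_ord0.
rewrite big_ord_recr /= !lvecS mix_eq.
rewrite (lvec_ext (C := mix k _ _ _) (C' := X)); last by move=> j jk; rewrite mix_lt.
under eq_bigr => i _ do rewrite lvecS mix_gt//.
by rewrite -mulmx_suml -IH mulmxBl mulmxBr addrC addrA subrK.
Qed.

Lemma TT_telescope q N (X Y : cores q) :
  TT N X - TT N Y = \sum_(i < N) TT N (mix i X (fun j t => X j t - Y j t) Y).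
Proof.
apply/ffunP => s; rewrite sum_ffunE !ffunE.
have h (C : cores q) : \sum_a \sum_b chain C s a b = TT N C s by rewrite ffunE.
rewrite !h; under eq_bigr do rewrite TTE.
rewrite -summxE -mulmx_suml -lvec_telescope mulmxBl !TTE.
by move: (lvec X s *m _) (lvec Y s *m _) => A B; rewrite !mxE.
Qed.

Lemma lvec_mix_linear q i (X D D' Y : cores q) a k (s : mindex k d) : (i < k)%N ->
  lvec (mix i X (fun j t => a *: D j t + D' j t) Y) s =
  a *: lvec (mix i X D Y) s + lvec (mix i X D' Y) s.
Proof.
elim: k s => [//|k IH s]; rewrite ltnS leq_eqVlt => /orP[/eqP->|ik].
  rewrite !lvecS !mix_eq !(lvec_ext (C := mix k _ _ _) (C' := X));
    try by move=> j jk; rewrite mix_lt.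
  by rewrite mulmxDr scalemxAr.
by rewrite !lvecS IH// !mix_gt// mulmxDl scalemxAl.
Qed.

Lemma TT_mix_linear q N i (X D D' Y : cores q) a : (i < N)%N ->
  TT N (mix i X (fun j t => a *: D j t + D' j t) Y) =
  a *: TT N (mix i X D Y) + TT N (mix i X D' Y).
Proof.
move=> iN; apply/ffunP => s; rewrite TTE lvec_mix_linear// mulmxDl -scalemxAl.
have -> : (a *: TT N (mix i X D Y) + TT N (mix i X D' Y)) s =
    a * TT N (mix i X D Y) s + TT N (mix i X D' Y) s by rewrite !ffunE.
by rewrite !TTE; move: (lvec _ s *m _) (lvec _ s *m _) => A B; rewrite !mxE.
Qed.

Lemma tnorm2_TT_le q N (C : cores q) n k a b : (n + k.+1)%N = N -> 0 <= a -> 0 <= b ->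
  cbound (pre C k) a -> rbound (suf C n k.+1) b ->
  tnorm2 (TT N C) <= a * b * \sum_s frob2 (C k s).
Proof.
move=> e a0 b0 ha hb; rewrite (tnorm2_TT _ e) (le_trans (hb _ _))//.
rewrite (mulrC a) -mulrA ler_wpM2l//= frob2_mxcol mulr_sumr.
by apply: ler_sum => s _; exact: ha.
Qed.

End Cores.

Arguments mix {R d q} i X D Y k _.

(** Stated for an arbitrary reflection proof, so that it can be destructed. It evaluates the matches
    on [idP] in [glue] and in the extensions of families from ['I_N] to all naturals. *)
Lemma reflect_true V (P : Prop) b (r : reflect P b) (F : P -> V) (G : ~ P -> V) p :
  (forall p' : P, p' = p) ->
  match r with ReflectT h => F h | ReflectF h => G h end = F p.
Proof. by move=> h; case: r => [p'|/(_ p)//]; rewrite (h p'). Qed.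

Lemma reflect_false V (P : Prop) b (r : reflect P b) (F : P -> V) (G : ~ P -> V) x :
  ~ P -> (forall p, G p = x) ->
  match r with ReflectT h => F h | ReflectF h => G h end = x.
Proof. by move=> np h; case: r => [/np//|p']; rewrite h. Qed.

(** * Unfoldings and interface matrices *)

Section Unfolding.
Context {R : realType} {d : nat -> nat} {q : nat -> nat} (C : @cores R d q).
Arguments C : clear implicits.

Section Split.
Context {n i : nat}.

Lemma ltn_addR (j : 'I_n) : (j + i < n + i)%N. Proof. by rewrite ltn_add2r. Qed.

Definition idxL (j : 'I_i) : {k : 'I_(n + i) | (k < i)%N} :=
  exist _ (widen_ord (leq_addl n i) j) (ltn_ord j).
Lemma idxR_proof (j : 'I_n) : ~~ (Ordinal (ltn_addR j) < i)%N.
Proof. by rewrite -leqNgt leq_addl. Qed.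
Definition idxR (j : 'I_n) : {k : 'I_(n + i) | ~~ (k < i)%N} :=
  exist _ (Ordinal (ltn_addR j)) (idxR_proof j).

Lemma idxL_bij : bijective idxL.
Proof.
have h (k : {k : 'I_(n + i) | (k < i)%N}) : (val k < i)%N := valP k.
exists (fun k => Ordinal (h k)) => [j|k]; first exact: val_inj.
by do 2! apply: val_inj.
Qed.

Lemma idxR_bij : bijective idxR.
Proof.
have h (k : {k : 'I_(n + i) | ~~ (k < i)%N}) : (val k - i < n)%N.
  by have := valP k; have := ltn_ord (val k); lia.
exists (fun k => Ordinal (h k)) => [j|k]; first by apply: val_inj; rewrite /= addnK.
by do 2! apply: val_inj => /=; rewrite subnK// leqNgt (valP k).
Qed.

Definition leftpart (s : mindex (n + i) d) : mindex i d :=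
  [ffun j : 'I_i => s (widen_ord (leq_addl n i) j)].
Definition rindex := mindex n (fun j => d (j + i)).
Definition rightpart (s : mindex (n + i) d) : rindex :=
  [ffun j : 'I_n => s (Ordinal (ltn_addR j))].
End Split.

Definition rchain n i (c : @rindex n i) : 'M[R]_(q i, q (n + i)) :=
  @chain_mx R (fun j => q (j + i)) n (fun j : 'I_n => C (j + i)%N (c j)).

Lemma mindex_irr N (s : mindex N d) m (p1 p2 : (m < N)%N) :
  s (Ordinal p1) = s (Ordinal p2) :> 'I_(d m).
Proof. by rewrite (bool_irrelevance p1 p2). Qed.

Lemma chain_split n i (s : mindex (n + i) d) :
  chain C s = chain C (leftpart s) *m rchain (rightpart s).
Proof.
elim: n s => [|n IH] s.
  rewrite /rchain /= mulmx1; congr chain; apply/ffunP => j; rewrite ffunE.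
  by case: j => j hj; exact: mindex_irr.
rewrite chainS IH -mulmxA; congr (chain _ _ *m _).
  by apply/ffunP => j; rewrite !ffunE; exact: mindex_irr.
rewrite /rchain [in RHS]/= ; congr (chain_mx _ *m _).
  apply: functional_extensionality_dep => j; rewrite !ffunE; congr (C _ _); exact: mindex_irr.
by rewrite ffunE; congr (C _ _); exact: mindex_irr.
Qed.

(** The matrix F placed behind n cores, pulled back through them to position k. F is a family
    because the final position n + k appears in another form at each recursive call. *)
Fixpoint backward n k (F : forall j, 'M[R]_(q j)) : 'M[R]_(q k) :=
  if n is n'.+1 then \sum_s C k s *m backward n' k.+1 F *m (C k s)^T else F k.

(** Peels off the last core instead of the first: [suf] grows on the left, [rchain] on the right,
    and their Gram matrices meet in [backward]. *)
Lemma backwardS n k F :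
  backward n k (fun j => \sum_s C j s *m F j.+1 *m (C j s)^T) = backward n.+1 k F.
Proof.
by elim: n k => [//|n IH] k; apply: eq_bigr => s _; congr (_ *m _ *m _); exact: IH.
Qed.

Lemma suf_gram n k :
  suf C n k *m (suf C n k)^T = backward n k (fun j => (const_mx 1 : 'cV_(q j)) *m (const_mx 1)^T).
Proof.
elim: n k => [//|n IH] k.
rewrite /= tr_mxrow mul_mxrow_mxcol; apply: eq_bigr => s _.
by rewrite -IH trmx_mul !mulmxA.
Qed.

Lemma sum_rchain n k (F : forall j, 'M[R]_(q j)) :
  \sum_c rchain (n := n) (i := k) c *m F (n + k)%N *m (rchain c)^T = backward n k F.
Proof.
elim: n F => [|n IH] F.
  under eq_bigr do rewrite /rchain /= trmx1 mulmx1 mul1mx.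
  exact: (@sum_mindex0 _ (fun j => d (j + k)%N) (F k)).
rewrite -backwardS -IH.
have e (c : @rindex n.+1 k) : rchain c = rchain (mprefix c : @rindex n k) *m C (n + k)%N (c ord_max).
  rewrite /rchain [LHS]/=; congr (chain_mx _ *m _).
  by apply: functional_extensionality_dep => j; rewrite ffunE.
under eq_bigr do rewrite e trmx_mul.
rewrite (@sum_mindexS _ (fun j => d (j + k)%N) n (fun p j =>
  rchain p *m C (n + k)%N j *m F (n.+1 + k)%N *m ((C (n + k)%N j)^T *m (rchain p)^T))).
apply: eq_bigr => p _; rewrite mulmx_sumr mulmx_suml; apply: eq_bigr => j _.
by rewrite !mulmxA.
Qed.

Section Split2.
Context (n i : nat).
Local Notation PL := (@pindex (n + i) d (fun k => (k < i)%N)).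
Local Notation PR := (@pindex (n + i) d (fun k => ~~ (k < i)%N)).

Definition restrL (a : PL) : mindex i d :=
  @restr _ _ (fun k : {k : 'I_(n + i) | (k < i)%N} => nat_of_ord (val k)) idxL d a.
Definition restrR (b : PR) : @rindex n i :=
  @restr _ _ (fun k : {k : 'I_(n + i) | ~~ (k < i)%N} => nat_of_ord (val k)) idxR d b.

Lemma leftpart_glue (a : PL) (b : PR) : leftpart (Defs.glue a b) = restrL a.
Proof.
apply/ffunP => j; rewrite !ffunE.
rewrite (reflect_true _ _ _ (p := (ltn_ord j : (widen_ord (leq_addl n i) j < i)%N)))//.
Qed.

Lemma rightpart_glue (a : PL) (b : PR) : rightpart (Defs.glue a b) = restrR b.
Proof.
apply/ffunP => j; rewrite !ffunE; apply: reflect_false => [|h].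
  exact/negP/idxR_proof.
by rewrite /idxR (bool_irrelevance (introN idP h) (idxR_proof j)).
Qed.

(** [preU] and [sufU] are the interface matrices in the enumeration order of [unfolding]. They share
    their Gram matrices with [pre] and [suf], which is all that norms see. *)
Definition preU : 'M[R]_(#|{: PL}|, q i) :=
  \matrix_(a, j) lvec C (restrL (enum_val a)) 0 j.
Definition sufU : 'M[R]_(q i, #|{: PR}|) :=
  \matrix_(j, b) (rchain (restrR (enum_val b)) *m (const_mx 1 : 'cV_(q (n + i)))) j 0.

Lemma unfoldingE : unfolding i (TT (n + i) C) = preU *m sufU.
Proof.
apply/matrixP => a b; rewrite mxE TTE /lvec chain_split leftpart_glue rightpart_glue.
rewrite mulmxA -mulmxA [LHS]mxE [RHS]mxE; apply: eq_bigr => j _.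
by rewrite !(mxE matrix_key).
Qed.

Lemma preUE a j : preU a j = lvec C (restrL (enum_val a)) 0 j.
Proof. by rewrite [LHS]mxE. Qed.

Lemma sufUE j b : sufU j b =
  (rchain (restrR (enum_val b)) *m (const_mx 1 : 'cV_(q (n + i)))) j 0.
Proof. by rewrite [LHS]mxE. Qed.

Lemma preU_gram : preU^T *m preU = (pre C i)^T *m pre C i.
Proof.
rewrite -pre_gram -(@sum_restr _ _ (fun k : {k : 'I_(n + i) | (k < i)%N} => nat_of_ord (val k))
  _ d idxL_bij).
rewrite -[RHS]sum_enum_val; apply/matrixP => j l; rewrite mxE summxE.
apply: eq_bigr => a _; rewrite [RHS]mxE big_ord1.
by rewrite [preU^T _ _]mxE [X in _ = X * _]mxE !preUE.
Qed.

Lemma sufU_gram : sufU *m sufU^T = suf C n i *m (suf C n i)^T.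
Proof.
rewrite suf_gram -sum_rchain.
rewrite -(@sum_restr _ _ (fun k : {k : 'I_(n + i) | ~~ (k < i)%N} => nat_of_ord (val k)) _ d idxR_bij).
rewrite -[RHS]sum_enum_val; apply/matrixP => j l; rewrite mxE summxE.
apply: eq_bigr => a _; rewrite mulmxA -mulmxA -trmx_mul [RHS]mxE big_ord1.
by rewrite [sufU^T _ _]mxE [X in _ = _ * X]mxE !sufUE.
Qed.

Lemma tt_rank_TT : (tt_rank i (TT (n + i) C) <= q i)%N.
Proof. by rewrite /tt_rank unfoldingE (leq_trans (mxrankM_maxr _ _))// rank_leq_row. Qed.

Context (oC : (pre C i)^T *m pre C i = 1%:M).

Lemma frob2_sufU p (x : 'M[R]_(p, q i)) : frob2 (x *m sufU) = frob2 (x *m suf C n i).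
Proof.
by rewrite !frob2E !mxdot_mulr -!mulmxA sufU_gram.
Qed.

Lemma frob2_preU p (y : 'M[R]_(p, q i)) : frob2 (y *m preU^T) = frob2 y.
Proof.
rewrite -[LHS]frob2_tr trmx_mul trmxK -[RHS]frob2_tr; apply: cbound_isom.
by rewrite preU_gram.
Qed.

(** Since [preU] is an isometry, x [sufU] is the unfolding applied to x [preU^T], which has the norm
    of x at most. *)
Lemma suf_rbound : rbound (suf C n i) (sigma 1 (unfolding i (TT (n + i) C)) ^+ 2).
Proof.
move=> p x; rewrite -frob2_sufU.
have -> : x *m sufU = x *m preU^T *m unfolding i (TT (n + i) C).
  by rewrite unfoldingE !mulmxA -(mulmxA x) preU_gram oC mulmx1.
apply: le_trans (cbound_rbound (sqr_ge0 _) (@sigma1_bound _ _ _ _) _) _.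
by rewrite frob2_preU.
Qed.

(** The smallest singular value of the right interface is at least that of rank index [q i] of the
    unfolding: [sigma_rank_bound] is applied to a row vector built from the inverse square root of
    the Gram matrix H. *)
Lemma suf_lower p (x : 'M[R]_(p, q i)) : (0 < q i)%N -> tt_rank i (TT (n + i) C) = q i ->
  sigma_tt i (TT (n + i) C) ^+ 2 * frob2 x <= frob2 (x *m suf C n i).
Proof.
move=> q0 hr; rewrite -frob2_sufU.
pose H := sufU *m sufU^T.
have rz : row_free sufU.
  rewrite /row_free eqn_leq rank_leq_row /= -{1}hr /tt_rank unfoldingE.
  exact: mxrankM_maxr.
have pH : posdefmx H.
  split; first by rewrite /H trmx_mul trmxK.
  move=> v v0; have := gram_quad sufU^T v; rewrite trmxK -/H => ->.
  by rewrite frob2_gt0; apply: contraNneq v0 => h; apply/eqP/(row_free_inj rz); rewrite mul0mx.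
have [W pW hW] := invsqrt_exists pH.
have SS := sqrt_sqr hW; have SW := sqrt_mulW hW; have sS := sqrt_sym pW hW.
rewrite frob2_rows [leRHS]frob2_rows mulr_sumr; apply: ler_sum => j _.
rewrite row_mul; move: (row j x) => u.
have HW : H *m W = W *m H by rewrite -[RHS]sS trmx_mul pH.1 pW.1.
(* With M the unfolding and W = H^(-1/2), this choice gives |v M| = |u| and |v M M^T| = |u
   [sufU]|. *)
pose v := u *m W *m preU^T.
have vM : v *m unfolding i (TT (n + i) C) = u *m W *m sufU.
  by rewrite unfoldingE /v !mulmxA -(mulmxA _ preU^T) preU_gram oC mulmx1.
have e1 : frob2 (u *m W *m sufU) = frob2 u.
  rewrite frob2E mxdot_mulr -!mulmxA -/H mxdot_mulr pW.1 -mulmxA SW mulmx1.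
  by rewrite frob2E.
have e2 : frob2 (u *m W *m sufU *m (unfolding i (TT (n + i) C))^T) = frob2 (u *m sufU).
  rewrite unfoldingE trmx_mul mulmxA -(mulmxA _ sufU) -/H.
  rewrite frob2_preU -(mulmxA u) frob2E mxdot_mulr sS -mulmxA SS.
  by rewrite [RHS]frob2E mxdot_mulr /H mulmxA.
have := @sigma_rank_bound R _ _ (unfolding i (TT (n + i) C)) v.
rewrite vM e2 e1 /sigma_tt /tt_rank; apply.
by move: hr; rewrite /tt_rank => ->.
Qed.

End Split2.
End Unfolding.

(** * One gradient step *)

Lemma sqr_sum_le (R : realType) n (f : 'I_n -> R) (N : nat) : (n <= N)%N ->
  (\sum_i f i) ^+ 2 <= N%:R * \sum_i f i ^+ 2.
Proof.
move=> nN; apply: (@le_trans _ _ (n%:R * \sum_i f i ^+ 2)); last first.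
  by rewrite ler_wpM2r ?ler_nat// sumr_ge0// => i _; apply: sqr_ge0.
have := mxdot_CS2 (\row_i f i) (const_mx 1 : 'rV_n).
have -> : mxdot (\row_i f i) (const_mx 1 : 'rV_n) = \sum_i f i.
  by rewrite mxdotE big_ord1; apply: eq_bigr => i _; rewrite !mxE mulr1.
have -> : frob2 (\row_i f i) = \sum_i f i ^+ 2.
  by rewrite /frob2 big_ord1; apply: eq_bigr => i _; rewrite mxE.
have -> : frob2 (const_mx 1 : 'rV[R]_n) = n%:R.
  rewrite /frob2 big_ord1; under eq_bigr do rewrite mxE expr1n.
  by rewrite sumr_const card_ord.
by rewrite mulrC.
Qed.

Lemma proj_contraction (R : realType) m n p (A : 'M[R]_(m, n)) (F : 'M[R]_(m, p)) :
  A^T *m A = 1%:M -> frob2 (F - A *m (A^T *m F)) <= frob2 F.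
Proof.
move=> AA; rewrite frob2B mxdotC mxdot_mull -frob2E (cbound_isom _ AA).
by have := frob2_ge0 (A^T *m F); lra.
Qed.

Section Local.
Context {R : realType} {d r : nat -> nat} {N : nat}.
Local Notation cores := (@cores R d r).
Implicit Types X Y D : cores.

Definition cnorm2 (D : cores) k : R := \sum_s frob2 (D k s).
Definition csub (X Y : cores) : cores := fun k s => X k s - Y k s.
Arguments csub X Y k _ : clear implicits.
Definition left_orth (X : cores) :=
  forall k, (k.+1 < N)%N -> \sum_s (X k s)^T *m X k s = 1%:M.

Lemma cnorm2_ge0 D k : 0 <= cnorm2 D k.
Proof. by apply: sumr_ge0 => s _; apply: frob2_ge0. Qed.

Lemma pre_isom X k : r 0%N = 1%N -> left_orth X -> (k < N)%N ->
  (pre X k)^T *m pre X k = 1%:M.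
Proof.
move=> r0 hX; elim: k => [_|k IH kN].
  rewrite /= trmx_const; apply/matrixP => i j; rewrite !mxE big_ord1 !mxE mulr1.
  have z (l : 'I_(r 0%N)) : nat_of_ord l = 0%N.
    by have := leq_trans (ltn_ord l) (eq_leq r0); case: (nat_of_ord l).
  by rewrite -val_eqE /= !z.
rewrite /= tr_mxcol mul_mxrow_mxcol -(hX _ kN); apply: eq_bigr => s _.
by rewrite trmx_mul mulmxA -(mulmxA _ _ (pre X k)) IH ?(ltnW kN)// mulmx1.
Qed.

Lemma cbound_stack m X k (B : 'M[R]_(m, r k)) (c : R) : 0 <= c ->
  \sum_s (X k s)^T *m X k s = 1%:M ->
  cbound B c -> cbound (\mxcol_s (B *m X k s)) c.
Proof.
move=> c0 h hc p x; rewrite /= mxcol_mul frob2_mxcol.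
have -> : frob2 x = \sum_s frob2 (X k s *m x).
  under [RHS]eq_bigr do rewrite frob2E mxdot_mull mulmxA.
  by rewrite -mxdot_sumr -mulmx_suml h mul1mx frob2E.
rewrite mulr_sumr; apply: ler_sum => s _; rewrite -mulmxA; exact: hc.
Qed.

Lemma cbound_stack_frob m X k (B : 'M[R]_(m, r k)) (c : R) : 0 <= c ->
  cbound B c -> cbound (\mxcol_s (B *m X k s)) (c * cnorm2 X k).
Proof.
move=> c0 hc p x; rewrite /= mxcol_mul frob2_mxcol.
have -> : c * cnorm2 X k * frob2 x = \sum_s c * frob2 (X k s) * frob2 x.
  by rewrite -mulr_suml -mulr_sumr.
apply: ler_sum => s _; rewrite -mulmxA (le_trans (hc _ _))// -mulrA ler_wpM2l//.
exact: cbound_frob.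
Qed.

Lemma rbound_last X k : r N = 1%N -> (k <= N)%N -> k = N -> rbound (suf X (N - k) k) 1.
Proof.
move=> rN _ ->; rewrite subnn => p x; rewrite mul1r /=.
apply: le_trans (_ : frob2 (const_mx 1 : 'cV[R]_(r N)) * frob2 x <= _).
  exact: rbound_frob.
rewrite (_ : frob2 _ = 1) ?mul1r//.
rewrite /frob2; under eq_bigr do rewrite big_ord1 mxE expr1n.
by rewrite sumr_const card_ord rN.
Qed.

(** The singular values of all inner right interface matrices lie in [sl, sb]. For left-orthogonal
    factors these are the nonzero singular values of the unfoldings, see [good_sigma]. *)
Definition good (sb sl : R) (Y : cores) := forall k, (0 < k < N)%N ->
  rbound (suf Y (N - k) k) (sb ^+ 2) /\
  forall p (x : 'M[R]_(p, r k)), sl ^+ 2 * frob2 x <= frob2 (x *m suf Y (N - k) k).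

Section Step.
Context (sb sl : R) (sl0 : 0 < sl) (slb : sl <= sb).
Context (r0 : r 0%N = 1%N) (rN : r N = 1%N) (N2 : (2 <= N)%N).
Let sb0 : 0 < sb. Proof. exact: lt_le_trans slb. Qed.

(** The weights of dist^2, which also bound the squared norm of the right interface behind core k
    ([rbound_suf]). Hence inserting [D k] between a left-orthogonal and a good chain gives a tensor
    of norm at most [u D k]. *)
Definition wt k : R := if (k.+1 < N)%N then sb ^+ 2 else 1.
Definition V (D : cores) : R := \sum_(k < N) wt k * cnorm2 D k.
Definition u (D : cores) k : R := Num.sqrt (wt k * cnorm2 D k).

Lemma wt_gt0 k : 0 < wt k. Proof. by rewrite /wt; case: ifP => _; rewrite ?exprn_gt0. Qed.

Lemma u_ge0 D k : 0 <= u D k. Proof. exact: sqrtr_ge0. Qed.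

Lemma sqr_u D k : u D k ^+ 2 = wt k * cnorm2 D k.
Proof. by rewrite sqr_sqrtr// mulr_ge0 ?cnorm2_ge0// ltW// wt_gt0. Qed.

Lemma V_ge0 D : 0 <= V D.
Proof. by apply: sumr_ge0 => k _; rewrite mulr_ge0 ?cnorm2_ge0// ltW// wt_gt0. Qed.

Lemma sqr_sum_u D k : (k <= N)%N -> (\sum_(i < k) u D i) ^+ 2 <= N%:R * V D.
Proof.
move=> kN; apply: le_trans (sqr_sum_le _ kN) _; rewrite ler_wpM2l//.
rewrite /V [leRHS](bigID (fun i : 'I_N => (i < k)%N)) /=.
rewrite (big_ord_widen N (fun i => u D i ^+ 2) kN) -[leLHS]addr0 lerD//.
  by apply: ler_sum => i _; rewrite sqr_u.
by apply: sumr_ge0 => i _; rewrite mulr_ge0 ?cnorm2_ge0// ltW// wt_gt0.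
Qed.

Lemma rbound_suf Y k : good sb sl Y -> (k < N)%N -> rbound (suf Y (N - k.+1) k.+1) (wt k).
Proof.
move=> gY kN; rewrite /wt; case: ifP => h; first by have [] := gY k.+1 h.
by apply: rbound_last => //; apply/eqP; rewrite eqn_leq kN leqNgt h.
Qed.

Lemma suf_mix i X D Y k : (i < k)%N -> suf (mix i X D Y) (N - k) k = suf Y (N - k) k.
Proof. by move=> ik; apply: suf_ext => j /andP[kj _]; rewrite mix_gt// (leq_trans ik). Qed.

Lemma pre_mix i X D Y : pre (mix i X D Y) i = pre X i.
Proof. by apply: pre_ext => j ji; rewrite mix_lt. Qed.

Lemma sqrt_le_tnorm (T : tensor R N d) a : 0 <= a -> tnorm2 T <= a ^+ 2 -> tnorm T <= a.
Proof.
move=> a0 h; rewrite -(@ler_pXn2r _ 2) ?nnegrE ?tnorm_ge0//.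
by rewrite sqr_tnorm.
Qed.

Lemma tnorm_mix X D Y i b : left_orth X -> (i < N)%N -> 0 <= b ->
  rbound (suf Y (N - i.+1) i.+1) b ->
  tnorm2 (TT N (mix i X D Y)) <= b * cnorm2 D i.
Proof.
move=> hX iN b0 hb.
have := @tnorm2_TT_le R d r N (mix i X D Y) (N - i.+1) i 1 b.
rewrite (subnK iN) mul1r mix_eq pre_mix (@suf_mix i X D Y i.+1 (ltnSn i)); apply => //.
exact/cbound_orth/pre_isom.
Qed.

Lemma tnorm_mix_good X D Y i : left_orth X -> good sb sl Y -> (i < N)%N ->
  tnorm (TT N (mix i X D Y)) <= u D i.
Proof.
move=> hX gY iN; apply: sqrt_le_tnorm; rewrite ?u_ge0// sqr_u.
by apply: tnorm_mix => //; [rewrite ltW// wt_gt0|exact: rbound_suf].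
Qed.

Lemma tnorm_err X Y : left_orth X -> good sb sl Y ->
  tnorm (TT N X - TT N Y) <= \sum_(k < N) u (csub X Y) k.
Proof.
move=> hX gY; rewrite TT_telescope (le_trans (tnorm_sum _ _))//.
by apply: ler_sum => i _; exact: tnorm_mix_good.
Qed.

Lemma sqr_tnorm_err X Y : left_orth X -> good sb sl Y ->
  tnorm (TT N X - TT N Y) ^+ 2 <= N%:R * V (csub X Y).
Proof.
move=> hX gY; apply: le_trans (sqr_sum_u _ (leqnn N)).
rewrite ler_pXn2r ?nnegrE ?tnorm_ge0 ?tnorm_err//.
by apply: sumr_ge0 => i _; exact: u_ge0.
Qed.

(** Between the two inserted cores stand isometric cores of X, and only the right interface behind j
    contributes a weight. As i is not the last mode, its weight sb^2 is divided out, whence the gain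
    1 / sb. *)
Lemma tnorm_mix_good2 X D Y i j : left_orth X -> good sb sl Y -> (i < j < N)%N ->
  tnorm (TT N (mix j (mix i X D X) D (mix i X D Y))) <= u D i * u D j / sb.
Proof.
move=> hX gY /andP[ij jN]; have iN : (i.+1 < N)%N by apply: leq_ltn_trans ij jN.
apply: sqrt_le_tnorm; first by rewrite divr_ge0 ?mulr_ge0 ?u_ge0 ?ltW.
rewrite expr_div_n exprMn !sqr_u {1}/wt iN.
rewrite (_ : _ / _ = cnorm2 D i * wt j * cnorm2 D j); last by field; rewrite gt_eqF.
set U := mix i X D X.
have := @tnorm2_TT_le R d r N (mix j U D (mix i X D Y)) (N - j.+1) j (cnorm2 D i) (wt j).
rewrite (subnK jN) mix_eq pre_mix (@suf_mix j U D _ j.+1 (ltnSn j)).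
rewrite (@suf_mix i X D Y j.+1 (ltnW ij)).
apply=> //; first exact: cnorm2_ge0.
- by rewrite ltW ?wt_gt0.
- elim: j ij jN => [//|k IH]; rewrite ltnS leq_eqVlt => /orP[/eqP e|ik] kN.
    subst k; have := @cbound_stack_frob _ U i (pre U i) 1 ler01.
    have -> : cnorm2 U i = cnorm2 D i by rewrite /cnorm2 /U mix_eq.
    rewrite mul1r; apply.
    by rewrite pre_mix; exact/cbound_orth/pre_isom/ltnW.
  apply: cbound_stack; first exact: cnorm2_ge0.
    by rewrite /U mix_gt// hX.
  exact: IH ik (ltnW kN).
- exact: rbound_suf.
Qed.

(** The exact difference is a sum of [mix i X D Y], its linearization a sum of [mix i X D X].
    Telescoping each discrepancy again leaves pairs i < j, and the sum of [u D i * u D j / sb] over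
    all pairs is at most N V / sb. *)
Lemma second_order_sum X Y : left_orth X -> good sb sl Y ->
  tnorm (\sum_(i < N) TT N (mix i X (csub X Y) X) - (TT N X - TT N Y)) <=
  N%:R * V (csub X Y) / sb.
Proof.
move=> hX gY; set D := csub X Y.
rewrite TT_telescope -sumrB.
apply: le_trans (tnorm_sum _ _) _.
apply: (@le_trans _ _ (\sum_(i < N) \sum_(j < N) u D i * u D j / sb)).
  apply: ler_sum => i _; rewrite TT_telescope (le_trans (tnorm_sum _ _))//.
  apply: ler_sum => j _.
  have [ij|ji] := ltnP i j.
    rewrite (_ : TT N _ = TT N (mix j (mix i X D X) D (mix i X D Y))).
      by apply: tnorm_mix_good2 => //; rewrite ij ltn_ord.
    apply: TT_ext => k _; rewrite /mix; case: ifP => // _; case: ifP => // /eqP ->.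
    by rewrite ltnNge (ltnW ij) /= gtn_eqF//.
  (* For j <= i the two chains have the same core j, so the inserted difference vanishes. *)
  set T := TT N _; have -> : T = 0.
    apply: tnorm2_eq0; apply/le_anti; rewrite tnorm2_ge0 andbT.
    rewrite (tnorm2_TT _ (subnK (ltn_ord j))) /= mix_eq.
    rewrite (_ : \mxcol_s _ = 0) ?mul0mx ?frob2_0//.
    have e : mix i X D X j = mix i X D Y j by rewrite /mix; case: ltngtP ji.
    by apply/mxcolP => s; rewrite mxcolK submxcol0 e subrr mulmx0.
  by rewrite /tnorm tnorm2_0 sqrtr0 divr_ge0 ?mulr_ge0 ?u_ge0 ?ltW.
under eq_bigr do rewrite -mulr_suml -mulr_sumr.
rewrite -!mulr_suml ler_wpM2r ?invr_ge0 ?(ltW sb0)//.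
by rewrite -expr2 sqr_sum_u.
Qed.

(** With A, A' the left and Z, Z' the right interfaces of X and Y, and F = A Z - A' Z', one has Z =
    A^T A' Z' + A^T F, where |F| <= e and A, A' are isometries. *)
Lemma suf_rbound_err X Y k (e : R) : left_orth X -> good sb sl Y -> left_orth Y ->
  (0 < k < N)%N -> 0 <= e -> tnorm2 (TT N X - TT N Y) <= e ^+ 2 ->
  rbound (suf X (N - k) k) ((sb + e) ^+ 2).
Proof.
move=> hX gY hY kN e0 he p x; have [k0 kN'] := andP kN.
have AA := pre_isom r0 hX kN'; have AA' := pre_isom r0 hY kN'.
have [hs _] := gY k kN.
have {he} := he; rewrite (tnorm2_TTB _ _ (subnK (ltnW kN'))).
set A := pre X k; set Z := suf X _ k; set A' := pre Y k; set Z' := suf Y _ k.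
set F := A *m Z - A' *m Z' => he.
have -> : x *m Z = x *m A^T *m A' *m Z' + x *m A^T *m F.
  by rewrite /F mulmxBr !mulmxA addrC subrK -(mulmxA x A^T) AA mulmx1.
rewrite -!sqr_fnorm -exprMn ler_pXn2r ?nnegrE ?mulr_ge0 ?fnorm_ge0 ?addr_ge0 ?(ltW sb0)//.
have nA : frob2 (x *m A^T) <= frob2 x.
  have h : rbound A^T 1 := rbound_tr (cbound_orth AA).
  by have := h _ x; rewrite mul1r.
rewrite (le_trans (fnormD _ _))// mulrDl lerD// fnorm_le ?(ltW sb0)//.
  apply: le_trans (hs _ _) _; rewrite ler_wpM2l ?sqr_ge0//.
  apply: le_trans nA.
  have h : rbound A' 1 := cbound_rbound ler01 (cbound_orth AA').
  by have := h _ (x *m A^T); rewrite mul1r.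
apply: le_trans (rbound_frob _ _) _.
by rewrite ler_pM ?frob2_ge0.
Qed.

Lemma cnorm2_csub (X Y : cores) k :
  cnorm2 (csub X Y) k = frob2 (\mxcol_s X k s - \mxcol_s Y k s).
Proof. by rewrite -mxcolB frob2_mxcol. Qed.

Lemma left_orth_mxcol X k : left_orth X -> (k.+1 < N)%N ->
  (\mxcol_s X k s)^T *m \mxcol_s X k s = 1%:M.
Proof. by move=> hX kN; rewrite tr_mxcol mul_mxrow_mxcol hX. Qed.

(* The Riemannian first-order variation of the cores in direction [D]: the
   tangential part of [L(X_k) - L(Y_k)] is [D_k - L(X_k) D_k^T D_k / 2]. *)
Definition tangential X D : cores := fun k s =>
  if (k.+1 < N)%N then D k s - 2^-1 *: (X k s *m \sum_t (D k t)^T *m D k t) else D k s.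

Arguments tangential X D k _ : clear implicits.

Lemma mxcol_tangential X Y k : left_orth X -> left_orth Y -> (k.+1 < N)%N ->
  \mxcol_s tangential X (csub X Y) k s =
  stiefel_proj (\mxcol_s X k s) (\mxcol_s X k s - \mxcol_s Y k s).
Proof.
move=> hX hY kN; rewrite stiefel_proj_normal ?left_orth_mxcol//.
rewrite -mxcolB tr_mxcol mul_mxrow_mxcol /tangential kN.
rewrite mxcol_mul mxcolZ -[RHS]mxcolB.
by apply: eq_mxcol => s.
Qed.

Definition tangent_sum X D : tensor R N d := \sum_(i < N) TT N (mix i X D X).

(** [second_order_sum] accounts for one half of the bound. The other half is the normal correction
    K_k = L(X_k) D_k^T D_k, whose norm is at most |D_k|^2. *)
Lemma second_order X Y (e : R) : left_orth X -> good sb sl Y -> left_orth Y ->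
  0 <= e -> tnorm2 (TT N X - TT N Y) <= e ^+ 2 -> e <= sb ->
  tnorm (tangent_sum X (tangential X (csub X Y)) - (TT N X - TT N Y)) <=
  2 * N%:R * V (csub X Y) / sb.
Proof.
move=> hX gY hY e0 he esb; set D := csub X Y.
pose K : cores := fun k s => if (k.+1 < N)%N then X k s *m \sum_t (D k t)^T *m D k t else 0.
have -> : tangent_sum X (tangential X D) =
    \sum_(i < N) TT N (mix i X D X) + \sum_(i < N) (- 2^-1) *: TT N (mix i X K X).
  rewrite -big_split; apply: eq_bigr => i _ /=.
  rewrite [RHS]addrC -TT_mix_linear//; apply: TT_ext => k _.
  rewrite /mix; case: ifP => // _; case: ifP => // /eqP ->.
  apply: funext => s; rewrite /tangential /K; case: ifP => _.
    by rewrite addrC scaleNr.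
  by rewrite scaler0 add0r.
rewrite addrAC; apply: le_trans (tnormD _ _) _.
have h1 := second_order_sum hX gY; rewrite -/D in h1.
suff h2 : tnorm (\sum_(i < N) (- 2^-1) *: TT N (mix i X K X)) <= N%:R * V D / sb.
  by move: h1 h2; rewrite -/D; lra.
apply: le_trans (tnorm_sum _ _) _.
have N1 : (1 : R) <= N%:R by rewrite ler1n; apply: leq_trans N2.
apply: (@le_trans _ _ (\sum_(i < N) (wt i * cnorm2 D i) / sb)); last first.
  by rewrite -mulr_suml ler_wpM2r ?invr_ge0 ?(ltW sb0)// -/(V D) ler_peMl ?V_ge0.
apply: ler_sum => i _.
have wc : 0 <= wt i * cnorm2 D i / sb.
  by rewrite divr_ge0 ?(ltW sb0)// mulr_ge0 ?cnorm2_ge0// ltW// wt_gt0.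
apply: sqrt_le_tnorm => //; rewrite tnorm2Z sqrrN.
have [iN|iN] := boolP (i.+1 < N)%N; last first.
  rewrite (_ : tnorm2 _ = 0) ?mulr0 ?sqr_ge0//.
  apply/le_anti; rewrite tnorm2_ge0 andbT.
  rewrite (tnorm2_TT _ (subnK (ltn_ord i))) /= mix_eq /K (negbTE iN).
  rewrite (_ : \mxcol_s _ = 0) ?mul0mx ?frob2_0//.
  by apply/mxcolP => s; rewrite mxcolK submxcol0 mulmx0.
have hb := @suf_rbound_err X Y i.+1 e hX gY hY iN e0 he.
have := @tnorm_mix X K X i _ hX (ltn_ord i) (sqr_ge0 _) hb.
have hK : cnorm2 K i <= cnorm2 D i ^+ 2.
  rewrite /cnorm2 /K iN -frob2_mxcol -mxcol_mul.
  set G := \sum_t (D i t)^T *m D i t; rewrite (cbound_isom _ (left_orth_mxcol hX iN)).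
  have -> : G = (\mxcol_s D i s)^T *m \mxcol_s D i s.
    by rewrite tr_mxcol mul_mxrow_mxcol.
  by apply: le_trans (rbound_frob _ _) _; rewrite frob2_tr frob2_mxcol expr2.
(* The right interface of X has norm at most sb + e <= 2 sb; this 2 cancels the factor 1/2 in front
   of K. *)
move=> h; apply: (@le_trans _ _ (2^-1 ^+ 2 * ((2 * sb) ^+ 2 * cnorm2 D i ^+ 2))).
  rewrite ler_wpM2l ?sqr_ge0//; apply: le_trans h _.
  have sb1 := ltW sb0.
  by rewrite ler_pM ?sqr_ge0 ?cnorm2_ge0// ler_pXn2r ?nnegrE//; lra.
rewrite {1}/wt iN (_ : _ / sb = sb * cnorm2 D i); last by field; rewrite gt_eqF.
rewrite le_eqVlt; apply/orP; left; apply/eqP; by field.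
Qed.

Lemma rbound_suf_near X Y k (e : R) : left_orth X -> good sb sl Y -> left_orth Y ->
  (k < N)%N -> 0 <= e -> tnorm2 (TT N X - TT N Y) <= e ^+ 2 -> 20 * e <= sb ->
  rbound (suf X (N - k.+1) k.+1) (6 / 5 * wt k).
Proof.
move=> hX gY hY kN e0 he esb p x; have sb1 := sb0; rewrite /wt; case: ifP => h.
  apply: le_trans (@suf_rbound_err X Y k.+1 e hX gY hY h e0 he _ _) _.
  rewrite ler_wpM2r ?frob2_ge0//.
  apply: (@le_trans _ _ ((21 / 20 * sb) ^+ 2)); last first.
    by rewrite exprMn ler_wpM2r ?sqr_ge0//; lra.
  by rewrite ler_pXn2r ?nnegrE//; lra.
have kN' : k.+1 = N by apply/eqP; rewrite eqn_leq kN leqNgt h.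
have h1 : rbound (suf X (N - k.+1) k.+1) 1 by apply: rbound_last.
apply: le_trans (h1 _ _) _; rewrite ler_wpM2r ?frob2_ge0//; lra.
Qed.

Section GradientStep.
Context (X X' Y : cores).
Arguments X : clear implicits.
Arguments X' : clear implicits.
Arguments Y : clear implicits.
Context (g : tensor R N d -> R) (c e mu : R).
Context (G : forall k, 'M[R]_((\sum_(s < d k) r k)%N, r k.+1)).
Hypotheses (hX : left_orth X) (gY : good sb sl Y) (hY : left_orth Y).
Hypotheses (e0 : 0 <= e) (he : tnorm2 (TT N X - TT N Y) <= e ^+ 2) (esb : 20 * e <= sb).
Hypotheses (c0 : 0 <= c) (mu0 : 0 <= mu).
Hypothesis hG : forall k, (k < N)%N -> forall B : cores,
  mxdot (G k) (\mxcol_s B k s) = g (TT N (mix k X B X)).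
Hypothesis hg : forall k, (k < N)%N -> forall B : cores,
  g (TT N (mix k X B X)) <= c * tnorm (TT N (mix k X B X)).
Hypothesis gsum : forall D, g (tangent_sum X D) = \sum_(k < N) g (TT N (mix k X D X)).
Hypothesis hU : forall k, (k.+1 < N)%N ->
  frob2 (\mxcol_s X' k s - \mxcol_s Y k s) <=
  frob2 (\mxcol_s X k s - (mu / sb ^+ 2) *: stiefel_proj (\mxcol_s X k s) (G k)
         - \mxcol_s Y k s).
Hypothesis hUN : forall k, k.+1 = N -> \mxcol_s X' k s = \mxcol_s X k s - mu *: G k.

(** Duality: the gradient is tested against itself, cut into a core B. Then |G|^2 = g(mix) <= c
    |mix|, and |mix| is at most the norm of the right interface times |G|. *)
Lemma gradient_le k : (k < N)%N -> frob2 (G k) <= 6 / 5 * wt k * c ^+ 2.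
Proof.
move=> kN; pose B : cores := fun j s => submxcol (G j) s.
have GB : \mxcol_s B k s = G k by rewrite submxcolK.
have [->|G0] := eqVneq (G k) 0.
  by rewrite frob2_0 mulr_ge0 ?sqr_ge0// mulr_ge0 ?(ltW (wt_gt0 k))//; lra.
have pG : 0 < frob2 (G k) by rewrite frob2_gt0.
have h1 : frob2 (G k) <= c * tnorm (TT N (mix k X B X)).
  by rewrite frob2E -{2}GB hG// hg.
have wk := wt_gt0 k.
have h2 : tnorm2 (TT N (mix k X B X)) <= 6 / 5 * wt k * frob2 (G k).
  rewrite -GB frob2_mxcol; apply: tnorm_mix => //; first by rewrite mulr_ge0 ?(ltW wk)//; lra.
  exact: (@rbound_suf_near X Y k e).
have h3 : frob2 (G k) ^+ 2 <= c ^+ 2 * (6 / 5 * wt k * frob2 (G k)).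
  apply: (@le_trans _ _ ((c * tnorm (TT N (mix k X B X))) ^+ 2)).
    by rewrite ler_pXn2r ?nnegrE ?mulr_ge0 ?tnorm_ge0 ?frob2_ge0.
  by rewrite exprMn sqr_tnorm ler_wpM2l ?sqr_ge0.
by rewrite -(ler_pM2r pG); move: h3; rewrite expr2; lra.
Qed.

(** Mode k moves by mu / [wt k], so after weighting all cross terms carry the same factor 2 mu. The
    projection is self-adjoint and passes from the gradient to the core difference, where the terms
    add up to g at the tangent tensor. *)
Lemma gradient_step : V (csub X' Y) <= V (csub X Y)
  - 2 * mu * g (tangent_sum X (tangential X (csub X Y))) + 6 / 5 * N%:R * mu ^+ 2 * c ^+ 2.
Proof.
set D := tangential X _.
rewrite gsum mulr_sumr.
have -> : 6 / 5 * N%:R * mu ^+ 2 * c ^+ 2 = \sum_(k < N) (6 / 5 * mu ^+ 2 * c ^+ 2).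
  by rewrite sumr_const card_ord -mulr_natr; ring.
rewrite /V -sumrB -big_split; apply: ler_sum => k _ /=.
have kN := ltn_ord k; have wk := wt_gt0 k; have Gk := gradient_le kN.
rewrite -hG// !cnorm2_csub.
set L := \mxcol_s X k s; set U := \mxcol_s Y k s.
have [h|h] := boolP (k.+1 < N)%N.
  rewrite (mxcol_tangential hX hY h) -/L -/U mxdotC stiefel_proj_selfadjoint.
  have LL : L^T *m L = 1%:M := left_orth_mxcol hX h.
  have hP := stiefel_proj_le (G k) LL.
  apply: (@le_trans _ _ (wt k * frob2 (L - (mu / sb ^+ 2) *: stiefel_proj L (G k) - U))).
    by rewrite ler_wpM2l ?(ltW wk)// hU.
  rewrite (addrAC L) (frob2B (L - U)) mxdotZr frob2Z.
  have ew : wt k = sb ^+ 2 by rewrite /wt h.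
  have sb2 : sb ^+ 2 != 0 by rewrite -ew gt_eqF.
  rewrite -ew; set P := mxdot _ _; set F := frob2 (L - U).
  rewrite -subr_ge0.
  have -> : wt k * F - 2 * mu * P + 6 / 5 * mu ^+ 2 * c ^+ 2 -
      wt k * (F - 2 * (mu / wt k * P) + (mu / wt k) ^+ 2 * frob2 (stiefel_proj L (G k))) =
      mu ^+ 2 / wt k * (6 / 5 * wt k * c ^+ 2 - frob2 (stiefel_proj L (G k))).
    by field; rewrite gt_eqF.
  rewrite mulr_ge0 ?divr_ge0 ?sqr_ge0 ?(ltW wk)// subr_ge0.
  exact: le_trans hP Gk.
have kN' : k.+1 = N by apply/eqP; rewrite eqn_leq kN leqNgt h.
have ew : wt k = 1 by rewrite /wt (negbTE h).
have -> : \mxcol_s D k s = L - U.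
  by rewrite -mxcolB; apply: eq_mxcol => s; rewrite /D /tangential (negbTE h).
rewrite hUN// -/L (addrAC L) (frob2B (L - U)) mxdotZr frob2Z ew !mul1r mxdotC.
have h1 : mu ^+ 2 * frob2 (G k) <= mu ^+ 2 * (6 / 5 * wt k * c ^+ 2).
  by rewrite ler_wpM2l ?sqr_ge0.
by move: h1; rewrite ew; lra.
Qed.

End GradientStep.

End Step.
End Local.

Arguments csub {R d r} X Y k _.
Arguments tangential {R d r N} X D k _.

(** * The error controls the distance *)

Section Gauge.
Context {R : realType} {d r : nat -> nat} {N : nat}.
Local Notation cores := (@cores R d r).
Implicit Types X Y D : cores.

Definition gauge_act (P : forall k, 'M[R]_(r k)) (Y : cores) : cores :=
  fun k s => (P k)^T *m Y k s *m P k.+1.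
Arguments gauge_act P Y k _ : clear implicits.

Section Fixed.
Context (P : forall k, 'M[R]_(r k)) (gP : @gauge R N r P).

Lemma gauge_orth k : (k <= N)%N -> (P k)^T *m P k = 1%:M.
Proof.
have [h0 hN hP] := gP; rewrite leq_eqVlt => /orP[/eqP->|kN].
  by rewrite hN trmx1 mulmx1.
by case: k kN => [|k] kN; [rewrite h0 trmx1 mulmx1|rewrite hP].
Qed.

Lemma gauge_orthV k : (k <= N)%N -> P k *m (P k)^T = 1%:M.
Proof. by move=> kN; apply/mulmx1C/gauge_orth. Qed.

Lemma pre_gauge Y k : (k <= N)%N -> pre (gauge_act P Y) k = pre Y k *m P k.
Proof.
elim: k => [_|k IH kN]; first by have [-> _ _] := gP; rewrite mulmx1.
rewrite /= IH ?(ltnW kN)// mxcol_mul; apply: eq_mxcol => s.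
by rewrite /gauge_act !mulmxA -(mulmxA _ (P k)) gauge_orthV ?(ltnW kN)// mulmx1.
Qed.

Lemma suf_gauge Y n k : (n + k)%N = N ->
  suf (gauge_act P Y) n k = (P k)^T *m suf Y n k.
Proof.
elim: n k => [|n IH] k e.
  by rewrite add0n in e; subst k; have [_ -> _] := gP; rewrite trmx1 mul1mx.
have kN : (k.+1 <= N)%N by lia.
rewrite /= mul_mxrow; apply: eq_mxrow => s; rewrite IH; last by lia.
by rewrite /gauge_act !mulmxA -(mulmxA _ (P k.+1)) gauge_orthV// mulmx1.
Qed.

Lemma lvec_gauge Y k (s : mindex k d) : (k <= N)%N ->
  lvec (gauge_act P Y) s = lvec Y s *m P k.
Proof.
elim: k s => [s _|k IH s kN]; first by have [-> _ _] := gP; rewrite mulmx1 !lvec0.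
rewrite !lvecS IH ?(ltnW kN)// /gauge_act !mulmxA -(mulmxA _ (P k)).
by rewrite gauge_orthV ?(ltnW kN)// mulmx1.
Qed.

Lemma TT_gauge Y : TT N (gauge_act P Y) = TT N Y.
Proof.
apply/ffunP => s; rewrite !TTE lvec_gauge//.
by have [_ -> _] := gP; rewrite mulmx1.
Qed.

Lemma left_orth_gauge Y : @left_orth R d r N Y -> @left_orth R d r N (gauge_act P Y).
Proof.
move=> hY k kN; rewrite /gauge_act.
under eq_bigr => s _.
  rewrite !trmx_mul trmxK !mulmxA -(mulmxA _ (P k)) gauge_orthV ?(ltnW (ltnW kN))//.
  rewrite mulmx1 -mulmxA -mulmxA (mulmxA _ (Y k s)); over.
rewrite -mulmx_sumr -mulmx_suml hY// mul1mx gauge_orth//.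
exact: ltnW.
Qed.

Lemma good_gauge sb sl Y : @good R d r N sb sl Y -> @good R d r N sb sl (gauge_act P Y).
Proof.
move=> gY k kN; have [h1 h2] := gY k kN; have [k0 kN'] := andP kN.
have e p (x : 'M[R]_(p, r k)) : frob2 (x *m (P k)^T) = frob2 x.
  by rewrite -frob2_tr trmx_mul trmxK cbound_isom ?frob2_tr// gauge_orth// ltnW.
rewrite suf_gauge ?subnK ?(ltnW kN')//; split => p x; rewrite mulmxA -(e _ x) ?h1//.
Qed.

End Fixed.

Lemma gauge_mul (P Q : forall k, 'M[R]_(r k)) : @gauge R N r P -> @gauge R N r Q ->
  @gauge R N r (fun k => P k *m Q k).
Proof.
move=> gP gQ; have [p0 pN hp] := gP; have [q0 qN hq] := gQ.
split; rewrite ?p0 ?q0 ?pN ?qN ?mulmx1// => i iN.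
by rewrite trmx_mul mulmxA -(mulmxA _ _ (P i)) hp// mulmx1 hq.
Qed.

Lemma gauge_act_mul (P Q : forall k, 'M[R]_(r k)) Y :
  gauge_act Q (gauge_act P Y) = gauge_act (fun k => P k *m Q k) Y.
Proof.
apply: functional_extensionality_dep => k; apply: funext => s.
by rewrite /gauge_act trmx_mul !mulmxA.
Qed.

End Gauge.
Arguments gauge_act {R d r} P Y k _.

Section Distance.
Context {R : realType} {d r : nat -> nat} {N : nat}.
Local Notation cores := (@cores R d r).
Implicit Types X Y D : cores.
Context (sb sl : R) (sl0 : 0 < sl) (slb : sl <= sb).
Context (r0 : r 0%N = 1%N) (rN : r N = 1%N) (N2 : (2 <= N)%N).
Let sb0 : 0 < sb. Proof. exact: lt_le_trans slb. Qed.
Local Notation V := (@V R d r N sb).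
Local Notation wt := (@wt R N sb).
Local Notation left_orth := (@left_orth R d r N).
Local Notation good := (@good R d r N).

Lemma cbound_preB X Y k : left_orth X -> left_orth Y -> (k < N)%N ->
  cbound (pre X k - pre Y k) ((\sum_(j < k) Num.sqrt (cnorm2 (csub X Y) j)) ^+ 2).
Proof.
move=> hX hY; elim: k => [_ p x|k IH kN].
  by rewrite subrr mul0mx frob2_0 mulr_ge0 ?sqr_ge0 ?frob2_ge0.
rewrite big_ord_recr /=.
have -> : \mxcol_s (pre X k *m X k s) - \mxcol_s (pre Y k *m Y k s) =
    \mxcol_s ((pre X k - pre Y k) *m Y k s) + \mxcol_s (pre X k *m csub X Y k s).
  rewrite -mxcolB -mxcolD; apply: eq_mxcol => s.
  by rewrite /csub mulmxBl mulmxBr [RHS]addrC [RHS]addrA subrK.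
apply: cboundD; rewrite ?sumr_ge0 ?sqrtr_ge0//.
  by apply: cbound_stack; [exact: sqr_ge0|exact: hY|exact: IH (ltnW kN)].
rewrite sqr_sqrtr ?cnorm2_ge0// -[cnorm2 _ _]mul1r; apply: cbound_stack_frob => //.
exact/cbound_orth/(pre_isom (N := N))/ltnW.
Qed.

Lemma preB_le X Y k : left_orth X -> left_orth Y -> (k < N)%N ->
  cbound (pre X k - pre Y k) (N%:R * V (csub X Y) / sb ^+ 2).
Proof.
move=> hX hY kN p x; apply: le_trans (cbound_preB hX hY kN _) _.
rewrite ler_wpM2r ?frob2_ge0// ler_pdivlMr ?exprn_gt0//.
apply: le_trans (sqr_sum_u sl0 slb _ (ltnW kN)); rewrite -exprMn.
rewrite le_eqVlt; apply/orP; left; apply/eqP; congr (_ ^+ 2).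
rewrite mulr_suml; apply: eq_bigr => j _; rewrite /u /wt.
rewrite (leq_ltn_trans (ltn_ord j) kN) sqrtrM ?sqr_ge0// sqrtr_sqr gtr0_norm//.
by rewrite mulrC.
Qed.

Lemma frob2_preB_last X Y : frob2 (pre X N - pre Y N) = tnorm2 (TT N X - TT N Y).
Proof.
rewrite (tnorm2_TTB _ _ (add0n N)) /= -mulmxBl; apply/esym.
rewrite -[RHS]frob2_tr -[LHS]frob2_tr trmx_mul trmx_const; apply: cbound_isom.
rewrite trmx_const; apply/matrixP => i j; rewrite !mxE big_ord1 !mxE mulr1.
have z (l : 'I_(r N)) : nat_of_ord l = 0%N.
  by have := leq_trans (ltn_ord l) (eq_leq rN); case: (nat_of_ord l).
by rewrite -val_eqE /= !z.
Qed.

Section Polar.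
Context (X Y : cores) (hX : left_orth X) (hY : left_orth Y) (gY : good sb sl Y).
Context (b : R) (b0 : 0 <= b) (b1 : b < 1).
Hypothesis hb : forall k, (k < N)%N -> cbound (pre X k - pre Y k) b.
Let e2 := tnorm2 (TT N X - TT N Y).

(** A sine-theta estimate. With A, A' the left interfaces and M = A'^T A, the part D = A - A' M of A
    orthogonal to A' satisfies |D| <= e / sl. The gauge is the polar factor P of M, and A - A' P
    splits orthogonally into D and A' (M - P). *)
Lemma interface_polar k : (k < N)%N -> exists P : 'M[R]_(r k), exists S : 'M[R]_(r k),
  [/\ (k == 0)%N -> P = 1%:M, P^T *m P = 1%:M,
    (pre X k)^T *m pre Y k *m P = S, frob2 (1%:M - S) <= b * (e2 / sl ^+ 2) &
    frob2 (pre X k - pre Y k *m P) <= 2 * (e2 / sl ^+ 2)].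
Proof.
move=> kN; have sl2 : 0 < sl ^+ 2 by rewrite exprn_gt0.
have AA := pre_isom r0 hX kN; have AA' := pre_isom r0 hY kN.
have e20 : 0 <= e2 / sl ^+ 2 by rewrite divr_ge0 ?tnorm2_ge0 ?sqr_ge0.
have [k0|k0] := posnP k.
  exists 1%:M, 1%:M; subst k; split; rewrite ?mulmx1 ?trmx1//.
    by rewrite addrN frob2_0 mulr_ge0.
  have e : pre X 0 = pre Y 0 by [].
  by rewrite e addrN frob2_0 mulr_ge0.
have kk : (0 < k < N)%N by rewrite k0.
have [_ hl] := gY kk.
pose A := pre X k; pose A' := pre Y k; pose Z := suf X (N - k) k.
pose Z' := suf Y (N - k) k.
pose M := A'^T *m A; pose D := A - A' *m M.
have he : e2 = frob2 (A *m Z - A' *m Z').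
  exact: tnorm2_TTB (subnK (ltnW kN)).
have hD : D = (A - A') - A' *m (A'^T *m (A - A')).
  by rewrite mulmxBr AA' mulmxBr mulmx1 opprB addrA subrK.
have cD : cbound D b.
  move=> p x; rewrite hD mulmxBl -!mulmxA.
  exact: le_trans (proj_contraction _ AA') (hb kN _).
have DD : D^T *m D = 1%:M - M^T *m M.
  have -> : D^T = A^T - M^T *m A'^T by rewrite /D linearB /= trmx_mul.
  rewrite /D mulmxBl !mulmxBr AA.
  have -> : A^T *m (A' *m M) = M^T *m M by rewrite /M trmx_mul trmxK mulmxA.
  have -> : M^T *m A'^T *m A = M^T *m M by rewrite -mulmxA.
  rewrite -(mulmxA _ A'^T) (mulmxA A'^T) AA' mul1mx.
  by rewrite subrr subr0.
have fD : frob2 D <= e2 / sl ^+ 2.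
  rewrite ler_pdivlMr// mulrC.
  (* The defects of A against A' and of A' against A have equal norms. The exchange is made because
     the lower bound sl is known for the right interface of Y. *)
  have -> : frob2 D = frob2 (A' - A *m M^T).
    have t (m : nat) (B : 'M[R]_(m, r k)) : frob2 B = \tr (B^T *m B).
      by rewrite -frob2_tr frob2E /mxdot trmxK.
    rewrite [LHS]t DD t.
    have -> : (A' - A *m M^T)^T = A'^T - M *m A^T by rewrite linearB /= trmx_mul trmxK.
    rewrite mulmxBl !mulmxBr AA'.
    have -> : A'^T *m (A *m M^T) = M *m M^T by rewrite mulmxA.
    have -> : M *m A^T *m A' = M *m M^T by rewrite /M trmx_mul trmxK -!mulmxA.
    rewrite -(mulmxA _ A^T) (mulmxA A^T) AA mul1mx subrr subr0.
    by rewrite !raddfB /= (mxtrace_mulC M).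
  apply: le_trans (hl _ _) _; rewrite -/Z'.
  have -> : (A' - A *m M^T) *m Z' = (A' *m Z' - A *m Z) - A *m (A^T *m (A' *m Z' - A *m Z)).
    rewrite mulmxBl mulmxBr [A^T *m (A *m Z)]mulmxA AA mul1mx mulmxBr opprB addrA subrK.
    by rewrite /M trmx_mul trmxK !mulmxA.
  by rewrite he [leRHS]frob2BC; apply: (proj_contraction _ AA).
have posG : posdefmx (M^T *m M).
  split; first by rewrite trmx_mul trmxK.
  move=> v v0; have -> : M^T *m M = 1%:M - D^T *m D by rewrite DD opprB addrC subrK.
  have -> : (v *m (1%:M - D^T *m D) *m v^T) 0 0 = frob2 v - frob2 (v *m D^T).
    rewrite -gram_quad frob2E /mxdot /mxtrace big_ord1 mulmxBr mulmxBl mulmx1.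
    by move: (v *m v^T) (_ *m v^T) => B1 B2; rewrite !mxE.
  have hv : frob2 (v *m D^T) <= b * frob2 v by exact: (rbound_tr cD v).
  rewrite subr_gt0 (le_lt_trans hv)// -[ltRHS]mul1r ltr_pM2r//.
  by rewrite frob2_gt0.
have [P [S [PP PS MP SS hS]]] := polar_factor posG.
have hSb : frob2 (1%:M - S) <= b * (e2 / sl ^+ 2).
  (* In D^T D one factor is measured in spectral norm (b), the other in Frobenius norm (e2 /
     sl^2). *)
  apply: le_trans hS _; rewrite -DD.
  apply: le_trans (cbound_rbound b0 cD _) _; rewrite frob2_tr ler_wpM2l//.
exists P, S; split=> //.
  by rewrite -MP /M trmx_mul trmxK.
rewrite -/A -/A'.
have -> : A - A' *m P = D + A' *m (M - P) by rewrite mulmxBr addrA subrK.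
have AD : A'^T *m D = 0.
  by rewrite mulmxBr (mulmxA A'^T A') AA' mul1mx subrr.
rewrite frob2D (mxdotC D) mxdot_mull AD mxdot0r mulr0 addr0 (cbound_isom _ AA').
have -> : M - P = P *m (S - 1%:M) by rewrite mulmxBr PS mulmx1.
rewrite (cbound_isom _ PP) (frob2BC S).
have : b * (e2 / sl ^+ 2) <= 1 * (e2 / sl ^+ 2) by apply: ler_wpM2r (ltW b1).
by move: fD hSb; lra.
Qed.

End Polar.

(** Each weighted core difference is at most 5 kap e2, where [kap] is (sb / sl)^2. Up to a factor 2
    each, it splits into a difference of consecutive interfaces (2 kap e2) and the deviation of S
    from the identity (kap e2 / 4); the 5 rounds up 2 * 2 + 2 / 4. *)
Lemma dist_le_err X Y : left_orth X -> left_orth Y -> good sb sl Y ->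
  4 * (N%:R * V (csub X Y)) <= sl ^+ 2 ->
  exists2 P, @gauge R N r P & V (csub X (gauge_act P Y)) <=
    5 * N%:R * (sb / sl) ^+ 2 * tnorm2 (TT N X - TT N Y).
Proof.
move=> hX hY gY hV; set e2 := tnorm2 _.
pose b := N%:R * V (csub X Y) / sb ^+ 2.
have sb2 : 0 < sb ^+ 2 by rewrite exprn_gt0.
have sl2 : 0 < sl ^+ 2 by rewrite exprn_gt0.
have slb2 : sl ^+ 2 <= sb ^+ 2 by rewrite ler_pXn2r ?nnegrE ?(ltW sl0) ?(ltW sb0).
have V0 : 0 <= V (csub X Y) := V_ge0 sl0 slb _.
have b0 : 0 <= b by apply: divr_ge0; [apply: mulr_ge0|exact: ltW].
have b1 : b < 1 by rewrite ltr_pdivrMr// mul1r; lra.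
have e20 : 0 <= e2 := tnorm2_ge0 _.
have hb k : (k < N)%N -> cbound (pre X k - pre Y k) b := preB_le hX hY.
have H k : exists P : 'M[R]_(r k), (k < N)%N -> exists S : 'M[R]_(r k),
    [/\ (k == 0)%N -> P = 1%:M, P^T *m P = 1%:M,
    (pre X k)^T *m pre Y k *m P = S, frob2 (1%:M - S) <= b * (e2 / sl ^+ 2) &
    frob2 (pre X k - pre Y k *m P) <= 2 * (e2 / sl ^+ 2)].
  case: (ltnP k N) => [kN|_]; last by exists 1%:M.
  by have [P hP] := interface_polar hX hY gY b0 b1 hb kN; exists P.
pose P k : 'M[R]_(r k) := if (k < N)%N then sval (cid (H k)) else 1%:M.
have hP k : (k < N)%N -> exists S : 'M[R]_(r k),
    [/\ (k == 0)%N -> P k = 1%:M, (P k)^T *m P k = 1%:M,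
    (pre X k)^T *m pre Y k *m P k = S, frob2 (1%:M - S) <= b * (e2 / sl ^+ 2) &
    frob2 (pre X k - pre Y k *m P k) <= 2 * (e2 / sl ^+ 2)].
  move=> kN; have -> : P k = sval (cid (H k)) by exact: ifT.
  exact: (svalP (cid (H k)) kN).
have gP : @gauge R N r P.
  split; last by move=> k /andP[_ kN]; have [S []] := hP k kN.
    by have [S [h _ _ _ _]] := hP 0%N (ltnW N2); exact: h.
  exact: ifF (ltnn N).
exists P => //.
pose Y' := gauge_act P Y; rewrite -/Y'.
have hY' := left_orth_gauge gP hY; have gY' := good_gauge gP gY.
rewrite -/Y' in hY' gY'.
have pg j : (j <= N)%N -> pre Y' j = pre Y j *m P j by move=> jN; exact: (pre_gauge gP).
have tg : TT N Y' = TT N Y := TT_gauge gP Y.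
clearbody Y'.
pose kap := (sb / sl) ^+ 2.
have ekap : kap = sb ^+ 2 / sl ^+ 2 by rewrite /kap expr_div_n.
have kap1 : 1 <= kap by rewrite ekap ler_pdivlMr// mul1r.
have kape : 0 <= kap * e2 by rewrite mulr_ge0//; lra.
suff hk : forall k : nat, (k < N)%N -> wt k * cnorm2 (csub X Y') k <= 5 * (kap * e2).
  apply: (@le_trans _ _ (\sum_(k < N) 5 * (kap * e2))).
    by apply: ler_sum => k _; exact: hk.
  by rewrite sumr_const card_ord -[leLHS]mulr_natr /kap le_eqVlt; apply/orP; left; apply/eqP; ring.
move=> k kN; have [S [hS0 PP MS hS hAP]] := hP k kN.
have AA := pre_isom r0 hX kN.
have wk : 0 < wt k := wt_gt0 sl0 slb k.
(* As (pre X k)^T (pre Y' k) = S, the core difference is exactly B - C; B is a block of the next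
   interface difference, contracted by (pre X k)^T. *)
pose B s := (pre X k)^T *m (pre X k *m X k s - pre Y' k *m Y' k s).
pose C s := (1%:M - S) *m Y' k s.
have hB : \sum_s frob2 (B s) <= frob2 (pre X k.+1 - pre Y' k.+1).
  rewrite /= -mxcolB frob2_mxcol; apply: ler_sum => s _.
  have h : cbound (pre X k)^T 1 := cbound_tr (cbound_rbound ler01 (cbound_orth AA)).
  by have := h _ (pre X k *m X k s - pre Y' k *m Y' k s); rewrite mul1r.
have hBC : cnorm2 (csub X Y') k <= 2 * \sum_s frob2 (B s) + 2 * \sum_s frob2 (C s).
  rewrite !mulr_sumr -big_split; apply: ler_sum => s _ /=.
  have -> : csub X Y' k s = B s - C s.
    rewrite /B mulmxBr !mulmxA AA mul1mx pg ?(ltnW kN)// mulmxA MS /C mulmxBl mul1mx.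
    by rewrite /csub opprB addrA subrK.
  by have := frob2_ge0 (B s + C s); rewrite frob2B frob2D; lra.
have h1 : wt k * \sum_s frob2 (B s) <= 2 * (kap * e2).
  apply: (@le_trans _ _ (wt k * frob2 (pre X k.+1 - pre Y' k.+1))).
    by rewrite ler_wpM2l ?(ltW wk).
  rewrite /wt; case: ifP => kN1.
    have [S1 [_ _ _ _ hAP1]] := hP _ kN1.
    rewrite pg ?(ltnW kN1)//.
    have h := ler_wpM2l (ltW sb2) hAP1; apply: le_trans h _.
    by rewrite ekap le_eqVlt; apply/orP; left; apply/eqP; field; rewrite gt_eqF.
  have kN' : k.+1 = N by apply/eqP; rewrite eqn_leq kN leqNgt kN1.
  rewrite kN' frob2_preB_last tg -/e2 mul1r.
  have : 1 * e2 <= kap * e2 by rewrite ler_wpM2r.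
  lra.
have h2 : wt k * \sum_s frob2 (C s) <= 1 / 4 * (kap * e2).
  have [k0|k0] := posnP k.
    have -> : \sum_s frob2 (C s) = 0.
      have S1 : S = 1%:M.
        rewrite -MS (hS0 (introT eqP k0)) mulmx1 -AA; congr (_ *m _).
        by move: (k0) => k0'; clear -k0'; subst k.
      by apply: big1 => s _; rewrite /C S1 addrN mul0mx frob2_0.
    by rewrite mulr0 mulr_ge0//; lra.
  have kk : (0 < k < N)%N by rewrite k0.
  have [hu _] := gY' k kk.
  (* Lower bound on the squared right interface behind core k. Undoing that interface bounds C by (1
     - S) times the interface in front of core k. *)
  pose cl : R := if (k.+1 < N)%N then sl ^+ 2 else 1.
  have hcl p (x : 'M[R]_(p, r k.+1)) : cl * frob2 x <= frob2 (x *m suf Y' (N - k.+1) k.+1).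
    rewrite /cl; case: ifP => kN1; first by have [_ h] := gY' k.+1 kN1; exact: h.
    have kN' : k.+1 = N by apply/eqP; rewrite eqn_leq kN leqNgt kN1.
    have -> : (N - k.+1)%N = 0%N by rewrite kN' subnn.
    rewrite mul1r /= -frob2_tr -[leRHS]frob2_tr trmx_mul trmx_const.
    rewrite cbound_isom// trmx_const; apply/matrixP => i j; rewrite !mxE big_ord1 !mxE mulr1.
    have z (l : 'I_(r k.+1)) : nat_of_ord l = 0%N.
      by have := leq_trans (ltn_ord l) (eq_leq (etrans (congr1 r kN') rN)); case: (nat_of_ord l).
    by rewrite -val_eqE /= !z.
  have wcl : wt k <= kap * cl.
    rewrite /wt /cl; case: ifP => _; last by rewrite mulr1.
    by rewrite ekap divfK// gt_eqF.
  have h3 : cl * \sum_s frob2 (C s) <= sb ^+ 2 * frob2 (1%:M - S).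
    apply: le_trans (hu _ (1%:M - S)).
    rewrite (_ : (N - k)%N = (N - k.+1).+1); last by rewrite -subSn.
    rewrite /= mul_mxrow frob2_mxrow mulr_sumr; apply: ler_sum => s _.
    by rewrite mulmxA; exact: hcl.
  have C0 : 0 <= \sum_s frob2 (C s) by apply: sumr_ge0 => s _; exact: frob2_ge0.
  have h4 : wt k * \sum_s frob2 (C s) <= kap * (sb ^+ 2 * frob2 (1%:M - S)).
    apply: (@le_trans _ _ (kap * cl * \sum_s frob2 (C s))); first by rewrite ler_wpM2r.
    by rewrite -mulrA ler_wpM2l//; lra.
  apply: le_trans h4 _.
  apply: (@le_trans _ _ (kap * (sb ^+ 2 * (b * (e2 / sl ^+ 2))))).
    by rewrite !ler_wpM2l ?(ltW sb2)//; lra.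
  have -> : kap * (sb ^+ 2 * (b * (e2 / sl ^+ 2))) =
      (N%:R * V (csub X Y) / sl ^+ 2) * (kap * e2).
    by rewrite /b; field; rewrite !gt_eqF.
  by rewrite ler_wpM2r// ler_pdivrMr//; lra.
have h3 := ler_wpM2l (ltW wk) hBC.
by move: h1 h2 h3; rewrite mulrDr !(mulrCA _ 2); lra.
Qed.

End Distance.

(** * Left form and tangent tensors *)

Section LeftForm.
Context {R : realType}.

Lemma const1_isom n p (x : 'M[R]_(n, p)) : n = 1%N ->
  frob2 ((const_mx 1 : 'rV[R]_n) *m x) = frob2 x.
Proof.
move=> n1; apply: cbound_isom; rewrite trmx_const.
apply/matrixP => i j; rewrite !mxE big_ord1 !mxE mulr1.
have z (l : 'I_n) : nat_of_ord l = 0%N.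
  by have := leq_trans (ltn_ord l) (eq_leq n1); case: (nat_of_ord l).
by rewrite -val_eqE /= !z.
Qed.

Lemma pif_ex m n (L : 'M[R]_(m, n)) : exists QS : 'M[R]_(m, n) * 'M[R]_n,
  [/\ QS.1 *m QS.2 = L, cbound QS.1 1 & forall p (x : 'M[R]_(n, p)),
      frob2 (QS.1 *m (QS.2 *m x)) = frob2 (QS.2 *m x)].
Proof. by have [Q [S h]] := partial_isometry_factor L; exists (Q, S). Qed.

Definition pif m n (L : 'M[R]_(m, n)) := sval (cid (pif_ex L)).

Context {d q : nat -> nat} {N : nat}.
Local Notation cores := (@cores R d q).
Context (N0 : (0 < N)%N) (q0 : q 0%N = 1%N) (qN : q N = 1%N).

(** Contractions replace orthonormal stacks, because the factor Q of a rank-deficient stack is only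
    a partial isometry. *)
Definition left_contraction (C : cores) :=
  forall k, (k.+1 < N)%N -> cbound (\mxcol_s C k s) 1.

Lemma cbound_pre_contraction (C : cores) k : left_contraction C -> (k < N)%N ->
  cbound (pre C k) 1.
Proof.
move=> hC; elim: k => [_|k IH kN] p x.
  by rewrite const1_isom// mul1r.
rewrite /= mxcol_mul frob2_mxcol.
apply: le_trans (hC k kN _ x); rewrite mxcol_mul frob2_mxcol.
by apply: ler_sum => s _; rewrite -mulmxA; have := IH (ltnW kN) _ (C k s *m x); rewrite mul1r.
Qed.

Lemma tnorm2_last (C : cores) : tnorm2 (TT N C) = frob2 (pre C N).
Proof.
rewrite (tnorm2_TT _ (add0n N)) /= -frob2_tr trmx_mul trmx_const const1_isom//.
by rewrite frob2_tr.
Qed.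

Lemma frob2_preS (C : cores) n : (0 < n)%N ->
  frob2 (pre C n) = \sum_s frob2 (pre C n.-1 *m C n.-1 s).
Proof. by case: n => //= n _; rewrite frob2_mxcol. Qed.

Lemma tnorm2_contraction (C : cores) : left_contraction C ->
  tnorm2 (TT N C) <= cnorm2 C N.-1.
Proof.
move=> hC; rewrite tnorm2_last frob2_preS//; apply: ler_sum => s _.
have kN : (N.-1 < N)%N by rewrite ltn_predL.
by have := cbound_pre_contraction hC kN (C N.-1 s); rewrite mul1r.
Qed.

Section Orthogonalize.
Context (C : cores).
Arguments C : clear implicits.

(** The factor carried to the right in a QR sweep from the left: core k is multiplied by [lfS k],
    factored as Q S, and S is passed on. The last core absorbs what remains. *)
Fixpoint lfS (k : nat) : 'M[R]_(q k) :=
  if k is k'.+1 then (pif (\mxcol_s (lfS k' *m C k' s))).2 else 1%:M.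
Definition lfQ (k : nat) := (pif (\mxcol_s (lfS k *m C k s))).1.
Definition left_form : cores := fun k s =>
  if (k.+1 < N)%N then submxcol (lfQ k) s else lfS k *m C k s.
Arguments left_form : clear implicits.

Lemma lf_spec k : [/\ lfQ k *m lfS k.+1 = \mxcol_s (lfS k *m C k s), cbound (lfQ k) 1 &
  forall p (x : 'M[R]_(q k.+1, p)), frob2 (lfQ k *m (lfS k.+1 *m x)) = frob2 (lfS k.+1 *m x)].
Proof. exact: (svalP (cid (pif_ex (\mxcol_s (lfS k *m C k s))))). Qed.

Lemma lf_mul k s : (k.+1 < N)%N -> left_form k s *m lfS k.+1 = lfS k *m C k s.
Proof.
move=> kN; rewrite /left_form kN submxcol_mul.
by have [-> _ _] := lf_spec k; rewrite mxcolK.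
Qed.

Lemma left_form_contraction : left_contraction left_form.
Proof.
move=> k kN; rewrite /left_form kN submxcolK.
by have [] := lf_spec k.
Qed.

Lemma lvec_left_form k (s : mindex k d) : (k < N)%N ->
  lvec left_form s *m lfS k = lvec C s.
Proof.
elim: k s => [s _|k IH s kN]; first by rewrite mulmx1 !lvec0.
by rewrite !lvecS -mulmxA lf_mul// mulmxA IH// ltnW.
Qed.

Lemma TT_left_form : TT N left_form = TT N C.
Proof.
apply/ffunP => s; rewrite !TTE; congr ((_ *m _) _ _).
suff h n (t : mindex n d) : n = N -> lvec left_form t = lvec C t by exact: h.
case: n t => [|n] t e; first by move: N0; rewrite -e.
rewrite !lvecS -lvec_left_form -?e// -mulmxA; congr (_ *m _).
by have hn : (n.+1 < N)%N = false by [rewrite e ltnn]; rewrite /left_form hn.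
Qed.

(** The left interface of the left form is isometric only on the range of [lfS k], which suffices to
    put the whole tensor norm into the last core. *)
Lemma pre_left_form k p (x : 'M[R]_(q k, p)) : (k < N)%N ->
  frob2 (pre left_form k *m (lfS k *m x)) = frob2 (lfS k *m x).
Proof.
elim: k p x => [|k IH] p x kN; first by rewrite const1_isom.
have [hQ _ hx] := lf_spec k.
rewrite -hx [lfQ k *m _]mulmxA hQ [pre _ _]/= !mxcol_mul !frob2_mxcol; apply: eq_bigr => s _.
rewrite -(mulmxA (pre left_form k)) (mulmxA (left_form k s)) lf_mul//.
by rewrite -(mulmxA (lfS k)) IH// ltnW.
Qed.

Lemma cnorm2_left_form : cnorm2 left_form N.-1 = tnorm2 (TT N C).
Proof.
rewrite -TT_left_form tnorm2_last frob2_preS//; apply: eq_bigr => s _.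
have h : (N.-1.+1 < N)%N = false by rewrite prednK// ltnn.
have -> : left_form N.-1 s = lfS N.-1 *m C N.-1 s by rewrite /left_form h.
by rewrite pre_left_form// ltn_predL.
Qed.

End Orthogonalize.
End LeftForm.

Section TangentCores.
Context {R : realType} {d r : nat -> nat} {N : nat} (N0 : (0 < N)%N).

Definition rank2 k := if (0 < k < N)%N then (r k + r k)%N else r k.

(** [emb1] and [emb2] embed the original bond space as first and second block of the doubled one. At
    k = 0 only the first block exists and [emb2] vanishes; at k = N only the second exists and
    [emb1] vanishes. This yields the boundary cores without casts between sizes. *)
Definition emb1 k : 'M[R]_(r k, rank2 k) :=
  \matrix_(i, j) ((k < N)%N && (j == i :> nat))%:R.
Definition emb2 k : 'M[R]_(r k, rank2 k) :=
  \matrix_(i, j) ((0 < k)%N && (j == i + (if (k < N)%N then r k else 0) :> nat)%N)%:R.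

Lemma emb_tr k (f g : 'I_(r k) -> nat) (a b : bool) :
  (forall i, f i < rank2 k)%N ->
  (\matrix_(i < r k, j < rank2 k) (a && (j == f i :> nat))%:R : 'M[R]_(_, _)) *m
  (\matrix_(i < r k, j < rank2 k) (b && (j == g i :> nat))%:R)^T =
  \matrix_(i, i') [&& a, b & f i == g i']%:R.
Proof.
move=> hf; apply/matrixP => i i'; rewrite !mxE (bigD1 (Ordinal (hf i)))//= big1 ?addr0.
  by rewrite !mxE /= eqxx andbT; case: a; case: b; rewrite /= ?mul0r ?mulr0 ?mul1r.
move=> j ji; rewrite !mxE; have -> : (nat_of_ord j == f i) = false.
  by apply/negbTE; apply: contraNneq ji => e; apply/eqP/val_inj.
by rewrite andbF mul0r.
Qed.

Lemma emb11 k : (k < N)%N -> emb1 k *m (emb1 k)^T = 1%:M.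
Proof.
move=> kN; rewrite emb_tr.
  by apply/matrixP => i j; rewrite !mxE kN /=.
by move=> i; rewrite /rank2; case: ifP => // _; rewrite (leq_trans (ltn_ord i))// leq_addr.
Qed.

Lemma emb22 k : (0 < k <= N)%N -> emb2 k *m (emb2 k)^T = 1%:M.
Proof.
move=> /andP[k0 kN]; rewrite emb_tr.
  by apply/matrixP => i j; rewrite !mxE k0 /= eqn_add2r.
by move=> i; rewrite /rank2 k0 /=; case: ifP => _; rewrite ?addn0// ltn_add2r.
Qed.

Lemma emb12 k : (k < N)%N -> emb1 k *m (emb2 k)^T = 0.
Proof.
move=> kN; rewrite emb_tr.
  apply/matrixP => i j; rewrite !mxE kN /=; have -> : (nat_of_ord i == j + r k)%N = false.
    by rewrite ltn_eqF// (leq_trans (ltn_ord i))// leq_addl.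
  by rewrite andbF.
by move=> i; rewrite /rank2; case: ifP => // _; rewrite (leq_trans (ltn_ord i))// leq_addr.
Qed.

Context (X B : @cores R d r).
Arguments X : clear implicits.
Arguments B : clear implicits.

(* Up to the boundary cores, the block matrices [X, B; 0, X]. *)
Definition tangent_cores : @cores R d rank2 := fun k s =>
  (emb1 k)^T *m X k s *m emb1 k.+1 + (emb1 k)^T *m B k s *m emb2 k.+1
  + (emb2 k)^T *m X k s *m emb2 k.+1.

Definition tangent_vec k (s : mindex k d) : 'rV[R]_(r k) :=
  \sum_(i < k) lvec (mix i X B X) s.

(** The partial product behaves like a dual number: its first block is the product of the cores of
    X, its second block the derivative of that product along B. *)
Lemma lvec_tangent k (s : mindex k d) : (k <= N)%N ->
  lvec tangent_cores s = lvec X s *m emb1 k + tangent_vec s *m emb2 k.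
Proof.
elim: k s => [s _|k IH s kN].
  rewrite /tangent_vec big_ord0 mul0mx addr0 !lvec0; apply/rowP => j.
  rewrite !mxE; have hj : (j < r 0)%N by have := ltn_ord j; rewrite {2}/rank2.
  rewrite (bigD1 (Ordinal hj))//= big1 ?addr0 => [|i ij]; rewrite !mxE N0 /= ?eqxx ?mulr1//.
  case: eqP => [e|_]; last by rewrite mulr0.
  by case/eqP: ij; apply: val_inj.
have k21 : emb2 k *m (emb1 k)^T = 0 by rewrite -[LHS]trmxK trmx_mul trmxK emb12// trmx0.
rewrite lvecS IH ?(ltnW kN)// /tangent_cores; set s' := mprefix s; set t := s ord_max.
(* At k = 0 the block [emb2] is zero, but so is the empty sum [tangent_vec]. *)
have h22 : tangent_vec s' *m (emb2 k *m (emb2 k)^T) = tangent_vec s'.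
  case: k kN s IH @s' t k21 => [|k] kN s IH s' t k21.
    by rewrite /tangent_vec big_ord0 mul0mx.
  by rewrite emb22 ?mulmx1// (ltnW kN).
rewrite !mulmxDl !mulmxDr !mulmxA.
rewrite -!(mulmxA (lvec X s') (emb1 k)) -!(mulmxA (tangent_vec s') (emb2 k)) h22.
rewrite emb11// emb12// k21 !mulmx0 !mul0mx !mulmx1 addr0 !add0r.
rewrite lvecS -/s' -/t -addrA; congr (_ + _).
rewrite /tangent_vec big_ord_recr /= lvecS mix_eq mulmxDl addrC -mulmxA.
congr (_ + _).
  rewrite mulmxA; congr (_ *m _); rewrite mulmx_suml.
  by apply: eq_bigr => i _; rewrite lvecS mix_gt.
by rewrite (lvec_ext (C := mix k X B X) (C' := X))// => j jk; rewrite mix_lt.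
Qed.

Lemma TT_tangent : TT N tangent_cores = @tangent_sum R d r N X B.
Proof.
apply/ffunP => s; rewrite TTE lvec_tangent// /tangent_sum sum_ffunE.
have -> : emb1 N = 0 by apply/matrixP => i j; rewrite !mxE ltnn.
have hN : rank2 N = r N by rewrite /rank2 ltnn andbF.
have e : emb2 N *m (const_mx 1 : 'cV_(rank2 N)) = const_mx 1.
  apply/colP => i; rewrite !mxE.
  have hi : (i < rank2 N)%N by rewrite hN.
  rewrite (bigD1 (Ordinal hi))//= big1 ?addr0 => [|j ji]; rewrite !mxE N0 ltnn addn0 /= ?eqxx ?mul1r//.
  case: eqP => [e|_]; last by rewrite mul0r.
  by case/eqP: ji; apply: val_inj.
rewrite mulmx0 add0r -mulmxA e /tangent_vec mulmx_suml summxE.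
by apply: eq_bigr => i _; rewrite TTE.
Qed.

End TangentCores.

(** * Gaussian tails and nets *)

Section GaussianTail.
Context {R : realType}.

(* For [|x| > b] the density [normal_pdf 0 s] is at most
   [exp (- b^2 / (2 s^2))] times the sum of its translates by [b] and [- b]. *)
Lemma normal_tail (s b : R) : 0 < s -> 0 <= b ->
  (normal_prob 0 s [set x | (b < `|x|)%R] <= (2 * expR (- (b ^+ 2 / (2 * s ^+ 2))))%:E)%E.
Proof.
move=> s0 b0; rewrite /normal_prob; set c := expR _.
have c0 : 0 <= c by apply: expR_ge0.
have sn : s != 0 by rewrite gt_eqF.
pose f (x : R) := c * (normal_pdf b s x + normal_pdf (- b) s x).
have mf : measurable_fun setT f.
  by apply: measurable_funM => //; apply: measurable_funD; exact: measurable_normal_pdf.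
have f0 x : 0 <= f x by rewrite mulr_ge0// addr_ge0 ?normal_pdf_ge0.
have mB : measurable [set x : R | b < `|x|].
  rewrite (_ : [set x : R | b < `|x|] = (fun x : R => `|x|) @^-1` `]b, +oo[%classic).
    rewrite -[X in measurable X]setTI; apply: (@normr_measurable R setT) => //.
  by apply/seteqP; split => x /=; rewrite in_itv /= andbT.
apply: (@le_trans _ _ (\int[lebesgue_measure]_(x in [set x : R | (b < `|x|)%R]) (f x)%:E)%E).
  apply: ge0_le_integral => //=.
  - by move=> x _; rewrite lee_fin normal_pdf_ge0.
  - by apply/measurable_EFinP; apply: measurable_funTS; exact: measurable_normal_pdf.
  - by apply/measurable_EFinP; exact: measurable_funTS.
  move=> x bx; rewrite lee_fin /f !normal_pdfE// /normal_fun.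
  rewrite -mulrDr mulrCA ler_wpM2l ?normal_peak_ge0// mulrDr /c.
  have s2 : 0 < s ^+ 2 *+ 2 by rewrite pmulrn_lgt0// exprn_gt0.
  have -> : b ^+ 2 / (2 * s ^+ 2) = b ^+ 2 / (s ^+ 2 *+ 2) by rewrite mulr_natl.
  have e y : expR (- (b ^+ 2 / (s ^+ 2 *+ 2))) * expR (- y ^+ 2 / (s ^+ 2 *+ 2)) =
      expR ((- b ^+ 2 - y ^+ 2) / (s ^+ 2 *+ 2)).
    by rewrite -expRD mulrBl !mulNr.
  rewrite !e subr0 opprK.
  have [x0|x0] := leP 0 x.
    rewrite ger0_norm// in bx.
    apply: le_trans (_ : expR ((- b ^+ 2 - (x - b) ^+ 2) / (s ^+ 2 *+ 2)) <= _).
      by rewrite ler_expR ler_wpM2r ?invr_ge0 ?(ltW s2)//; nra.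
    by rewrite lerDl expR_ge0.
  rewrite ltr0_norm// in bx.
  apply: le_trans (_ : expR ((- b ^+ 2 - (x + b) ^+ 2) / (s ^+ 2 *+ 2)) <= _).
    by rewrite ler_expR ler_wpM2r ?invr_ge0 ?(ltW s2)//; nra.
  by rewrite lerDr expR_ge0.
apply: (@le_trans _ _ (\int[lebesgue_measure]_x (f x)%:E)%E).
  apply: ge0_subset_integral => //; first exact/measurable_EFinP.
  by move=> x _; rewrite lee_fin.
have -> : (\int[lebesgue_measure]_x (f x)%:E =
    c%:E * \int[lebesgue_measure]_x ((normal_pdf b s x)%:E + (normal_pdf (- b) s x)%:E))%E.
  rewrite -ge0_integralZl//=.
  - apply/measurable_EFinP; apply: measurable_funD; exact: measurable_normal_pdf.
  - by move=> x _; rewrite -EFinD lee_fin addr_ge0 ?normal_pdf_ge0.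
rewrite ge0_integralD//=; last 4 first.
- by move=> x _; rewrite lee_fin normal_pdf_ge0.
- by apply/measurable_EFinP; exact: measurable_normal_pdf.
- by move=> x _; rewrite lee_fin normal_pdf_ge0.
- by apply/measurable_EFinP; exact: measurable_normal_pdf.
rewrite !integral_normal_pdf// -EFinD -EFinM lee_fin mulrC.
by rewrite (_ : 1 + 1 = 2 :> R)//.
Qed.

Lemma gaussian_linear_tail dsp (Omega : measurableType dsp) (P : probability Omega R)
    m (gamma : R) (eps : Omega -> 'cV[R]_m) (a : 'cV[R]_m) (K L : R) :
  gaussian_vector P 0 (gamma ^+ 2)%:M eps -> frob2 a <= K -> 0 <= L ->
  measurable [set w | Num.sqrt (2 * gamma ^+ 2 * K * L) < `|mxdot a (eps w)|] /\
  (P [set w | (Num.sqrt (2 * gamma ^+ 2 * K * L) < `|mxdot a (eps w)|)%R] <=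
    (2 * expR (- L))%:E)%E.
Proof.
move=> [meas law] aK L0; set b := Num.sqrt _.
have b0 : 0 <= b by apply: sqrtr_ge0.
have K0 : 0 <= K by apply: le_trans aK; apply: frob2_ge0.
have dotE w : mxdot a (eps w) = (a^T *m eps w) 0 0.
  by rewrite mxdotE mxE; apply: eq_bigr => i _; rewrite big_ord1 mxE.
have mdot : measurable_fun setT (fun w => mxdot a (eps w)).
  under eq_fun do rewrite mxdotE.
  apply: measurable_sum => i; under eq_fun do rewrite big_ord1.
  by apply: measurable_funM => //; exact: meas.
have mB : measurable [set x : R | b < `|x|].
  rewrite (_ : [set x : R | b < `|x|] = (fun x : R => `|x|) @^-1` `]b, +oo[%classic).
    rewrite -[X in measurable X]setTI; apply: (@normr_measurable R setT) => //.
  by apply/seteqP; split => x /=; rewrite in_itv /= andbT.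
have eS : [set w | b < `|mxdot a (eps w)|] =
    (fun w => (a^T *m eps w) 0 0) @^-1` [set x : R | b < `|x|].
  by apply/seteqP; split => w /=; rewrite dotE.
split.
  rewrite -[X in measurable X]setTI.
  exact: (mdot measurableT [set x : R | b < `|x|] mB).
rewrite eS (law a _ mB) mulmx0 mxE.
have -> : (a^T *m (gamma ^+ 2)%:M *m a) 0 0 = gamma ^+ 2 * frob2 a.
  rewrite mul_mx_scalar -scalemxAl mxE; congr (_ * _).
  by rewrite frob2E -mxdot_tr /mxdot /mxtrace big_ord1 trmxK.
(* For zero variance the law is the Dirac mass at 0, which the event excludes since b >= 0. *)
rewrite /gaussian_law; case: ifPn => [_|v0].
  rewrite diracE memNset ?lee_fin ?mulr_ge0 ?expR_ge0//=.
  by rewrite normr0 ltNge b0.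
have vpos : 0 < gamma ^+ 2 * frob2 a.
  by rewrite lt_neqAle eq_sym v0 mulr_ge0 ?sqr_ge0 ?frob2_ge0.
apply: le_trans (normal_tail _ b0) _; first by rewrite sqrtr_gt0.
have eb : b ^+ 2 = 2 * gamma ^+ 2 * K * L.
  by rewrite /b sqr_sqrtr //; do 3! (apply: mulr_ge0 => //); exact: sqr_ge0.
have ev : Num.sqrt (gamma ^+ 2 * frob2 a) ^+ 2 = gamma ^+ 2 * frob2 a.
  by rewrite sqr_sqrtr// ltW.
rewrite lee_fin ler_wpM2l// ler_expR lerN2 ev eb.
rewrite ler_pdivlMr; last by rewrite mulr_gt0.
have -> : 2 * gamma ^+ 2 * K * L = L * (2 * (gamma ^+ 2 * K)) by ring.
by rewrite ler_wpM2l// ler_wpM2l// ler_wpM2l ?sqr_ge0.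
Qed.

Lemma union_bound dsp (Omega : measurableType dsp) (P : probability Omega R)
    (T : finType) (B : T -> set Omega) (p : R) :
  (forall t, measurable (B t) /\ (P (B t) <= p%:E)%E) ->
  exists E : set Omega, [/\ measurable E, ((1 - #|T|%:R * p)%:E <= P E)%E &
    forall w, E w -> forall t, ~ B t w].
Proof.
move=> h; pose U : set Omega := \big[setU/set0]_t B t.
have [mU hU] : measurable U /\ (P U <= (\sum_(t : T) p)%:E)%E.
  rewrite /U; elim/big_rec2: _ => [|t x V _ [mV IH]]; first by rewrite measure0.
  have [mt ht] := h t; split; first exact: measurableU.
  by apply: le_trans (measureU2 _ _ _) _ => //; rewrite EFinD leeD.
exists (~` U); split; first exact: measurableC.
  rewrite probability_setC// EFinB leeB//.
  by rewrite sumr_const -mulr_natl in hU.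
by move=> w nU t Bt; apply: nU; rewrite /U (bigD1 t)//=; left.
Qed.

End GaussianTail.

Section Nets.
Context {R : realType}.

Lemma geometric_le (z : R) n : 0 <= z -> z < 1 -> \sum_(j < n) z ^+ j <= (1 - z)^-1.
Proof.
move=> z0 z1; have z1' : 0 < 1 - z by rewrite subr_gt0.
rewrite -[leRHS]mul1r ler_pdivlMr//.
have -> : (\sum_(j < n) z ^+ j) * (1 - z) = 1 - z ^+ n.
  elim: n => [|n IH]; first by rewrite big_ord0 mul0r expr0 subrr.
  by rewrite big_ord_recr /= mulrDl IH exprS; ring.
by rewrite gerBl exprn_ge0.
Qed.

(* Every point of the ball is counted with weight at least 1 by
   [e^n prod_i z^|k_i|], z = rho / (rho + 1).  Integers are encoded as pairs
   of a sign and an absolute value. *)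
Lemma l1_ball_count (I : finType) (B rho : nat) :
  #|[pred c : {ffun I -> bool * 'I_B.+1} | (\sum_i (c i).2 <= #|I| * rho)%N]|%:R <=
  (2 * expR 1 * (rho%:R + 1)) ^+ #|I| :> R.
Proof.
set A := [pred c | _]; pose z : R := rho%:R / (rho%:R + 1).
have r1 : 0 < rho%:R + 1 :> R by rewrite ltr_wpDl.
have z0 : 0 <= z by rewrite divr_ge0 ?(ltW r1).
have z1 : z < 1 by rewrite ltr_pdivrMr// mul1r ltrDl.
(* This is (1 + 1 / rho)^rho <= e; it bounds the total weight z^(n rho) of a point from below by
   e^-n. *)
have ze : (expR 1)^-1 <= z ^+ rho.
  case: (posnP rho) => [->|rho0]; first by rewrite expr0 invf_le1 ?expR_gt0// -expR0 ler_expR.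
  have r0 : 0 < rho%:R :> R by rewrite ltr0n.
  rewrite -[leRHS]invrK lef_pV2 ?posrE ?expR_gt0 ?invr_gt0 ?exprn_gt0 ?divr_gt0//.
  have -> : (z ^+ rho)^-1 = (1 + rho%:R^-1) ^+ rho.
    by rewrite -exprVn /z invf_div mulrDl divff ?gt_eqF// mul1r.
  apply: le_trans (_ : expR (rho%:R^-1) ^+ rho <= _).
    by apply: lerXn2r; rewrite ?nnegrE ?expR_ge0 ?expR_ge1Dx// addr_ge0 ?invr_ge0.
  by rewrite -expRM_natl divff ?lexx ?gt_eqF.
have h1 c : c \in A -> ((expR 1)^-1) ^+ #|I| <= \prod_i z ^+ (c i).2.
  rewrite inE => hc; rewrite prodrXr.
  apply: le_trans (_ : z ^+ (#|I| * rho) <= _).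
    by rewrite mulnC exprM; apply: lerXn2r; rewrite ?nnegrE ?invr_ge0 ?expR_ge0 ?exprn_ge0.
  by rewrite ler_wiXn2l ?(ltW z1).
have h2 : #|A|%:R * ((expR 1)^-1) ^+ #|I| <= (2 * (rho%:R + 1)) ^+ #|I| :> R.
  rewrite mulr_natl -sumr_const.
  apply: le_trans (ler_sum _ h1) _.
  apply: (@le_trans _ _ (\sum_(c : {ffun I -> bool * 'I_B.+1}) \prod_i z ^+ (c i).2)).
    rewrite [leRHS](bigID (mem A)) /= lerDl sumr_ge0// => c _.
    by rewrite prodr_ge0// => i _; rewrite exprn_ge0.
  rewrite -(bigA_distr_bigA (fun _ (j : bool * 'I_B.+1) => z ^+ j.2)) prodr_const.
  apply: lerXn2r; rewrite ?nnegrE ?mulr_ge0 ?(ltW r1)//.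
    by apply: sumr_ge0 => j _; rewrite exprn_ge0.
  rewrite -(pair_big xpredT xpredT (fun (_ : bool) (j : 'I_B.+1) => z ^+ j)) /= sumr_const card_bool.
  rewrite -[leLHS]mulr_natl ler_wpM2l//.
  apply: le_trans (geometric_le _ z0 z1) _.
  have -> : 1 - z = (rho%:R + 1)^-1 by rewrite /z; field; rewrite gt_eqF.
  by rewrite invrK.
have e1 : 0 < expR 1 ^+ #|I| :> R by rewrite exprn_gt0// expR_gt0.
move: h2; rewrite exprVn ler_pdivrMr// => /le_trans; apply.
by rewrite -exprMn le_eqVlt; apply/orP; left; apply/eqP; congr (_ ^+ _); ring.
Qed.

(** A point is encoded by the integer parts of its coordinates in units of h. These have l1 norm at
    most n rho by Cauchy-Schwarz, so the bound for l1 balls gives a count exponential in n with base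
    of order Q / eps. *)
Lemma finite_net (I : finType) (P : (I -> R) -> Prop) (x0 : I -> R) (Q eps : R) (rho : nat) :
  P x0 -> 0 <= Q -> 0 < eps -> Q / eps + 1 <= rho%:R ->
  (forall x, P x -> \sum_i x i ^+ 2 <= Q ^+ 2) ->
  exists T : finType, exists y : T -> I -> R, [/\ (forall t, P (y t)),
    #|T|%:R <= (2 * expR 1 * (rho%:R + 1)) ^+ #|I| :> R &
    forall x, P x -> exists t, \sum_i (x i - y t i) ^+ 2 <= eps ^+ 2].
Proof.
move=> Px0 Q0 e0 hrho hP.
pose n := #|I|.
(* h = eps / sqrt n: a cell of side h has diameter at most eps, and sqrt n * Q / h = n Q / eps. For
   n = 0 any positive h will do. *)
have [h [h0 hn hq]] : exists h : R, [/\ 0 < h, n%:R * h ^+ 2 <= eps ^+ 2 &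
    Num.sqrt n%:R * Q / h <= n%:R * (Q / eps)].
  have [n0|n0] := posnP n.
    by exists 1; rewrite n0 sqrtr0 !mul0r sqr_ge0.
  have sn : 0 < Num.sqrt n%:R :> R by rewrite sqrtr_gt0 ltr0n.
  exists (eps / Num.sqrt n%:R); split; first exact: divr_gt0.
    by rewrite expr_div_n sqr_sqrtr// mulrCA divff ?mulr1// gt_eqF// ltr0n.
  rewrite invf_div !mulrA -[X in _ <= X * _ / _](@sqr_sqrtr _ n%:R)// expr2.
  by rewrite le_eqVlt; apply/orP; left; apply/eqP; ring.
pose cell (x : I -> R) (i : I) : int := Num.floor (x i / h).
have absk x i : (`|cell x i|%N)%:R <= `|x i| / h + 1 :> R.
  have -> : (`|cell x i|%N)%:R = `| (cell x i)%:~R | :> R by rewrite -intr_norm natr_absz.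
  have hf := @floor_itv R (x i / h); move: hf => /andP[f1 f2].
  rewrite -[X in _ / X + _](gtr0_norm h0) -normf_div ler_norml; apply/andP; split.
    have := ler_norm (- (x i / h)); rewrite normrN.
    move: f2; rewrite intrD -/(cell x i); lra.
  have := ler_norm (x i / h); move: f1; rewrite -/(cell x i); lra.
have sumk x : P x -> (\sum_i `|cell x i|%N <= n * rho)%N.
  move=> Px; rewrite -(ler_nat R) natr_sum natrM.
  apply: le_trans (ler_sum _ (fun i _ => absk x i)) _.
  rewrite big_split /= sumr_const -mulr_suml -/n.
  have h1 : \sum_i `|x i| <= Num.sqrt n%:R * Q.
    rewrite -[leRHS]ger0_norm ?mulr_ge0 ?sqrtr_ge0// -sqrtr_sqr -[leLHS]ger0_norm ?sumr_ge0//.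
    rewrite -sqrtr_sqr ler_sqrt ?sqr_ge0// exprMn sqr_sqrtr//.
    apply: le_trans (_ : n%:R * \sum_i `|x i| ^+ 2 <= _).
      have := sqr_sum_le (fun j : 'I_n => `|x (enum_val j)|) (leqnn n).
      rewrite (sum_enum_val (fun i => `|x i|)).
      by rewrite (sum_enum_val (fun i => `|x i| ^+ 2)).
    rewrite ler_wpM2l//; apply: le_trans (hP x Px).
    by apply: ler_sum => i _; rewrite real_normK ?num_real.
  have h2 : (\sum_i `|x i|) / h <= n%:R * (Q / eps).
    by apply: le_trans hq; rewrite ler_wpM2r ?invr_ge0 ?(ltW h0).
  apply: (@le_trans _ _ (n%:R * (Q / eps + 1))); last by rewrite ler_wpM2l.
  by rewrite mulrDr mulr1 lerD2r.
pose B := (n * rho)%N.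
pose code x : {ffun I -> bool * 'I_B.+1} := [ffun i => (0 <= cell x i, inord `|cell x i|%N)].
have absB x i : P x -> (`|cell x i|%N < B.+1)%N.
  by move=> Px; rewrite ltnS (leq_trans _ (sumk x Px))// (bigD1 i)//= leq_addr.
have code_inj x y i : P x -> P y -> code x = code y -> cell x i = cell y i.
  move=> Px Py /ffunP/(_ i); rewrite !ffunE => -[e1 /(congr1 val)].
  rewrite /= !inordK ?absB//; move: e1.
  by case: (cell x i) => a; case: (cell y i) => b //=; lia.
pose A := [pred c : {ffun I -> bool * 'I_B.+1} | (\sum_i (c i).2 <= #|I| * rho)%N].
have codeA x : P x -> code x \in A.
  move=> Px; rewrite inE; apply: leq_trans (sumk x Px).
  by apply: eq_leq; apply: eq_bigr => i _; rewrite ffunE /= inordK// absB.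
(* Every occupied cell is represented by a point satisfying P, so the net lies inside the set; [x0]
   stands for the empty cells. *)
have hy c : exists y, P y /\ forall x, P x -> code x = c -> code y = c.
  have [[x [Px xc]]|nx] := pselect (exists x, P x /\ code x = c); first by exists x; split.
  by exists x0; split => // x Px xc; case: nx; exists x.
have [y hyc] := choice hy.
exists {c | c \in A}, (fun t => y (val t)); split.
- by move=> t; have [] := hyc (val t).
- by rewrite card_sig; exact: l1_ball_count.
move=> x Px; exists (exist _ (code x) (codeA x Px)) => /=.
have [Py /(_ x Px erefl) ce] := hyc (code x).
apply: le_trans hn; rewrite mulr_natl -sumr_const; apply: ler_sum => i _.
have ei := code_inj _ _ i Py Px ce.
have := @floor_itv R (x i / h); have := @floor_itv R (y (code x) i / h).
rewrite -/(cell x i) -/(cell (y (code x)) i) ei intrD.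
rewrite !ler_pdivlMr// !ltr_pdivrMr// => /andP[a1 a2] /andP[b1 b2].
rewrite -[leLHS]real_normK ?num_real// ler_pXn2r ?nnegrE ?(ltW h0)//.
rewrite ler_norml; apply/andP; split; move: a1 a2 b1 b2; rewrite !mulrDl !mul1r; lra.
Qed.

End Nets.

(** * Uniform bound on the noise *)

Section Noise.
Context {R : realType} {d q : nat -> nat} {N : nat}.
Local Notation cores := (@cores R d q).
Context (N0 : (0 < N)%N) (q0 : q 0%N = 1%N) (qN : q N = 1%N).

(** Spectral unit ball for the inner cores and Frobenius unit ball for the last. A product of such
    cores has norm at most 1, and every nonzero tensor of this format, divided by its norm, is such
    a product by its left form. *)
Definition core_ball k (c : 'I_(d k) -> 'M[R]_(q k, q k.+1)) : Prop :=
  if (k.+1 < N)%N then cbound (\mxcol_s c s) 1 else \sum_s frob2 (c s) <= 1.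

Definition cores_ball (C : cores) := forall k, (k < N)%N -> @core_ball k (C k).

(** A contraction with q_(k+1) columns has squared norm at most q_(k+1); this is weakened to a
    square so that the radius in [finite_net] is an integer. *)
Lemma core_ball_frob k (c : 'I_(d k) -> 'M[R]_(q k, q k.+1)) : (k < N)%N ->
  core_ball c -> \sum_s frob2 (c s) <= (q k.+1)%:R ^+ 2.
Proof.
move=> kN; rewrite /core_ball; case: ifPn => [_ h|kN'].
  have := h _ 1%:M; rewrite mulmx1 mul1r frob2_mxcol => /le_trans; apply.
  have -> : frob2 (1%:M : 'M[R]_(q k.+1)) = (q k.+1)%:R.
    rewrite frob2E mxdotE -[in RHS](card_ord (q k.+1)) -sumr_const.
    apply: eq_bigr => i _; rewrite (bigD1 i)//= big1 ?addr0 => [|j ji]; rewrite mxE ?eqxx ?mul1r//.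
    by rewrite eq_sym (negbTE ji) mul0r.
  by rewrite -natrX ler_nat; case: (q k.+1) => // n; rewrite expnS leq_pmulr.
have e : q k.+1 = 1%N by rewrite (_ : k.+1 = N) ?qN//; lia.
by move=> /le_trans; apply; rewrite (congr1 (fun n => n%:R ^+ 2) e) expr1n.
Qed.

Lemma core_ball_small k (c : 'I_(d k) -> 'M[R]_(q k, q k.+1)) :
  \sum_s frob2 (c s) <= 1 -> core_ball c.
Proof.
rewrite /core_ball => h; case: ifP => // _ p x.
apply: le_trans (cbound_frob _ _) _; rewrite frob2_mxcol.
by rewrite ler_wpM2r ?frob2_ge0.
Qed.

(** The base 2 e (rho + 1) of [finite_net] for rho = 2 N q_(k+1) + 1, that is, for radius q_(k+1)
    and mesh 1 / (2 N). *)
Definition net_base k : R := 4 * expR 1 * (N%:R * (q k.+1)%:R + 1).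

Lemma core_net k : (k < N)%N -> exists T : finType,
  exists y : T -> 'I_(d k) -> 'M[R]_(q k, q k.+1),
  [/\ (forall t, core_ball (y t)),
    #|T|%:R <= net_base k ^+ (d k * (q k * q k.+1)) :> R &
    forall c, core_ball c ->
      exists t, \sum_s frob2 (c s - y t s) <= (2 * N%:R)^-1 ^+ 2].
Proof.
move=> kN; pose I := ('I_(d k) * ('I_(q k) * 'I_(q k.+1)))%type.
pose dec (x : I -> R) : 'I_(d k) -> 'M[R]_(q k, q k.+1) :=
  fun s => \matrix_(i, j) x (s, (i, j)).
pose enc (c : 'I_(d k) -> 'M[R]_(q k, q k.+1)) : I -> R := fun p => c p.1 p.2.1 p.2.2.
have decK c : dec (enc c) = c.
  by apply: funext => s; apply/matrixP => i j; rewrite mxE.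
have sumE (x y : I -> R) : \sum_i (x i - y i) ^+ 2 = \sum_s frob2 (dec x s - dec y s).
  rewrite /frob2; under [RHS]eq_bigr do rewrite pair_bigA.
  by rewrite pair_bigA; apply: eq_bigr => -[s [i j]] _; rewrite !mxE.
have n2 : 0 < 2 * N%:R :> R by rewrite mulr_gt0// ltr0n.
have [T [y [y1 y2 y3]]] : exists T : finType, exists y : T -> I -> R,
    [/\ (forall t, core_ball (dec (y t))),
    #|T|%:R <= (2 * expR 1 * ((2 * N * q k.+1 + 1)%N%:R + 1)) ^+ #|{: I}| :> R &
    forall x, core_ball (dec x) -> exists t, \sum_i (x i - y t i) ^+ 2 <= (2 * N%:R)^-1 ^+ 2].
  apply: (@finite_net R _ (fun x : I -> R => core_ball (dec x)) (fun=> 0) (q k.+1)%:R).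
  - apply: core_ball_small; rewrite big1// => s _.
    by rewrite (_ : dec _ s = 0) ?frob2_0//; apply/matrixP => i j; rewrite !mxE.
  - by [].
  - by rewrite invr_gt0.
  - by rewrite invrK natrD !natrM lerD2r mulrC.
  move=> x /(core_ball_frob kN); congr (_ <= _).
  have := sumE x (fun=> 0); under eq_bigr do rewrite subr0.
  move=> ->; apply: eq_bigr => s _; rewrite [X in _ - X](_ : _ = 0) ?subr0//.
  by apply/matrixP => i j; rewrite !mxE.
exists T, (fun t => dec (y t)); split => //.
  apply: le_trans y2 _; rewrite !card_prod !card_ord /net_base.
  rewrite le_eqVlt; apply/orP; left; apply/eqP; congr (_ ^+ _).
  by rewrite natrD !natrM; ring.
move=> c hc; have [|t ht] := y3 (enc c); first by rewrite decK.
by exists t; move: ht; rewrite sumE decK.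
Qed.

Lemma cores_net : exists T : finType, exists Y : T -> cores,
  [/\ (forall t, cores_ball (Y t)),
    #|T|%:R <= \prod_(k < N) net_base k ^+ (d k * (q k * q k.+1)) :> R &
    forall C, cores_ball C -> exists t, forall k, (k < N)%N ->
      \sum_s frob2 (C k s - Y t k s) <= (2 * N%:R)^-1 ^+ 2].
Proof.
have [T hT] := choice (fun k : 'I_N => core_net (ltn_ord k)).
pose y (k : 'I_N) := sval (cid (hT k)).
have hy k := svalP (cid (hT k)).
pose Y (t : {dffun forall k : 'I_N, T k}) : cores := fun k =>
  match @idP (k < N)%N with
  | ReflectT h => y (Ordinal h) (t (Ordinal h))
  | ReflectF _ => fun=> 0
  end.
have YE t (k : 'I_N) : Y t k = y k (t k).
  case: k => k kN; rewrite /Y /= (reflect_true _ _ _ (p := kN))//.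
exists {dffun forall k : 'I_N, T k}, Y; split.
- move=> t k kN; rewrite (YE t (Ordinal kN)).
  by have [h _ _] := hy (Ordinal kN); exact: h.
- rewrite card_dep_ffun foldrE big_image /= natr_prod.
  by apply: ler_prod => k _; rewrite ler0n /=; have [_ h _] := hy k.
move=> C hC.
have ht (k : 'I_N) : exists t : T k, \sum_s frob2 (C k s - y k t s) <= (2 * N%:R)^-1 ^+ 2.
  by have [_ _ h] := hy k; apply: h; exact: hC.
exists [ffun k => sval (cid (ht k))] => k kN.
rewrite (YE _ (Ordinal kN)) ffunE; exact: (svalP (cid (ht (Ordinal kN)))).
Qed.

Lemma TT_mix_scale i (C D C' : cores) (a : R) : (i < N)%N ->
  TT N (mix i C (fun j t => a *: D j t) C') = a *: TT N (mix i C D C').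
Proof.
move=> iN; pose Z : cores := fun k s => 0.
have Z0 : TT N (mix i C Z C') = 0.
  have := @TT_mix_linear R d q N i C Z Z C' 1 iN.
  have -> : mix i C (fun j t => 1 *: Z j t + Z j t) C' = mix i C Z C'.
    congr (mix i C _ C'); apply: functional_extensionality_dep => j; apply: funext => t.
    by rewrite /Z addr0 scaler0.
  by rewrite scale1r => /eqP; rewrite -subr_eq0 opprD addrA subrr sub0r oppr_eq0 => /eqP.
rewrite -[RHS]addr0 -Z0 -TT_mix_linear//; congr (TT N (mix i C _ C')).
by apply: functional_extensionality_dep => j; apply: funext => t; rewrite /Z addr0.
Qed.

(* By multilinearity the supremum [M] over the ball satisfies [M <= b + M / 2]. *)
Lemma cores_ball_sup (W : tensor R N d -> R) (Y : cores -> Prop) (b B : R) :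
  (forall T U, W (T + U) = W T + W U) -> (forall a T, W (a *: T) = a * W T) ->
  (forall C, cores_ball C -> `|W (TT N C)| <= B) ->
  (forall C, Y C -> cores_ball C /\ `|W (TT N C)| <= b) ->
  (forall C, cores_ball C -> exists2 C', Y C' & forall k, (k < N)%N ->
      \sum_s frob2 (C k s - C' k s) <= (2 * N%:R)^-1 ^+ 2) ->
  forall C, cores_ball C -> `|W (TT N C)| <= 2 * b.
Proof.
move=> WD WZ hB hb hY.
have e0 : 0 < (2 * N%:R)^-1 :> R by rewrite invr_gt0 mulr_gt0// ltr0n.
have W_sum (F : 'I_N -> tensor R N d) : W (\sum_i F i) = \sum_i W (F i).
  have W0 : W 0 = 0 by rewrite -(scale0r 0) WZ mul0r.
  by elim/big_rec2: _ => // i x z _ <-.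
have step M : (forall C, cores_ball C -> `|W (TT N C)| <= M) ->
    forall C, cores_ball C -> `|W (TT N C)| <= b + M / 2.
  move=> hM C hC; have [C' YC' near] := hY C hC; have [hC' bC'] := hb _ YC'.
  have -> : TT N C = TT N C' + (TT N C - TT N C') by rewrite addrC subrK.
  rewrite WD (le_trans (ler_normD _ _))// lerD// TT_telescope W_sum.
  apply: le_trans (ler_norm_sum _ _ _) _.
  apply: (@le_trans _ _ (\sum_(i < N) (2 * N%:R)^-1 * M)); last first.
    rewrite sumr_const card_ord -[leLHS]mulr_natl le_eqVlt; apply/orP; left; apply/eqP.
    by field; rewrite pnatr_eq0 -lt0n.
  apply: ler_sum => i _.
  set e := (2 * N%:R)^-1 in e0 near *.
  (* Dividing by the mesh e brings the core difference back into the ball, so each of the N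
     telescoping terms is at most e M = M / (2 N). *)
  pose D : cores := fun k s => e^-1 *: (C k s - C' k s).
  have -> : mix i C (fun j t => C j t - C' j t) C' = mix i C (fun j t => e *: D j t) C'.
    congr (mix i C _ C'); apply: functional_extensionality_dep => j; apply: funext => t.
    by rewrite /D scalerA divff ?scale1r// gt_eqF.
  rewrite TT_mix_scale// WZ normrM (gtr0_norm e0) ler_wpM2l ?(ltW e0)//; apply: hM => k kN.
  have [ki|ki|ki] := ltngtP k i.
  - by rewrite mix_lt//; exact: hC.
  - by rewrite mix_gt//; exact: hC'.
  subst k; rewrite mix_eq; apply: core_ball_small; rewrite /D.
  under eq_bigr do rewrite frob2Z; rewrite -mulr_sumr exprVn.
  by rewrite mulrC ler_pdivrMr ?exprn_gt0// mul1r near.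
move=> C hC; set S := [set x | exists2 C, cores_ball C & x = `|W (TT N C)|].
have hS : has_sup S.
  by split; [exists `|W (TT N C)|, C | exists B => x [C1 h1 ->]; exact: hB].
have hM C1 : cores_ball C1 -> `|W (TT N C1)| <= sup S.
  by move=> h1; apply: (sup_upper_bound hS); exists C1.
have : sup S <= b + sup S / 2.
  apply: ge_sup => [|x [C1 h1 ->]]; first by exists `|W (TT N C)|, C.
  exact: step.
by have := hM _ hC; lra.
Qed.

(** The tail is taken at L + a: the part L cancels the size of the net in the union bound, and a is
    left as the confidence. The factor 2 in front of the square root comes from [cores_ball_sup]. *)
Lemma noise_event dsp (Omega : measurableType dsp) (P : probability Omega R) m
    (gamma : R) (eps : Omega -> 'cV[R]_m) (A : {linear tensor R N d -> 'cV[R]_m}) (K a L : R) :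
  gaussian_vector P 0 (gamma ^+ 2)%:M eps ->
  0 <= K -> (forall C : cores, frob2 (A (TT N C)) <= K * tnorm2 (TT N C)) ->
  0 <= a -> 0 <= L ->
  \prod_(k < N) net_base k ^+ (d k * (q k * q k.+1)) <= expR L ->
  exists E : set Omega, [/\ measurable E, ((1 - 2 * expR (- a))%:E <= P E)%E &
    forall w, E w -> forall C : cores, `|mxdot (A (TT N C)) (eps w)| <=
      2 * Num.sqrt (2 * gamma ^+ 2 * K * (L + a)) * tnorm (TT N C)].
Proof.
move=> gv K0 hA a0 L0 hL; set b := Num.sqrt _.
have [T [Y [Yb Tcard Ynet]]] := cores_net.
have ball_norm C : cores_ball C -> tnorm2 (TT N C) <= 1.
  move=> hC; apply: le_trans (tnorm2_contraction _ _ _ _) _ => //.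
    by move=> k kN; have := hC k (ltnW kN); rewrite /core_ball kN.
  have := hC N.-1; rewrite ltn_predL => /(_ N0); rewrite /core_ball.
  by have -> : (N.-1.+1 < N)%N = false by rewrite prednK// ltnn.
have ball_A C : cores_ball C -> frob2 (A (TT N C)) <= K.
  by move=> hC; rewrite (le_trans (hA C))// -[leRHS]mulr1 ler_wpM2l// ball_norm.
have tail t := gaussian_linear_tail gv (ball_A _ (Yb t)) (addr_ge0 L0 a0).
have [E [mE PE hE]] := union_bound tail.
exists E; split => //.
  apply: le_trans PE; rewrite lee_fin lerD2l lerN2 mulrCA ler_wpM2l//.
  rewrite opprD expRD mulrA ler_piMl ?expR_ge0// expRN.
  by rewrite ler_pdivrMr ?expR_gt0// mul1r (le_trans Tcard).
move=> w Ew C; pose W (U : tensor R N d) : R := mxdot (A U) (eps w).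
have WZ c U : W (c *: U) = c * W U by rewrite /W linearZ mxdotZl.
have sup_b : forall C : cores, cores_ball C -> `|W (TT N C)| <= 2 * b.
  (* The bound sqrt K |eps w| depends on w; it serves only to make the supremum over the ball
     finite. *)
  apply: (@cores_ball_sup W (fun C => exists t, C = Y t) b (Num.sqrt K * fnorm (eps w))) => //.
  - by move=> U U'; rewrite /W linearD mxdotDl.
  - move=> C1 h1; rewrite -sqrtr_sqr /fnorm -sqrtrM// ler_sqrt ?mulr_ge0 ?frob2_ge0//.
    by apply: le_trans (mxdot_CS2 _ _) _; rewrite ler_wpM2r ?frob2_ge0// ball_A.
  - move=> _ [t ->]; split=> //; have := hE w Ew t; rewrite /W /=.
    by move=> h; rewrite leNgt; apply/negP.
  by move=> C1 /Ynet[t ht]; exists (Y t) => //; exists t.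
rewrite -/(W _); set n := tnorm (TT N C).
have [n0|n0] := eqVneq n 0.
  have -> : TT N C = 0 by apply: tnorm2_eq0; rewrite -sqr_tnorm -/n n0 expr0n.
  by rewrite -(scale0r 0) WZ mul0r normr0 n0 mulr0.
have np : 0 < n by rewrite lt_neqAle eq_sym n0 tnorm_ge0.
(* In left form the last core carries the whole norm n, so scaling that core by 1 / n lands in the
   product of balls. *)
pose Cl : cores := fun k => @left_form R d q N C k; have Nl : (N.-1 < N)%N by rewrite ltn_predL.
pose C1 := mix N.-1 Cl (fun j t => n^-1 *: Cl j t) Cl.
have e1 : TT N C1 = n^-1 *: TT N C.
  rewrite TT_mix_scale// -(TT_left_form N0 C); congr (_ *: _); apply: TT_ext => j jN.
  by rewrite /mix; case: ltngtP => //.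
have : cores_ball C1.
  move=> k kN; rewrite /core_ball; case: ifPn => kN1.
    rewrite /C1 mix_lt; last by rewrite -ltnS prednK.
    exact: left_form_contraction.
  have -> : k = N.-1 by lia.
  rewrite /C1 mix_eq; under eq_bigr do rewrite frob2Z.
  rewrite -mulr_sumr -/(cnorm2 Cl N.-1) /Cl cnorm2_left_form// -sqr_tnorm -/n.
  by rewrite -exprMn mulVf// expr1n.
move=> /sup_b; rewrite e1 WZ normrM normfV (gtr0_norm np).
by rewrite mulrC ler_pdivrMr.
Qed.

End Noise.

(** * Size of the net *)

Section Entropy.
Context {R : realType}.

Lemma expR_half_le2 : expR 2^-1 <= 2 :> R.
Proof.
have := @expR_ge1Dx R (- 2^-1); rewrite expRN.
have h : 0 < expR 2^-1 :> R := expR_gt0 _.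
by move: h; move: (expR _) => y h; rewrite -[y^-1]div1r ler_pdivlMr//; lra.
Qed.

Lemma ln_ge_half (N : nat) : (2 <= N)%N -> 2^-1 <= ln N%:R :> R.
Proof.
move=> N2; rewrite -ler_expR lnK ?posrE ?ltr0n 1?(leq_trans _ N2)//.
by rewrite (le_trans expR_half_le2)// ler_nat.
Qed.

Context {d r : nat -> nat} {N : nat}.
Lemma rank2_le k : (rank2 (r := r) (N := N) k <= 2 * r k)%N.
Proof. by rewrite /rank2; case: ifP => _; rewrite mul2n -addnn// leq_addr. Qed.

Context (N2 : (2 <= N)%N) (r0 : r 0%N = 1%N) (rN : r N = 1%N).
Context (rpos : forall i, (0 < i < N)%N -> (0 < r i)%N).

Lemma rank_pos k : (k <= N)%N -> (0 < r k)%N.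
Proof.
move=> kN; case: (posnP k) => [->|k0]; first by rewrite r0.
move: kN; rewrite leq_eqVlt => /orP[/eqP->|kN]; first by rewrite rN.
by rewrite rpos ?k0.
Qed.

(** Numerical factors go into powers of N >= 2 through 64 = 2^6, and the rank into the exponent
    through x <= e^(x - 1). This keeps log N as the only logarithm, at the price of a factor
    r_(k+1). *)
Lemma net_base_le k : (k < N)%N ->
  net_base (q := rank2 (r := r) (N := N)) (N := N) k <= expR (8 * (r k.+1)%:R * ln N%:R) :> R.
Proof.
move=> kN; have rk : 1 <= (r k.+1)%:R :> R by rewrite ler1n rank_pos.
have NR : 2 <= N%:R :> R by rewrite ler_nat.
have q2 : (rank2 (r := r) (N := N) k.+1)%:R <= 2 * (r k.+1)%:R :> R.
  by rewrite -natrM ler_nat rank2_le.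
have e4 : expR 1 <= 4 :> R.
  have -> : 1 = 2^-1 + 2^-1 :> R by field.
  rewrite expRD; have := expR_half_le2; have := expR_gt0 (2^-1 : R); nra.
have lnh := ln_ge_half N2.
rewrite /net_base; set q := _%:R in q2 *; set x := _%:R in rk q2 *.
apply: (@le_trans _ _ (N%:R ^+ 7 * x)).
  have h1 : 4 * expR 1 * (N%:R * q + 1) <= 64 * N%:R * x.
    have h2 : N%:R * q + 1 <= 4 * N%:R * x.
      have : N%:R * q <= N%:R * (2 * x) by rewrite ler_wpM2l.
      nra.
    have q0 : 0 <= q by exact: ler0n.
    have e0 := expR_ge0 (1 : R).
    have : expR 1 * (N%:R * q + 1) <= 4 * (4 * N%:R * x).
      by rewrite ler_pM// addr_ge0// mulr_ge0.
    lra.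
  apply: le_trans h1 _; rewrite ler_wpM2r ?(le_trans _ rk)//.
  rewrite (exprSr _ 6) ler_wpM2r// (_ : 64 = 2 ^+ 6); last by ring.
  by rewrite lerXn2r ?nnegrE.
have -> : N%:R = expR (ln N%:R) :> R by rewrite lnK// posrE (lt_le_trans _ NR).
rewrite expRK -expRM_natl.
apply: (@le_trans _ _ (expR (7%:R * ln N%:R) * expR (x - 1))).
  rewrite ler_wpM2l ?expR_ge0//; have := @expR_ge1Dx R (x - 1); lra.
rewrite -expRD ler_expR; nra.
Qed.

(** Mode k contributes 4 d_k r_k r_(k+1) times 8 r_(k+1) log N. One factor r_(k+1) is bounded by B
    when k >= 1, where it has index at least 2 or is r_N = 1; for k = 0 the factor r_0 = 1 leaves
    r_1^2 <= rb^2. So B need not bound r_1. *)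
Lemma entropy_bound (db rb : nat) (B : R) : (forall k, (k < N)%N -> (d k <= db)%N) ->
  (0 < rb)%N -> (forall i, (0 < i < N)%N -> (r i <= rb)%N) ->
  1 <= B -> (forall i, (2 <= i < N)%N -> (r i)%:R <= B) ->
  \prod_(k < N) net_base (q := rank2 (r := r) (N := N)) (N := N) k ^+
     (d k * (rank2 (r := r) (N := N) k * rank2 (r := r) (N := N) k.+1)) <=
  expR (32 * N%:R * db%:R * rb%:R ^+ 2 * ln N%:R * B) :> R.
Proof.
move=> hd rb0 hr B1 hB.
have ln0 : 0 <= ln N%:R :> R by apply: le_trans (ln_ge_half N2).
have rbR : 1 <= rb%:R :> R by rewrite ler1n.
apply: (@le_trans _ _ (\prod_(k < N) expR (32 * db%:R * rb%:R ^+ 2 * ln N%:R * B))).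
  apply: ler_prod => k _; apply/andP; split.
    by rewrite exprn_ge0// !mulr_ge0 ?expR_ge0// addr_ge0// mulr_ge0.
  set n := (_ * (_ * _))%N.
  apply: (@le_trans _ _ (expR (8 * (r k.+1)%:R * ln N%:R) ^+ n)).
    rewrite lerXn2r ?nnegrE ?expR_ge0 ?net_base_le//.
    by rewrite !mulr_ge0 ?expR_ge0// addr_ge0// mulr_ge0.
  rewrite -expRM_natl ler_expR.
  have hn : n%:R <= 4 * db%:R * ((r k)%:R * (r k.+1)%:R) :> R.
    rewrite -!natrM ler_nat /n; have := rank2_le k; have := rank2_le k.+1.
    move: (hd _ (ltn_ord k)); move: (d k) (r k) (r k.+1) (rank2 _) (rank2 _) => a b c e f h1 h2 h3.
    apply: leq_trans (_ : db * (2 * b * (2 * c)) <= _)%N; last by nia.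
    by rewrite !leq_mul.
  have hr3 : (r k)%:R * (r k.+1)%:R * (r k.+1)%:R <= rb%:R ^+ 2 * B :> R.
    have rbk j : (0 < j < N)%N -> (r j)%:R <= rb%:R :> R by move=> /hr; rewrite ler_nat.
    have [k0|k0] := posnP k.
      have -> : (r k)%:R = 1 :> R by rewrite k0 r0.
      have h : (r k.+1)%:R <= rb%:R :> R by rewrite rbk// k0 /=.
      have : 0 <= (r k.+1)%:R :> R by []. 
      move: h; move: (r k.+1)%:R => x; nra.
    have hk := rbk k; rewrite k0 ltn_ord in hk; have {}hk := hk isT.
    have [e|e] := eqVneq k.+1 N.
      have -> : (r k.+1)%:R = 1 :> R by rewrite e rN.
      nra.
    have h1 : (r k.+1)%:R <= rb%:R :> R by rewrite rbk//= ltn_neqAle e ltn_ord.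
    have h2 : (r k.+1)%:R <= B by rewrite hB// ltnS k0 ltn_neqAle e ltn_ord.
    rewrite expr2 ler_pM ?mulr_ge0//.
    by rewrite ler_pM.
  apply: (@le_trans _ _ (4 * db%:R * ((r k)%:R * (r k.+1)%:R) * (8 * (r k.+1)%:R * ln N%:R))).
    by rewrite ler_wpM2r// !mulr_ge0.
  have -> : 4 * db%:R * ((r k)%:R * (r k.+1)%:R) * (8 * (r k.+1)%:R * ln N%:R) =
    32 * db%:R * ln N%:R * ((r k)%:R * (r k.+1)%:R * (r k.+1)%:R) :> R by ring.
  have -> : 32 * db%:R * rb%:R ^+ 2 * ln N%:R * B = 32 * db%:R * ln N%:R * (rb%:R ^+ 2 * B) :> R by ring.
  by rewrite ler_wpM2l// !mulr_ge0.
rewrite prodr_const card_ord -expRM_natl ler_expR le_eqVlt; apply/orP; left.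
by apply/eqP; ring.
Qed.

End Entropy.

(** * Gradient of the sensing loss *)

Lemma derive_quadratic (R : realType) (U : normedModType R) (f : U -> R^o) (x v : U) (a b : R) :
  (forall h : R, f (h *: v + x) = f x + h * a + h ^+ 2 * b) -> 'D_v f x = a.
Proof.
move=> hf; rewrite /derive; apply: cvg_lim => //.
have : (fun h : R => a + h * b) @ (0 : R)^' --> a.
  have h : (fun h : R => a + h * b) @ (0 : R) --> a + 0 * b.
    by apply: cvgD; [exact: cvg_cst|apply: cvgM; [exact: cvg_id|exact: cvg_cst]].
  by rewrite mul0r addr0 in h; exact: cvg_within_filter h.
apply: cvg_trans; apply: near_eq_cvg; near=> h.
have h0 : h != 0 by near: h; exact: nbhs_dnbhs_neq.
rewrite /= hf /GRing.scale /=.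
by field.
Unshelve. all: by end_near. Qed.

Section RetractionStep.
Context {R : realType}.

(** A step along a tangent vector T gives Y^T Y = 1 + a^2 T^T T >= 1, the condition under which the
    polar retraction is nonexpansive towards U. *)
Lemma retr_tangent m n (L B U : 'M[R]_(m, n)) (a : R) : L^T *m L = 1%:M -> U^T *m U = 1%:M ->
  let Y := L - a *: stiefel_proj L B in
  (retr Y)^T *m retr Y = 1%:M /\ frob2 (retr Y - U) <= frob2 (Y - U).
Proof.
move=> LL UU Y; apply: retr_spec => // p x.
have T0 := stiefel_proj_tangent B LL; set T := stiefel_proj L B in Y T0 *; clearbody T.
have -> : Y^T *m Y = 1%:M + a ^+ 2 *: (T^T *m T).
  have -> : Y^T = L^T - a *: T^T by rewrite /Y linearB /= linearZ.
  rewrite /Y mulmxBl !mulmxBr LL -!scalemxAl -!scalemxAr.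
  have -> : L^T *m T = - (T^T *m L) by apply/eqP; rewrite -addr_eq0 addrC T0.
  rewrite scalerN opprK opprB -addrA; congr (_ + _).
  by rewrite addrCA subrr addr0 scalerA -expr2.
rewrite mulmxDr mulmx1 mxdotDl -frob2E lerDl -scalemxAr mxdotZl mulr_ge0 ?sqr_ge0//.
rewrite mulmxA mxdot_mulr -frob2E frob2_ge0 //.
Qed.

End RetractionStep.

Lemma submxcolZ (R : realType) p n q (a : R) (B : 'M[R]_(\sum_(s < p) n, q)) s :
  submxcol (a *: B) s = a *: submxcol B s.
Proof. by apply/matrixP => i j; rewrite !mxE. Qed.

Section Factors.
Context {R : realType} {N : nat} {d r : nat -> nat}.
Local Notation cores := (@cores R d r).
Local Notation factors := (factors R N d r).
Implicit Types X Y : factors.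

Definition ext X : cores := fun k =>
  match @idP (k < N)%N with
  | ReflectT h => X (Ordinal h)
  | ReflectF _ => fun=> 0
  end.
Arguments ext X k _ : clear implicits.

Lemma ext_ord X (k : 'I_N) : ext X k = X k.
Proof.
case: k => k kN; by rewrite /ext /= (reflect_true _ _ _ (p := kN)).
Qed.

Lemma tt_tensor_ext X : tt_tensor X = TT N (ext X).
Proof.
apply/ffunP => s; rewrite !ffunE /chain; apply: eq_bigr => a _; apply: eq_bigr => b _.
congr (chain_mx _ a b); apply: functional_extensionality_dep => k.
by rewrite ext_ord.
Qed.

Lemma Lunf_ext X (k : 'I_N) : Lunf X k = \mxcol_s ext X k s.
Proof. by rewrite ext_ord. Qed.

Lemma left_orth_ext X : left_orthogonal X -> @left_orth R d r N (ext X).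
Proof.
move=> h k kN; have := h (Ordinal (ltnW kN)) kN.
by rewrite Lunf_ext tr_mxcol mul_mxrow_mxcol.
Qed.

Lemma ext_gauged Q X k : (k < N)%N -> ext (gauged Q X) k = gauge_act Q (ext X) k.
Proof.
move=> kN; rewrite -[k]/(nat_of_ord (Ordinal kN)) ext_ord /gauge_act.
by apply: funext => s; rewrite ext_ord.
Qed.

Definition core_pert (k : 'I_N) (B : 'M[R]_(\sum_(s < d k) r k, r k.+1)) : cores :=
  ext (dfwith (fun j _ => 0) k (core_of_Lunf B)).
Arguments core_pert {k} B j _ : rename.

Lemma core_pertE (k : 'I_N) (B : 'M[R]_(\sum_(s < d k) r k, r k.+1)) s :
  core_pert B k s = submxcol B s.
Proof. by rewrite /core_pert ext_ord dfwithin. Qed.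

Lemma TT_dfwith X (k : 'I_N) (M : 'M[R]_(\sum_(s < d k) r k, r k.+1)) :
  tt_tensor (dfwith X k (core_of_Lunf M)) = TT N (mix k (ext X) (core_pert M) (ext X)).
Proof.
rewrite tt_tensor_ext; apply: TT_ext => j jN; have [e|e] := eqVneq j k.
  by subst j; rewrite mix_eq ext_ord dfwithin; apply: funext => s; rewrite core_pertE.
have -> : mix k (ext X) (core_pert M) (ext X) j = ext X j.
  by rewrite /mix (negbTE e); case: ifP.
rewrite -[j]/(nat_of_ord (Ordinal jN)) !ext_ord dfwithout//.
by apply: contraNneq e => ->.
Qed.

Lemma TT_mix_self (C : cores) k : TT N (mix k C C C) = TT N C.
Proof. by apply: TT_ext => j _; rewrite /mix; do 2 case: ifP => //. Qed.

Lemma TT_mix_congr (C B B' : cores) k : B k = B' k -> TT N (mix k C B C) = TT N (mix k C B' C).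
Proof.
move=> e; apply: TT_ext => j _; rewrite /mix; case: ifP => //; case: eqP => // ->.
by rewrite e.
Qed.

Section Gradient.
Context {m : nat} (A : {linear tensor R N d -> 'cV[R]_m}) (y : 'cV[R]_m) (X : factors).

(** The differential, at the current tensor, of the loss as a function of the tensor. The core
    gradients are its compositions with the partial derivatives of [TT N]. *)
Definition residual_form (T : tensor R N d) : R :=
  m%:R^-1 * mxdot (A (TT N (ext X)) - y) (A T).

Lemma residual_formD (a : R) T U :
  residual_form (a *: T + U) = a * residual_form T + residual_form U.
Proof. by rewrite /residual_form linearP mxdotDr mxdotZr; ring. Qed.

Lemma derive_sensing_loss (k : 'I_N) (B : 'M[R]_(\sum_(s < d k) r k, r k.+1)) :
  'D_B ((fun M => sensing_loss A y (dfwith X k (core_of_Lunf M))) :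
          'M[R]_(\sum_(s < d k) r k, r k.+1) -> R^o) (Lunf X k) =
  residual_form (TT N (mix k (ext X) (core_pert B) (ext X))).
Proof.
set U := TT N (mix k _ _ _).
apply: (@derive_quadratic _ _ _ _ _ _ ((2 * m%:R)^-1 * frob2 (A U))) => h.
have eT (h' : R) : tt_tensor (dfwith X k (core_of_Lunf (h' *: B + Lunf X k))) =
    h' *: U + TT N (ext X).
  rewrite TT_dfwith -(TT_mix_self (ext X) k) -TT_mix_linear//; apply: TT_mix_congr.
  apply: funext => s; rewrite !core_pertE ext_ord.
  by rewrite submxcolD submxcolZ /Lunf mxcolK.
have := eT 0; rewrite scale0r add0r scale0r add0r => e0.
rewrite /sensing_loss eT e0.
have -> : A (h *: U + TT N (ext X)) - y = h *: A U + (A (TT N (ext X)) - y).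
  by rewrite linearD linearZ /= addrA.
rewrite (frob2D (h *: A U)) mxdotZl frob2Z (mxdotC (A U)).
rewrite /residual_form; set P := mxdot _ _; set F := frob2 _; set F' := frob2 _.
have -> : (2 * m%:R)^-1 = m%:R^-1 / 2 :> R by rewrite invfM mulrC.
by move: (m%:R^-1) => c; field.
Qed.

Lemma residual_form_mx (k : 'I_N) (B : 'M[R]_(\sum_(s < d k) r k, r k.+1)) :
  mxdot (grad (sensing_loss A y) X k) B =
  residual_form (TT N (mix k (ext X) (core_pert B) (ext X))).
Proof.
pose f (M : 'M[R]_(\sum_(s < d k) r k, r k.+1)) :=
  residual_form (TT N (mix k (ext X) (core_pert M) (ext X))).
have fP (a : R) M M' : f (a *: M + M') = a * f M + f M'.
  rewrite /f -residual_formD -TT_mix_linear//; congr residual_form; apply: TT_mix_congr.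
  by apply: funext => s; rewrite !core_pertE submxcolD submxcolZ.
have f0 : f 0 = 0.
  by have := fP 1 0 0; rewrite scale1r addr0 mul1r => /eqP;
    rewrite -subr_eq0 opprD addNKr oppr_eq0 => /eqP.
have fD M M' : f (M + M') = f M + f M' by rewrite -[M]scale1r fP mul1r scale1r.
have fZ a M : f (a *: M) = a * f M by rewrite -[a *: M]addr0 fP f0 addr0.
rewrite -/(f B) {2}[B]matrix_sum_delta mxdotE.
rewrite (big_morph f fD f0); apply: eq_bigr => i _.
rewrite (big_morph f fD f0); apply: eq_bigr => j _.
by rewrite fZ mulrC; congr (_ * _); rewrite mxE derive_sensing_loss.
Qed.

Lemma grad_mxdot (k : 'I_N) (B : cores) :
  mxdot (grad (sensing_loss A y) X k) (\mxcol_s B k s) =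
  residual_form (TT N (mix k (ext X) B (ext X))).
Proof.
rewrite residual_form_mx; congr residual_form; apply: TT_mix_congr.
by apply: funext => s; rewrite core_pertE mxcolK.
Qed.

End Gradient.

Lemma dist2E (sb : R) X Xs : dist2 sb X Xs =
  inf [set x | exists2 Q, @gauge R N r Q &
    x = @V R d r N sb (csub (ext X) (gauge_act Q (ext Xs)))].
Proof.
rewrite /dist2; congr inf; apply/seteqP; split => x [Q gQ ->]; exists Q => //.
  rewrite /V [RHS](bigID (fun k : 'I_N => (k.+1 < N)%N)) /=; congr (_ + _).
    apply: eq_bigr => k kN; rewrite /wt kN cnorm2_csub !Lunf_ext; congr (_ * frob2 (_ - _)).
    by apply: eq_mxcol => s; rewrite ext_gauged.
  apply: eq_big => [k|k /eqP kN]; first by rewrite -leqNgt eqn_leq ltn_ord.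
  rewrite /wt (_ : (k.+1 < N)%N = false) ?mul1r ?cnorm2_csub ?Lunf_ext; last by rewrite kN ltnn.
  by congr (frob2 (_ - _)); apply: eq_mxcol => s; rewrite ext_gauged.
rewrite /V [LHS](bigID (fun k : 'I_N => (k.+1 < N)%N)) /=; congr (_ + _).
  apply: eq_bigr => k kN; rewrite /wt kN cnorm2_csub !Lunf_ext; congr (_ * frob2 (_ - _)).
  by apply: eq_mxcol => s; rewrite ext_gauged.
apply: eq_big => [k|k kN]; first by rewrite -leqNgt eqn_leq ltn_ord.
rewrite /wt (negbTE kN) mul1r cnorm2_csub !Lunf_ext.
by congr (frob2 (_ - _)); apply: eq_mxcol => s; rewrite ext_gauged.
Qed.

End Factors.
Arguments ext {R N d r} X k _.

(** * Convergence *)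

Section Ranks.
Context {R : realType} {d : nat -> nat} {N : nat}.

Lemma tt_rankD i (T U : tensor R N d) : (tt_rank i (T + U)%R <= tt_rank i T + tt_rank i U)%N.
Proof.
rewrite /tt_rank (_ : unfolding i (T + U) = unfolding i T + unfolding i U) ?mxrank_add//.
by apply/matrixP => a b; rewrite !mxE ffunE.
Qed.

Lemma tt_rankN i (T : tensor R N d) : tt_rank i (- T) = tt_rank i T.
Proof.
rewrite /tt_rank (_ : unfolding i (- T) = - unfolding i T) ?mxrank_opp//.
by apply/matrixP => a b; rewrite !mxE ffunE.
Qed.

Lemma tt_rank_TT_le q (C : @cores R d q) i : (i <= N)%N -> (tt_rank i (TT N C) <= q i)%N.
Proof.
move=> iN; have : (N - i + i)%N = N by rewrite subnK.
by move: (N - i)%N => n e; subst N; exact: tt_rank_TT.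
Qed.

Lemma tt_rank_tangent r (X B : @cores R d r) i : (0 < i < N)%N ->
  (tt_rank i (@tangent_sum R d r N X B) <= r i + r i)%N.
Proof.
move=> /andP[i0 iN]; rewrite -TT_tangent ?(leq_trans _ iN)//.
apply: leq_trans (tt_rank_TT_le _ (ltnW iN)) _.
by rewrite /rank2 i0 iN.
Qed.

(** Makes the rank and noise bounds for tangent tensors available for each partial derivative, hence
    for each core gradient. *)
Lemma tangent_sum_single r (X B : @cores R d r) k : (k < N)%N ->
  exists B', @tangent_sum R d r N X B' = TT N (mix k X B X).
Proof.
move=> kN; exists (fun j s => if j == k then B j s else 0).
rewrite /tangent_sum (bigD1 (Ordinal kN))//= big1 ?addr0 => [|j jk].
  by apply: TT_ext => j _; rewrite /mix; case: ifP => // _; case: eqP => // ->.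
have jk' : (nat_of_ord j == k) = false.
  by apply/negbTE; apply: contraNneq jk => e; apply/eqP/val_inj.
pose Z : @cores R d r := fun k s => 0.
have -> : TT N (mix j X (fun i s => if i == k then B i s else 0) X) =
    TT N (mix j X (fun i t => 0 *: Z i t) X).
  apply: TT_ext => i _; rewrite /mix; case: ifP => // _; case: eqP => // ->.
  by apply: funext => s; rewrite jk' scale0r.
by rewrite TT_mix_scale// scale0r.
Qed.

End Ranks.

(** Here e = |E|, h = |H| and c is the norm bound of the residual form. Young's inequality absorbs
    the products of e, h and tau, using 1 - delta >= 23 / 30 and 1 + delta <= 37 / 30; of the
    resulting multiple of e^2, one half is kept. *)
Lemma step_arith (R : realType) (N : nat) (delta mu e h tau v v' c : R) :
  0 <= delta -> delta <= 7 / 30 -> 0 <= mu -> 0 <= e -> 0 <= h -> 0 <= tau ->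
  c = (1 + delta) * e + tau ->
  mu * N%:R * (1 + delta) ^+ 2 <= 7 / 130 ->
  v' <= v - 2 * mu * ((1 - delta) * e ^+ 2 - (1 + delta) * (e * h) - tau * (e + h))
     + 6 / 5 * N%:R * mu ^+ 2 * c ^+ 2 ->
  v' <= v - mu / 2 * e ^+ 2 + 41 / 20 * mu * h ^+ 2 + 21 * mu * tau ^+ 2.
Proof.
move=> delta0 delta1 mu0 e0 h0 t0 -> hmu hv.
have d1 : 1 <= 1 + delta by rewrite lerDl.
have c1 : ((1 + delta) * e + tau) ^+ 2 <= (1 + delta) ^+ 2 * (2 * (e ^+ 2 + tau ^+ 2)).
  have h1 : (1 + delta) * e + tau <= (1 + delta) * (e + tau) by rewrite mulrDr lerD2l ler_peMl.
  apply: (@le_trans _ _ (((1 + delta) * (e + tau)) ^+ 2)).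
    by rewrite ler_pXn2r ?nnegrE// ?addr_ge0 ?mulr_ge0 ?addr_ge0//.
  by rewrite exprMn ler_wpM2l ?sqr_ge0//; have := sqr_ge0 (e - tau); rewrite !expr2; lra.
have c2 : 6 / 5 * N%:R * mu ^+ 2 * ((1 + delta) * e + tau) ^+ 2 <=
    mu * (12 / 5 * (7 / 130)) * (e ^+ 2 + tau ^+ 2).
  have nm : 0 <= N%:R * mu ^+ 2 by rewrite mulr_ge0 ?sqr_ge0.
  have := ler_wpM2l nm c1.
  have k0 : 0 <= mu * (e ^+ 2 + tau ^+ 2) by rewrite mulr_ge0 ?addr_ge0 ?sqr_ge0.
  have := ler_wpM2l k0 hmu.
  rewrite !expr2; lra.
have eh : (1 + delta) * (e * h) <= 37 / 30 * (e * h).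
  rewrite ler_wpM2r ?mulr_ge0//; lra.
have ee : 23 / 30 * e ^+ 2 <= (1 - delta) * e ^+ 2.
  by rewrite ler_wpM2r ?sqr_ge0//; lra.
set w := (1 - delta) * e ^+ 2 - _ - _ in hv.
suff : 0 <= mu * (2 * w - (12 / 5 * (7 / 130)) * (e ^+ 2 + tau ^+ 2)
   - e ^+ 2 / 2 + 41 / 20 * h ^+ 2 + 21 * tau ^+ 2) by move: hv c2; rewrite !expr2; lra.
apply: mulr_ge0 => //.
have := sqr_ge0 (e - 3 / 2 * h); have := sqr_ge0 (e - h).
have := sqr_ge0 (e - 15 * tau); have := sqr_ge0 (h - 5 * tau).
have := sqr_ge0 e; have := sqr_ge0 h; have := sqr_ge0 tau.
move: eh ee; rewrite /w !expr2; lra.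
Qed.

Section OneStep.
Context {R : realType} {d r : nat -> nat} {N : nat}.
Local Notation cores := (@cores R d r).
Context (N2 : (2 <= N)%N) (r0 : r 0%N = 1%N) (rN : r N = 1%N).
Context (sb sl : R) (sl0 : 0 < sl) (slb : sl <= sb).
Local Notation left_orth := (@left_orth R d r N).
Local Notation V := (@V R d r N sb).
Local Notation good := (@good R d r N sb sl).
Context {m : nat} (A : {linear tensor R N d -> 'cV[R]_m}) (q : nat) (delta : R).
Context (m0 : (0 < m)%N) (rip : RIP A q delta) (hq : forall i, (0 < i < N)%N -> (4 * r i <= q)%N).
Context (delta0 : 0 <= delta) (delta1 : delta <= 7 / 30).

Let mR : 0 < m%:R :> R. Proof. by rewrite ltr0n. Qed.

Lemma rip_upper T : (forall i, (0 < i < N)%N -> (tt_rank i T <= q)%N) ->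
  fnorm (A T) <= Num.sqrt (m%:R * (1 + delta)) * tnorm T.
Proof.
move=> /rip /andP[_ h]; have d1 : 0 <= 1 + delta by rewrite addr_ge0.
rewrite /fnorm /tnorm -sqrtrM ?mulr_ge0//.
rewrite ler_sqrt ?mulr_ge0 ?tnorm2_ge0//.
by rewrite -mulrA -ler_pdivrMl.
Qed.

Lemma rip_dot T U : (forall i, (0 < i < N)%N -> (tt_rank i T <= q)%N) ->
  (forall i, (0 < i < N)%N -> (tt_rank i U <= q)%N) ->
  m%:R^-1 * mxdot (A T) (A U) <= (1 + delta) * (tnorm T * tnorm U).
Proof.
move=> hT hU; rewrite ler_pdivrMl//; apply: le_trans (mxdot_CS _ _) _.
have d1 : 0 <= m%:R * (1 + delta) by rewrite mulr_ge0// addr_ge0.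
apply: le_trans (ler_pM (fnorm_ge0 _) (fnorm_ge0 _) (rip_upper hT) (rip_upper hU)) _.
by rewrite mulrACA -expr2 sqr_sqrtr// -!mulrA.
Qed.

Section Step.
Context (X X' Y : cores) (eps : 'cV[R]_m) (mu tau : R).
Arguments X : clear implicits.
Arguments X' : clear implicits.
Arguments Y : clear implicits.
Context (G : forall k, 'M[R]_((\sum_(s < d k) r k)%N, r k.+1)).
Hypotheses (hX : left_orth X) (hY : left_orth Y) (gY : good Y).
Hypotheses (mu0 : 0 <= mu) (tau0 : 0 <= tau).
Hypothesis hmu : mu * N%:R * (1 + delta) ^+ 2 <= 7 / 130.
Hypothesis hG : forall k, (k < N)%N -> forall B : cores,
  mxdot (G k) (\mxcol_s B k s) =
  m%:R^-1 * mxdot (A (TT N X) - (A (TT N Y) + eps)) (A (TT N (mix k X B X))).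
Hypothesis noise : forall B : cores,
  `|mxdot (A (tangent_sum X B)) eps| <= m%:R * tau * tnorm (@tangent_sum R d r N X B).
Hypothesis hU : forall k, (k.+1 < N)%N ->
  frob2 (\mxcol_s X' k s - \mxcol_s Y k s) <=
  frob2 (\mxcol_s X k s - (mu / sb ^+ 2) *: stiefel_proj (\mxcol_s X k s) (G k)
         - \mxcol_s Y k s).
Hypothesis hUN : forall k, k.+1 = N -> \mxcol_s X' k s = \mxcol_s X k s - mu *: G k.
Hypothesis hV : V (csub X Y) <= sl ^+ 2 / (140 * N%:R ^+ 3).

(** E and the tangent tensors have ranks at most 2 r_i and H at most 4 r_i, which is what [hq]
    covers. The radius 140 N^3 gives mu h^2 <= 4 / 140 of the rate times V, and 41 / 20 * 4 / 140 <=
    3 / 50. *)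
Lemma one_step : V (csub X' Y) <=
  (1 + 3 / 50 * (mu * sl ^+ 2 / (N%:R * sb ^+ 2))) * V (csub X Y)
  - mu / 2 * tnorm2 (TT N X - TT N Y) + 21 * mu * tau ^+ 2.
Proof.
have sb0 : 0 < sb by exact: lt_le_trans slb.
have NR : 2 <= N%:R :> R by rewrite ler_nat.
have N0 : 0 < N%:R :> R by exact: lt_le_trans NR.
have v0 : 0 <= V (csub X Y) by apply: V_ge0 sl0 slb _.
have hV' := hV; set v := V (csub X Y) in v0 hV' *.
set E := TT N X - TT N Y; set e := tnorm E.
have e0 : 0 <= e by exact: tnorm_ge0.
have he : tnorm2 E <= e ^+ 2 by rewrite sqr_tnorm.
have hev : e ^+ 2 <= N%:R * v.
  by rewrite /e /E /v; apply: (@sqr_tnorm_err R d r N sb sl).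
have esb : 20 * e <= sb.
  rewrite -(@ler_pXn2r _ 2) ?nnegrE ?mulr_ge0 ?(ltW sb0)//.
  have h1 : N%:R * v <= sl ^+ 2 / (140 * N%:R ^+ 2).
    apply: le_trans (_ : N%:R * (sl ^+ 2 / (140 * N%:R ^+ 3)) <= _); first by rewrite ler_wpM2l// ltW.
    by rewrite le_eqVlt; apply/orP; left; apply/eqP; field; rewrite gt_eqF.
  have h2 : sl ^+ 2 / (140 * N%:R ^+ 2) <= sb ^+ 2 / 560.
    apply: ler_pM; rewrite ?sqr_ge0 ?invr_ge0 ?mulr_ge0 ?sqr_ge0//.
      by rewrite ler_pXn2r ?nnegrE ?(ltW sl0) ?(ltW sb0).
    have n2 : 2 ^+ 2 <= N%:R ^+ 2 :> R by rewrite lerXn2r ?nnegrE// ltW.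
    rewrite lef_pV2 ?posrE; [lra|lra|by rewrite ltr0n].
  have := sqr_ge0 sb; rewrite exprMn; lra.
set g : tensor R N d -> R := fun T => m%:R^-1 * mxdot (A (TT N X) - (A (TT N Y) + eps)) (A T).
have gE T : g T = m%:R^-1 * mxdot (A E) (A T) - m%:R^-1 * mxdot (A T) eps.
  by rewrite /g /E opprD addrA -linearB mxdotBl mulrBr (mxdotC eps).
have rankq (T : tensor R N d) i (n : nat) : (n <= 4)%N -> (0 < i < N)%N ->
    (tt_rank i T <= n * r i)%N -> (tt_rank i T <= q)%N.
  by move=> n4 iN h; apply: leq_trans (hq iN); rewrite (leq_trans h)// leq_mul2r n4 orbT.
have rE i : (0 < i < N)%N -> (tt_rank i E <= 2 * r i)%N.
  move=> /andP[_ iN]; rewrite /E mul2n -addnn (leq_trans (tt_rankD _ _ _))// tt_rankN.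
  by rewrite leq_add// tt_rank_TT_le// ltnW.
have rS B i : (0 < i < N)%N -> (tt_rank i (@tangent_sum R d r N X B) <= 2 * r i)%N.
  by move=> iN; rewrite mul2n -addnn tt_rank_tangent.
have noise' B : `|m%:R^-1 * mxdot (A (tangent_sum X B)) eps| <= tau * tnorm (@tangent_sum R d r N X B).
  by rewrite normrM gtr0_norm ?invr_gt0// ler_pdivrMl// mulrA noise.
pose c := (1 + delta) * e + tau.
have d1 : 0 <= 1 + delta by rewrite addr_ge0.
have c0 : 0 <= c by rewrite addr_ge0// mulr_ge0.
have hg k : (k < N)%N -> forall B : cores, g (TT N (mix k X B X)) <= c * tnorm (TT N (mix k X B X)).
  move=> kN B; have [B' <-] := tangent_sum_single X B kN.
  rewrite gE /c mulrDl lerD//; last first.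
    by have := noise' B'; rewrite ler_norml => /andP[+ _]; rewrite lerNl.
  rewrite -mulrA; apply: rip_dot => i iN; [exact: (rankq E i 2%N isT iN (rE i iN))|
    exact: (rankq _ _ 2%N isT iN (rS _ _ iN))].
have gsum D : g (tangent_sum X D) = \sum_(k < N) g (TT N (mix k X D X)).
  by rewrite /g /tangent_sum linear_sum mxdot_sumr mulr_sumr.
have hGg k : (k < N)%N -> forall B : cores, mxdot (G k) (\mxcol_s B k s) = g (TT N (mix k X B X)).
  exact: hG.
have step := @gradient_step R d r N sb sl sl0 slb r0 rN X X' Y g c e mu G
  hX gY hY e0 he esb c0 hGg hg gsum hU hUN.
set S := tangent_sum X (tangential X (csub X Y)) in step.
pose H := S - E; pose h := tnorm H.
have h0 : 0 <= h by exact: tnorm_ge0.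
have hH : h <= 2 * N%:R * v / sb.
  by apply: (@second_order R d r N sb sl) he _ => //; lra.
have SE : S = E + H by rewrite /H addrC subrK.
have rH i : (0 < i < N)%N -> (tt_rank i H <= 4 * r i)%N.
  move=> iN; rewrite /H (leq_trans (tt_rankD _ _ _))// tt_rankN.
  by rewrite (mulnDl 2 2) leq_add//; [exact: rS|exact: rE].
have gS : (1 - delta) * e ^+ 2 - (1 + delta) * (e * h) - tau * (e + h) <= g S.
  rewrite gE lerD//; last first.
    rewrite lerN2; apply: le_trans (ler_norm _) _; apply: le_trans (noise' _) _.
    by rewrite ler_wpM2l// -/S SE tnormD.
  rewrite {1}SE (_ : A (E + H) = A E + A H) ?mxdotDr ?mulrDr ?lerD//; last exact: linearD.
    have /andP[+ _] := rip (fun i iN => rankq E i 2%N isT iN (rE i iN)).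
    by rewrite frob2E -sqr_tnorm.
  have rNH i : (0 < i < N)%N -> (tt_rank i (- H) <= q)%N.
    by move=> iN; rewrite tt_rankN; exact: (rankq _ _ 4%N isT iN (rH _ iN)).
  have := rip_dot (fun i iN => rankq E i 2%N isT iN (rE i iN)) rNH.
  have -> : tnorm (- H) = h by rewrite /h /tnorm -scaleN1r tnorm2Z sqrrN expr1n mul1r.
  by rewrite linearN mxdotNr mulrN lerNl.
have step' : V (csub X' Y) <= v - 2 * mu *
    ((1 - delta) * e ^+ 2 - (1 + delta) * (e * h) - tau * (e + h)) + 6 / 5 * N%:R * mu ^+ 2 * c ^+ 2.
  apply: le_trans step _; rewrite lerD2r lerD2l lerN2 ler_wpM2l// mulr_ge0//.
apply: le_trans (step_arith delta0 delta1 mu0 e0 h0 tau0 (erefl c) hmu step') _.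
rewrite -sqr_tnorm -/e; set rho := mu * _ / _.
suff : 41 / 20 * mu * h ^+ 2 <= 3 / 50 * (rho * v) by lra.
have hh : h ^+ 2 <= 4 * N%:R ^+ 2 * v ^+ 2 / sb ^+ 2.
  rewrite (_ : 4 * _ * _ / _ = (2 * N%:R * v / sb) ^+ 2); last by field; rewrite gt_eqF.
  by rewrite ler_pXn2r ?nnegrE// ?divr_ge0 ?mulr_ge0 ?(ltW sb0)//.
have hv2 : v ^+ 2 <= v * (sl ^+ 2 / (140 * N%:R ^+ 3)) by rewrite expr2 ler_wpM2l.
apply: (@le_trans _ _ (41 / 20 * mu * (4 * N%:R ^+ 2 * (v * (sl ^+ 2 / (140 * N%:R ^+ 3))) / sb ^+ 2))).
  rewrite ler_wpM2l ?mulr_ge0//; apply: le_trans hh _.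
  by rewrite ler_wpM2r ?invr_ge0 ?sqr_ge0// ler_wpM2l ?mulr_ge0 ?sqr_ge0.
rewrite (_ : 41 / 20 * mu * _ = 41 / 700 * (rho * v)); last first.
  by rewrite /rho; field; rewrite !gt_eqF.
apply: ler_wpM2r; last lra.
apply: mulr_ge0 => //; apply: divr_ge0; first by rewrite mulr_ge0 ?sqr_ge0.
by rewrite mulr_ge0 ?sqr_ge0 ?(ltW N0).
Qed.

End Step.
End OneStep.

(** s is the fixed point of the affine recursion. As s <= b, the ball of radius b, on which the
    recursion is known, is invariant. *)
Lemma perturbed_contraction (R : realType) (a : nat -> R) (k s b : R) :
  0 <= k -> k <= 1 -> 0 <= s -> s <= b -> a 0%N <= b ->
  (forall t, a t <= b -> a t.+1 <= (1 - k) * a t + k * s) ->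
  forall t, a t <= b /\ a t <= (1 - k) ^+ t * a 0%N + s.
Proof.
move=> k0 k1 s0 sb a0 h; elim=> [|t [IH1 IH2]]; first by rewrite expr0 mul1r lerDl.
have k1' : 0 <= 1 - k by rewrite subr_ge0.
split.
  apply: le_trans (h t IH1) _; have := ler_wpM2l k1' IH1; have := ler_wpM2l k0 sb; lra.
apply: le_trans (h t IH1) _; rewrite exprS; have := ler_wpM2l k1' IH2; lra.
Qed.

Section Distance.
Context {R : realType} {d r : nat -> nat} {N : nat}.
Local Notation cores := (@cores R d r).
Context (N2 : (2 <= N)%N) (r0 : r 0%N = 1%N) (rN : r N = 1%N).
Context (sb sl : R) (sl0 : 0 < sl) (slb : sl <= sb).
Local Notation left_orth := (@left_orth R d r N).
Local Notation V := (@V R d r N sb).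
Local Notation good := (@good R d r N sb sl).
Context (Ys : cores) (hYs : left_orth Ys) (gYs : good Ys).
Arguments Ys : clear implicits.

Definition gdist (X : cores) : R :=
  inf [set x | exists2 Q, @gauge R N r Q & x = V (csub X (gauge_act Q Ys))].

Lemma gauge1 : @gauge R N r (fun=> 1%:M).
Proof. by split=> // i _; rewrite trmx1 mulmx1. Qed.

Lemma gdist_has_inf X :
  has_inf [set x | exists2 Q, @gauge R N r Q & x = V (csub X (gauge_act Q Ys))].
Proof.
split; first by exists (V (csub X (gauge_act (fun=> 1%:M) Ys))), (fun=> 1%:M) => //; exact: gauge1.
by exists 0 => _ [Q _ ->]; apply: V_ge0 sl0 slb _.
Qed.

Lemma gdist_le X Q : @gauge R N r Q -> gdist X <= V (csub X (gauge_act Q Ys)).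
Proof. by move=> gQ; apply: ge_inf; [have [] := gdist_has_inf X|exists Q]. Qed.

Lemma gdist_approx X (e : R) : 0 < e ->
  exists2 Q, @gauge R N r Q & V (csub X (gauge_act Q Ys)) < gdist X + e.
Proof.
by move=> e0; have [_ [Q gQ ->] h] := inf_adherent e0 (gdist_has_inf X); exists Q.
Qed.

Lemma gdist_ge0 X : 0 <= gdist X.
Proof.
apply: lb_le_inf; first by have [] := gdist_has_inf X.
by move=> _ [Q _ ->]; apply: V_ge0 sl0 slb _.
Qed.

Context {m : nat} (A : {linear tensor R N d -> 'cV[R]_m}) (q : nat) (delta : R).
Context (m0 : (0 < m)%N) (rip : RIP A q delta) (hq : forall i, (0 < i < N)%N -> (4 * r i <= q)%N).
Context (delta0 : 0 <= delta) (delta1 : delta <= 7 / 30).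

(** [dist_le_err] turns mu e2 / 2 into at least rho / 10 times the distance, while [one_step] loses
    3 / 50 rho; this leaves rho / 25, more than the stated rho / 50. The arbitrary e of the
    near-optimal gauge disappears at the end. *)
Lemma gdist_step (X X' : cores) (eps : 'cV[R]_m) (mu tau : R)
    (G : forall k, 'M[R]_((\sum_(s < d k) r k)%N, r k.+1)) :
  left_orth X -> 0 <= mu -> 0 <= tau -> mu * N%:R * (1 + delta) ^+ 2 <= 7 / 130 ->
  (forall k, (k < N)%N -> forall B : cores,
    mxdot (G k) (\mxcol_s B k s) =
    m%:R^-1 * mxdot (A (TT N X) - (A (TT N Ys) + eps)) (A (TT N (mix k X B X)))) ->
  (forall B : cores, `|mxdot (A (tangent_sum X B)) eps| <=
    m%:R * tau * tnorm (@tangent_sum R d r N X B)) ->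
  (forall Y, left_orth Y -> forall k, (k.+1 < N)%N ->
    frob2 (\mxcol_s X' k s - \mxcol_s Y k s) <=
    frob2 (\mxcol_s X k s - (mu / sb ^+ 2) *: stiefel_proj (\mxcol_s X k s) (G k)
           - \mxcol_s Y k s)) ->
  (forall k, k.+1 = N -> \mxcol_s X' k s = \mxcol_s X k s - mu *: G k) ->
  gdist X <= sl ^+ 2 / (145 * N%:R ^+ 3) ->
  gdist X' <= (1 - mu * sl ^+ 2 / (N%:R * sb ^+ 2) / 50) * gdist X + 21 * mu * tau ^+ 2.
Proof.
move=> hX mu0 tau0 hmu hG noise hU hUN hball.
have sb0 : 0 < sb by exact: lt_le_trans slb.
have NR : 2 <= N%:R :> R by rewrite ler_nat.
have N0 : 0 < N%:R :> R by exact: lt_le_trans NR.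
have N3 : 8 <= N%:R ^+ 3 :> R.
  by rewrite (_ : 8 = 2 ^+ 3); [rewrite lerXn2r ?nnegrE// ltW|ring].
have N30 : 0 < N%:R ^+ 3 :> R by rewrite exprn_gt0.
have sl2 : 0 < sl ^+ 2 by rewrite exprn_gt0.
set rho := mu * sl ^+ 2 / (N%:R * sb ^+ 2).
have rho0 : 0 <= rho.
  by apply: divr_ge0; [rewrite mulr_ge0 ?sqr_ge0|rewrite mulr_ge0 ?sqr_ge0 ?(ltW N0)].
(* Room for choosing a gauge whose value slightly exceeds the infimum and still meets the radius of
   [one_step]. *)
pose slack := sl ^+ 2 / (140 * N%:R ^+ 3) - sl ^+ 2 / (145 * N%:R ^+ 3).
have slack0 : 0 < slack.
  rewrite /slack (_ : _ - _ = sl ^+ 2 / N%:R ^+ 3 * (140^-1 - 145^-1)); last by field; rewrite gt_eqF.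
  by rewrite mulr_gt0 ?divr_gt0//; lra.
have near (e : R) : 0 < e -> exists Q, [/\ @gauge R N r Q,
    V (csub X (gauge_act Q Ys)) <= gdist X + e &
    V (csub X (gauge_act Q Ys)) <= sl ^+ 2 / (140 * N%:R ^+ 3)].
  move=> e0; have me : 0 < Num.min e slack by rewrite lt_min e0.
  have [Q gQ hQ] := gdist_approx X me; exists Q; split => //.
    by apply: le_trans (ltW hQ) _; rewrite lerD2l ge_min lexx.
  apply: le_trans (ltW hQ) _; apply: (@le_trans _ _ (gdist X + slack)).
    by rewrite lerD2l ge_min lexx orbT.
  by move: hball; rewrite /slack; lra.
set e2 := tnorm2 (TT N X - TT N Ys).
have he2 : rho / 10 * gdist X <= mu / 2 * e2.
  have [Q [gQ _ hQ]] := near 1 ltr01.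
  have [|P gP hP] := @dist_le_err R d r N sb sl sl0 slb r0 rN N2 X (gauge_act Q Ys)
    hX (left_orth_gauge gQ hYs) (good_gauge gQ gYs).
    apply: (@le_trans _ _ (4 * (N%:R * (sl ^+ 2 / (140 * N%:R ^+ 3))))).
      by rewrite ler_wpM2l// ler_wpM2l// ltW.
    rewrite (_ : 4 * _ = sl ^+ 2 * (35 * N%:R ^+ 2)^-1); last by field; rewrite gt_eqF.
    rewrite ler_piMr ?(ltW sl2)// invf_le1 ?mulr_gt0 ?exprn_gt0//.
    have : 2 ^+ 2 <= N%:R ^+ 2 :> R by rewrite lerXn2r ?nnegrE// ltW.
    lra.
  rewrite TT_gauge// -/e2 gauge_act_mul in hP.
  have h1 : gdist X <= 5 * N%:R * (sb / sl) ^+ 2 * e2.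
    by apply: le_trans hP; apply: gdist_le; exact: gauge_mul.
  have := ler_wpM2l rho0 h1.
  rewrite (_ : rho * (5 * N%:R * (sb / sl) ^+ 2 * e2) = 5 * mu * e2); last first.
    by rewrite /rho; field; rewrite !gt_eqF.
  lra.
apply/ler_addgt0Pr => e e0.
have c0 : 0 < 1 + 3 / 50 * rho by rewrite ltr_wpDr// mulr_ge0//; lra.
have [Q [gQ hQ1 hQ2]] := near (e / (1 + 3 / 50 * rho)) (divr_gt0 e0 c0).
have eT : TT N (gauge_act Q Ys) = TT N Ys by rewrite TT_gauge.
have oQ := left_orth_gauge gQ hYs.
have := @one_step R d r N N2 r0 rN sb sl sl0 slb m A q delta m0 rip hq delta0 delta1
  X X' (gauge_act Q Ys) eps mu tau G hX oQ (good_gauge gQ gYs) mu0 tau0 hmu.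
rewrite eT => /(_ hG noise (hU _ oQ) hUN hQ2); rewrite -/rho -/e2 => step.
apply: le_trans (gdist_le X' gQ) _; apply: le_trans step _.
have h1 := ler_wpM2l (ltW c0) hQ1.
rewrite (mulrDr _ (gdist X)) (mulrC _ (e / _)) divfK ?gt_eqF// in h1.
have g0 : 0 <= rho * gdist X by rewrite mulr_ge0 ?gdist_ge0.
lra.
Qed.

End Distance.

(** * Numerical constants and singular values of the target *)

Section Numerics.
Context {R : realType}.
Implicit Types (x y n delta mu D : R).

(** 7 - 30 delta <= 7 and 20 (9 n - 5) >= 130 n, with equality in the latter at n = 2. *)
Lemma step_size_bound n delta mu : 2 <= n -> 0 <= delta -> 0 <= mu ->
  mu <= (7 - 30 * delta) / (20 * (9 * n - 5) * (1 + delta) ^+ 2) ->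
  mu * n * (1 + delta) ^+ 2 <= 7 / 130.
Proof.
move=> n2 d0 mu0; have x0 : 0 < (1 + delta) ^+ 2 by rewrite exprn_gt0// ltr_wpDr.
move: x0; move: (_ ^+ 2) => x x0.
have c0 : 0 < 20 * (9 * n - 5) * x by rewrite mulr_gt0//; lra.
rewrite ler_pdivlMr// => h.
have : 0 <= mu * x * (n - 2) by rewrite mulr_ge0 ?mulr_ge0 ?(ltW x0)//; lra.
lra.
Qed.

(** The constant 145 comes from the leading coefficients: 7 * 145 = 1015 lies just below 8 * 129 =
    1032. *)
Lemma initial_radius n delta D x : 2 <= n -> 0 <= delta -> delta <= 7 / 30 -> n + 1 <= D -> 0 <= x ->
  (7 - 30 * delta) * x / (8 * D * (129 * n ^+ 2 + 7231 * n - 7360)) <= x / (145 * n ^+ 3).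
Proof.
move=> n2 d0 d1 hD x0.
have n0 : 0 < n by lra.
have p0 : 0 < 129 * n ^+ 2 + 7231 * n - 7360 by have := sqr_ge0 n; lra.
have hp : 7 * (145 * n ^+ 3) <= 8 * (n + 1) * (129 * n ^+ 2 + 7231 * n - 7360).
  have h2 : 0 <= n ^+ 2 * (n - 2) by rewrite mulr_ge0 ?sqr_ge0 ?subr_ge0.
  have h3 : 0 <= n * (n - 2) by rewrite mulr_ge0 ?(ltW n0) ?subr_ge0.
  by move: h2 h3; rewrite (exprSr n 2) expr2; clear -n2; lra.
move: (129 * n ^+ 2 + _ - _) p0 hp => p p0 hp.
have D0 : 0 < D by lra.
have c0 : 0 < 8 * D * p by rewrite !mulr_gt0.
have n30 : 0 < n ^+ 3 by rewrite exprn_gt0.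
move: (145 * n ^+ 3) (mulr_gt0 (ltr0Sn R 144) n30) hp => c c1 hp.
rewrite ler_pdivrMr// mulrAC ler_pdivlMr// mulrAC [leRHS]mulrC.
apply: ler_wpM2r => //.
apply: (@le_trans _ _ (8 * (n + 1) * p)); last by rewrite ler_wpM2r ?(ltW p0)//; lra.
by apply: le_trans hp; rewrite ler_wpM2r ?(ltW c1)//; lra.
Qed.

End Numerics.

Section Singular.
Context {R : realType} {d : nat -> nat} {N : nat}.

Lemma sigma_max_ge (T : tensor R N d) k : (0 < k < N)%N ->
  sigma 1 (unfolding k T) <= sigma_max T.
Proof.
move=> kN; rewrite /sigma_max.
have : k \in index_iota 1 N by rewrite mem_index_iota.
move: (sigma 1 (unfolding 1 T)) => x.
elim: (index_iota 1 N) => // j s IH; rewrite inE big_cons le_max => /orP[/eqP->|/IH->].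
  by rewrite lexx.
by rewrite orbT.
Qed.

Lemma sigma_min_le (T : tensor R N d) k : (0 < k < N)%N -> sigma_min T <= sigma_tt k T.
Proof.
move=> kN; rewrite /sigma_min.
have : k \in index_iota 1 N by rewrite mem_index_iota.
move: (sigma_tt 1 T) => x.
elim: (index_iota 1 N) => // j s IH; rewrite inE big_cons ge_min => /orP[/eqP->|/IH->].
  by rewrite lexx.
by rewrite orbT.
Qed.

Lemma sigma_min_gt0 (T : tensor R N d) : (1 < N)%N ->
  (forall k, (0 < k < N)%N -> (0 < tt_rank k T)%N) -> 0 < sigma_min T.
Proof.
move=> N1 h; rewrite /sigma_min big_seq.
have h' k : (0 < k < N)%N -> 0 < sigma_tt k T by move=> /h; exact: sigma_rank_gt0.
elim/big_rec: _ => [|i x]; first exact: h'.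
by rewrite mem_index_iota lt_min => /h'->.
Qed.

Lemma good_sigma r (Y : @cores R d r) (sb sl : R) :
  r 0%N = 1%N -> @left_orth R d r N Y -> 0 <= sl ->
  (forall k, (0 < k < N)%N -> (0 < r k)%N /\ tt_rank k (TT N Y) = r k) ->
  (forall k, (0 < k < N)%N -> sigma 1 (unfolding k (TT N Y)) <= sb /\ sl <= sigma_tt k (TT N Y)) ->
  @good R d r N sb sl Y.
Proof.
move=> r0 oY sl0 hr hs k kN; have [rk0 rk] := hr k kN; have [hsb hsl] := hs k kN.
have /andP[k0 kN'] := kN.
have pk := pre_isom r0 oY kN'.
have s0 : 0 <= sigma 1 (unfolding k (TT N Y)) by exact: sigma1_ge0.
split=> p x.
  apply: (@le_trans _ _ (sigma 1 (unfolding k (TT N Y)) ^+ 2 * frob2 x)).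
    have e : (N - k + k)%N = N by rewrite subnK// ltnW.
    move: (N - k)%N e => n e; subst N; exact: suf_rbound.
  by rewrite ler_wpM2r ?frob2_ge0// lerXn2r ?nnegrE ?(le_trans s0).
apply: (@le_trans _ _ (sigma_tt k (TT N Y) ^+ 2 * frob2 x)).
  by rewrite ler_wpM2r ?frob2_ge0// lerXn2r ?nnegrE ?(le_trans sl0).
move: rk; have e : (N - k + k)%N = N by rewrite subnK// ltnW.
by move: (N - k)%N e => n e; subst N => rk; exact: suf_lower.
Qed.

End Singular.

Section Convergence.
Context {R : realType} {d r : nat -> nat} {N : nat}.
Context (N2 : (2 <= N)%N) (r0 : r 0%N = 1%N) (rN : r N = 1%N).
Context (sb sl : R) (sl0 : 0 < sl) (slb : sl <= sb).
Context (Xs : factors R N d r) (hXs : left_orthogonal Xs) (gXs : @good R d r N sb sl (ext Xs)).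
Context {m : nat} (A : {linear tensor R N d -> 'cV[R]_m}) (q : nat) (delta : R).
Context (m0 : (0 < m)%N) (rip : RIP A q delta) (hq : forall i, (0 < i < N)%N -> (4 * r i <= q)%N).
Context (delta0 : 0 <= delta) (delta1 : delta <= 7 / 30).
Context (eps : 'cV[R]_m) (mu tau : R) (X : nat -> factors R N d r).
Context (mu0 : 0 <= mu) (tau0 : 0 <= tau) (hmu : mu * N%:R * (1 + delta) ^+ 2 <= 7 / 130).
Context (rgd : RGD (sensing_loss A (A (tt_tensor Xs) + eps)) sb mu X).
Context (oX0 : left_orthogonal (X 0%N)).
Hypothesis noise : forall C B : @cores R d r, `|mxdot (A (tangent_sum C B)) eps| <=
    m%:R * tau * tnorm (@tangent_sum R d r N C B).

Lemma RGD_orth t : left_orthogonal (X t).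
Proof.
elim: t => // t IH k kN; have [/(_ kN) -> _] := rgd t k.
by have [] := retr_tangent (grad (sensing_loss A (A (tt_tensor Xs) + eps)) (X t) k)
  (mu / sb ^+ 2) (IH k kN) (IH k kN).
Qed.

Lemma dist2_gdist Y : dist2 sb Y Xs = @gdist R d r N sb (ext Xs) (ext Y).
Proof. exact: dist2E. Qed.

Lemma dist2_step t : dist2 sb (X t) Xs <= sl ^+ 2 / (145 * N%:R ^+ 3) ->
  dist2 sb (X t.+1) Xs <=
  (1 - mu * sl ^+ 2 / (N%:R * sb ^+ 2) / 50) * dist2 sb (X t) Xs + 21 * mu * tau ^+ 2.
Proof.
rewrite !dist2_gdist.
pose F := sensing_loss A (A (tt_tensor Xs) + eps) : factors R N d r -> R.
pose G k : 'M[R]_((\sum_(s < d k) r k)%N, r k.+1) :=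
  match @idP (k < N)%N with
  | ReflectT h => grad F (X t) (Ordinal h)
  | ReflectF _ => 0
  end.
have GE (k : 'I_N) : G k = grad F (X t) k.
  by case: k => k kN; rewrite /G /= (reflect_true _ _ _ (p := kN)).
have oX := left_orth_ext (RGD_orth t).
apply: (@gdist_step R d r N N2 r0 rN sb sl sl0 slb (ext Xs) (left_orth_ext hXs) gXs
  m A q delta m0 rip hq delta0 delta1 (ext (X t)) (ext (X t.+1)) eps mu tau G) => //.
- move=> k kN B; have := grad_mxdot A (A (tt_tensor Xs) + eps) (X t) (Ordinal kN) B.
  by rewrite -GE /residual_form (tt_tensor_ext Xs).
- move=> Y oY k kN; have [/(_ kN) h _] := rgd t (Ordinal (ltnW kN)).
  rewrite -/F -GE !Lunf_ext /= in h; rewrite h.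
  exact: (retr_tangent _ _ (left_orth_mxcol oX kN) (left_orth_mxcol oY kN)).2.
move=> k kN; have kN' : (k < N)%N by rewrite -kN.
have [_ /(_ kN) h] := rgd t (Ordinal kN').
by rewrite -/F -GE !Lunf_ext /= in h; rewrite h.
Qed.

Lemma rate_le1 : mu * sl ^+ 2 / (N%:R * sb ^+ 2) / 50 <= 1.
Proof.
have sb0 : 0 < sb by exact: lt_le_trans slb.
have NR : 2 <= N%:R :> R by rewrite ler_nat.
have N0 : 0 < N%:R :> R by exact: lt_le_trans NR.
have N1 : 1 <= N%:R :> R by lra.
have d1 : 1 <= (1 + delta) ^+ 2 by rewrite exprn_ege1// lerDl.
have mu1 : mu <= 1.
  have h1 : mu * 1 <= mu * N%:R by rewrite ler_wpM2l.
  have h2 : mu * N%:R * 1 <= mu * N%:R * (1 + delta) ^+ 2 by rewrite ler_wpM2l// mulr_ge0.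
  by move: hmu; lra.
rewrite ler_pdivrMr// ler_pdivrMr ?mulr_gt0 ?exprn_gt0//.
have h1 : mu * sl ^+ 2 <= 1 * sb ^+ 2.
  by rewrite ler_pM ?sqr_ge0// lerXn2r ?nnegrE ?(ltW sl0) ?(ltW sb0).
have h2 : 1 * sb ^+ 2 <= N%:R * sb ^+ 2 by rewrite ler_wpM2r ?sqr_ge0.
have : 0 <= N%:R * sb ^+ 2 by rewrite mulr_ge0 ?sqr_ge0.
lra.
Qed.

(** The steady state s is the noise term 21 mu tau^2 divided by the rate mu sl^2 / (50 N sb^2),
    whence 1050 = 21 * 50. *)
Lemma dist2_convergence : let s := 1050 * N%:R * (sb / sl) ^+ 2 * tau ^+ 2 in
  s <= sl ^+ 2 / (145 * N%:R ^+ 3) ->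
  dist2 sb (X 0%N) Xs <= sl ^+ 2 / (145 * N%:R ^+ 3) ->
  forall t, 0 <= dist2 sb (X t) Xs /\ dist2 sb (X t) Xs <=
    (1 - mu * sl ^+ 2 / (N%:R * sb ^+ 2) / 50) ^+ t * dist2 sb (X 0%N) Xs + s.
Proof.
move=> s hs h0.
have sb0 : 0 < sb by exact: lt_le_trans slb.
have NR : 2 <= N%:R :> R by rewrite ler_nat.
have N0 : 0 < N%:R :> R by exact: lt_le_trans NR.
set k := mu * sl ^+ 2 / (N%:R * sb ^+ 2) / 50.
have k0 : 0 <= k.
  apply: divr_ge0 => //; apply: divr_ge0; first by rewrite mulr_ge0 ?sqr_ge0.
  by rewrite mulr_ge0 ?sqr_ge0 ?(ltW N0).
have k1 : k <= 1 := rate_le1.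
have s0 : 0 <= s.
  rewrite /s; apply: mulr_ge0; [|exact: sqr_ge0].
  by apply: mulr_ge0; [rewrite -natrM ler0n|exact: sqr_ge0].
have ks : k * s = 21 * mu * tau ^+ 2.
  by rewrite /k /s; field; rewrite !gt_eqF.
move=> t; split; first by rewrite dist2_gdist; apply: gdist_ge0 sl0 slb _ _.
have [] := @perturbed_contraction R (fun t => dist2 sb (X t) Xs) k s _ k0 k1 s0 hs h0 _ t => //.
by move=> j hj; rewrite ks; exact: dist2_step.
Qed.

End Convergence.

(** * The theorem *)

Section FinalNumerics.
Context {R : realType}.

(** Used with t2 = tau^2 to show that the steady state lies in the invariant ball. The power n^5 in
    the sample size collects one n from the error bound, one from the entropy and three from the
    radius. *)
Lemma steady_state_radius (C a b c n Z k2 t2 s2 m : R) :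
  0 <= a -> 0 < b -> a * b * c <= C -> 0 < n -> 0 < m -> 0 < s2 ->
  0 <= Z -> 0 <= k2 -> t2 * m <= c * n * Z -> C * (n ^+ 5 * Z * k2) / s2 <= m ->
  a * n * k2 * t2 <= s2 / (b * n ^+ 3).
Proof.
move=> a0 b0 hC n0 m0 s20 Z0 k0 ht; rewrite ler_pdivrMr// => hm.
have n3 : 0 < b * n ^+ 3 by rewrite mulr_gt0 ?exprn_gt0.
rewrite ler_pdivlMr// -(ler_pM2l m0).
have n4 : 0 <= a * b * (n ^+ 4 * k2) by rewrite !mulr_ge0 ?exprn_ge0 ?(ltW n0) ?(ltW b0)//.
have h1 := ler_wpM2l n4 ht.
have z5 : 0 <= n ^+ 5 * Z * k2 by rewrite !mulr_ge0 ?exprn_ge0 ?(ltW n0)//.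
have h2 := ler_wpM2r z5 hC.
have -> : m * (a * n * k2 * t2 * (b * n ^+ 3)) = a * b * (n ^+ 4 * k2) * (t2 * m) by ring.
apply: le_trans h1 _; apply: le_trans hm; apply: le_trans h2.
by rewrite le_eqVlt; apply/orP; left; apply/eqP; ring.
Qed.

(** Used with t2 = kappa^2 tau^2. The denominator eta = 7 - 30 delta is introduced through eta <= c
    with c = 7, and the factor n + mu through n >= 1. *)
Lemma steady_state_error (C a b c n m mu eta D W t2 : R) :
  0 <= a -> 0 <= b -> 0 <= c -> a * b * c <= C -> 1 <= n -> 0 < m -> 0 <= mu ->
  0 < eta -> eta <= c -> 0 <= D -> 0 <= W -> t2 * m <= b * n * W * D ->
  a * n * t2 <= C * ((n + mu) * D * n ^+ 2 * W) / (m * eta).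
Proof.
move=> a0 b0 c0 hC n1 m0 mu0 eta0 etac D0 W0 ht.
have n0 : 0 < n by exact: lt_le_trans n1.
have wd : 0 <= W * D by rewrite mulr_ge0.
rewrite ler_pdivlMr ?mulr_gt0//.
have e1 : a * n * t2 * (m * eta) = a * n * eta * (t2 * m) by ring.
have c1 : 0 <= a * n * eta by rewrite !mulr_ge0 ?(ltW n0) ?(ltW eta0)//.
rewrite e1; apply: le_trans (ler_wpM2l c1 ht) _.
have e2 : a * n * eta * (b * n * W * D) = a * b * (n ^+ 2 * (W * D)) * eta by ring.
have nw : 0 <= n ^+ 2 * (W * D) by rewrite mulr_ge0 ?exprn_ge0 ?(ltW n0)//.
have c2 : 0 <= a * b * (n ^+ 2 * (W * D)) by rewrite mulr_ge0// mulr_ge0.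
rewrite e2; apply: le_trans (ler_wpM2l c2 etac) _.
have h3 := ler_wpM2r nw hC.
rewrite mulrAC; apply: le_trans h3 _.
have C0 : 0 <= C by apply: le_trans hC; rewrite !mulr_ge0.
have -> : C * ((n + mu) * D * n ^+ 2 * W) = C * (n ^+ 2 * (W * D)) * (n + mu) by ring.
by apply: ler_peMr; [rewrite mulr_ge0|rewrite (le_trans n1)// lerDl].
Qed.

(** Passes from the rate obtained, mu / (50 N kappa^2), to the one claimed, by N <= D and 7 / 1280
    <= 1 / 50. *)
Lemma rate_le (n D k2 mu eta : R) : 0 < n -> n <= D -> 0 < k2 -> 0 <= mu -> 0 <= eta -> eta <= 7 ->
  eta / (1280 * D * k2) * mu <= mu / (n * k2) / 50.
Proof.
move=> n0 nD k0 mu0 e0 e7; have D0 : 0 < D by exact: lt_le_trans nD.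
rewrite mulrC -[leRHS]mulrA ler_wpM2l//.
have p1 : 0 < 1280 * D * k2 by rewrite !mulr_gt0 ?ltr0n.
rewrite ler_pdivrMr// -invfM mulrC ler_pdivlMr ?mulr_gt0 ?ltr0n//.
have : k2 * (eta * n) <= k2 * (7 * D) by rewrite ler_wpM2l ?(ltW k0)// ler_pM// ltW.
have : 0 <= k2 * D by rewrite mulr_ge0// ltW.
lra.
Qed.

End FinalNumerics.

Lemma large_constant (R : realType) :
  1050 * 145 * 326 <= 10 ^+ 8 :> R /\ 1050 * 264 * 7 <= 10 ^+ 8 :> R.
Proof. by split; lra. Qed.

Theorem theorem10 (R : realType) :
  exists C C' c1 c2 : R, [/\ 0 < C, 0 < C', 0 < c1 & 0 < c2] /\
  forall (N : nat) (d r : nat -> nat) (m : nat)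
    (Tstar : tensor R N d) (Xstar : factors R N d r)
    (A : {linear tensor R N d -> 'cV[R]_m}) (delta gamma mu : R)
    (dsp : measure_display) (Omega : measurableType dsp)
    (P : probability Omega R) (eps : Omega -> 'cV[R]_m)
    (X : Omega -> nat -> factors R N d r),
  let dbar := (\max_(k < N) d k)%N in
  let rbar := (\max_(1 <= i < N) r i)%N in
  let D : R := N%:R + 1 + \sum_(2 <= i < N) (r i)%:R in
  let dist2_to_star (Y : factors R N d r) := dist2 (sigma_max Tstar) Y Xstar in
  let y w := A Tstar + eps w in
  (2 <= N)%N -> r 0%N = 1%N -> r N = 1%N ->
  (forall i, (0 < i < N)%N -> (0 < r i)%N) ->
  (forall i, (0 < i < N)%N -> tt_rank i Tstar = r i) ->
  Tstar = tt_tensor Xstar -> minimal Xstar -> left_orthogonal Xstar ->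
  RIP A ((N + 3) * rbar) delta -> delta <= 7 / 30 ->
  gaussian_vector P 0 (gamma ^+ 2)%:M eps ->
  0 < mu ->
  (forall w, RGD (sensing_loss A (y w)) (sigma_max Tstar) mu (X w)) ->
  (forall w, left_orthogonal (X w 0%N)) ->
  (forall w, dist2_to_star (X w 0%N) <=
     (7 - 30 * delta) * sigma_min Tstar ^+ 2 /
     (8 * D * (129 * N%:R ^+ 2 + 7231 * N%:R - 7360))) ->
  mu <= (7 - 30 * delta) / (20 * (9 * N%:R - 5) * (1 + delta) ^+ 2) ->
  C * (N%:R ^+ 5 * dbar%:R * rbar%:R ^+ 3 * ln N%:R * kappa Tstar ^+ 2
       * gamma ^+ 2) / sigma_min Tstar ^+ 2 <= m%:R ->
  exists E : set Omega, [/\ measurable E,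
    ((1 - 2 * N%:R * expR (- (c1 * N%:R * dbar%:R * rbar%:R ^+ 2 * ln N%:R))
        - 2 * expR (- (c2 * N%:R ^+ 3 * dbar%:R * rbar%:R ^+ 2 * ln N%:R)))%:E
     <= P E)%E &
    forall w, E w -> forall t : nat,
      dist2_to_star (X w t.+1) <=
        (1 - (7 - 30 * delta) / (1280 * D * kappa Tstar ^+ 2) * mu) ^+ t.+1
          * dist2_to_star (X w 0%N)
        + C' * ((N%:R + mu) * D * (1 + delta) * N%:R ^+ 2 * dbar%:R
                * rbar%:R ^+ 2 * ln N%:R * kappa Tstar ^+ 2 * gamma ^+ 2)
          / (m%:R * (7 - 30 * delta))].
Proof.
exists (10 ^+ 8), (10 ^+ 8), 1, 1; split; first by split=> //; rewrite exprn_gt0// ltr0n.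
set C := 10 ^+ 8.
move=> N d r m Tstar Xstar A delta gamma mu dsp Omega P eps X dbar rbar D dist2_to_star y.
move=> N2 r0 rN rpos rT TX _ oXs rip delta1 gauss mu_gt0 rgd oX0 + hmu hm.
have N0 : (0 < N)%N by exact: leq_trans N2.
have NR : 2 <= N%:R :> R by rewrite ler_nat.
have NR0 : 0 < N%:R :> R by exact: lt_le_trans NR.
have D0 : N%:R + 1 <= D by rewrite /D lerDl sumr_ge0.
have D2 i : (2 <= i < N)%N -> (r i)%:R <= D.
  move=> iN; rewrite /D (@big_rem _ _ _ _ _ i) /=; last by rewrite mem_index_iota.
  by rewrite addrCA lerDl !addr_ge0// sumr_ge0.
have rb i : (0 < i < N)%N -> (r i <= rbar)%N.
  by move=> iN; rewrite /rbar; apply: leq_bigmax_seq => //; rewrite mem_index_iota.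
have rb0 : (0 < rbar)%N by rewrite (leq_trans (rpos 1%N _)) ?rb//.
have db k : (k < N)%N -> (d k <= dbar)%N.
  by move=> kN; exact: (@leq_bigmax _ (fun k : 'I_N => d k) (Ordinal kN)).
rewrite /dist2_to_star => {dist2_to_star}.
clearbody D rbar dbar; rewrite /kappa in hm *.
set sl := sigma_min Tstar in hm *; set sb := sigma_max Tstar in rgd hm *.
have sl0 : 0 < sl by apply: sigma_min_gt0 => // k kN; rewrite rT// rpos.
have TXe : Tstar = TT N (ext Xstar) by rewrite TX tt_tensor_ext.
have oXe := left_orth_ext oXs.
have gXs : @good R d r N sb sl (ext Xstar).
  apply: good_sigma => //; first exact: ltW.
    by move=> k kN; rewrite -TXe rT// rpos.
  by move=> k kN; rewrite -TXe; split; [exact: sigma_max_ge|exact: sigma_min_le].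
have sb0 : 0 <= sb.
  by apply: le_trans (sigma_max_ge Tstar (_ : (0 < 1 < N)%N)) => //; exact: sigma1_ge0.
(* Both bounds of [good] at k = 1 are tested on the identity matrix, which is nonzero because r_1 >
   0. *)
have slb : sl <= sb.
  have [h1 h2] := gXs 1%N N2.
  have fr : 0 < frob2 (1%:M : 'M[R]_(r 1%N)).
    rewrite frob2_gt0; apply: contraTneq (rpos 1%N N2) => e; rewrite -leqNgt leqn0.
    by rewrite -(mxrank1 R (r 1%N)) e mxrank0.
  have := le_trans (h2 _ 1%:M) (h1 _ 1%:M); rewrite ler_pM2r//.
  by rewrite ler_pXn2r ?nnegrE ?(ltW sl0).
clearbody sl sb.
have rk4 i : (0 < i < N)%N -> (4 * r i <= (N + 3) * rbar)%N.
  by move=> iN; rewrite leq_mul ?rb// (leq_add2r 3 1).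
have T0 : 0 < tnorm2 Tstar.
  rewrite lt_neqAle tnorm2_ge0 andbT; apply/negP => /eqP/esym/tnorm2_eq0 e.
  have := rpos 1%N N2; rewrite -(rT 1%N N2) e /tt_rank.
  by rewrite (_ : unfolding 1 _ = 0) ?mxrank0//; apply/matrixP => i j; rewrite !mxE ffunE.
have /andP[ripl ripu] :
    (1 - delta) * tnorm2 Tstar <= m%:R^-1 * frob2 (A Tstar) <= (1 + delta) * tnorm2 Tstar.
  by apply: rip => i iN; rewrite rT// (leq_trans _ (rk4 i iN))// leq_pmull.
(* The two sides of the RIP at the nonzero target give 1 - delta <= 1 + delta. *)
have delta0 : 0 <= delta by have := le_trans ripl ripu; rewrite ler_pM2r//; lra.
have m0 : (0 < m)%N.
  rewrite lt0n; apply/negP => /eqP em; move: ripl.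
  (* For m = 0 the inverse is 0 by convention, which contradicts the lower RIP bound because delta <
     1. *)
  have -> : m%:R^-1 = 0 :> R by rewrite em invr0.
  by rewrite mul0r leNgt mulr_gt0// subr_gt0 (le_lt_trans delta1)//; lra.
have mR : 0 < m%:R :> R by rewrite ltr0n.
have mu0 := ltW mu_gt0.
(* Equality would make the bound on the step size 0, against mu > 0. *)
have eta0 : 0 < 7 - 30 * delta.
  rewrite lt_neqAle; apply/andP; split; last by lra.
  apply/negP => /eqP e; move: hmu; rewrite -e mul0r; lra.
have d10 : 0 < 1 + delta by lra.
move=> init; have {}init w : dist2 sb (X w 0%N) Xstar <= sl ^+ 2 / (145 * N%:R ^+ 3).
  apply: le_trans (init w) _.
  exact: (initial_radius NR delta0 delta1 D0 (sqr_ge0 sl)).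
have mub := step_size_bound NR delta0 mu0 hmu.
have D1 : 0 <= D by lra.
have ND : N%:R <= D by lra.
have N1 : 1 <= N%:R :> R by lra.
have eta7 : 7 - 30 * delta <= 7 by lra.
(* The bound by rbar enters the sample size condition ([t1]), the bound by D the final error
   ([t2]). *)
pose B := Num.min rbar%:R D.
have B1 : 1 <= B by rewrite le_min ler1n rb0 /=; lra.
have B2 i : (2 <= i < N)%N -> (r i)%:R <= B.
  by move=> iN; have /andP[i2 iN'] := iN; rewrite le_min ler_nat rb ?iN' ?(ltnW i2) ?D2.
pose l : R := ln N%:R; have l0 : 0 <= l by apply: le_trans (ln_ge_half N2).
pose Q : R := N%:R * dbar%:R * rbar%:R ^+ 2 * l.
have Q0 : 0 <= Q by rewrite !mulr_ge0.
pose L := 32 * N%:R * dbar%:R * rbar%:R ^+ 2 * l * B.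
have L0 : 0 <= L by rewrite mulr_ge0 ?(le_trans _ B1)// !mulr_ge0.
have LQ : L + Q <= 33 * Q * B.
  have : Q <= Q * B by rewrite ler_peMr.
  rewrite /L (_ : 32 * _ * _ * _ * _ * _ = 32 * (Q * B)); [lra|by rewrite /Q; ring].
pose K := m%:R * (1 + delta); have K0 : 0 <= K by rewrite mulr_ge0// ltW.
have hA (c : @cores R d (rank2 (r := r) (N := N))) : frob2 (A (TT N c)) <= K * tnorm2 (TT N c).
  rewrite -mulrA -ler_pdivrMl//; have [] := andP (rip (TT N c) _) => // i iN.
  have /andP[_ iN'] := iN.
  apply: leq_trans (tt_rank_TT_le c (ltnW iN')) _; rewrite (leq_trans (rank2_le _))//.
  by apply: leq_trans (rk4 i iN); rewrite leq_mul.
have q0 : rank2 (r := r) (N := N) 0 = 1%N by rewrite /rank2.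
have qN : rank2 (r := r) (N := N) N = 1%N by rewrite /rank2 ltnn andbF.
have [E [mE PE hE]] := noise_event N0 q0 qN gauss K0 hA Q0 L0
  (entropy_bound N2 r0 rN rpos db rb0 rb B1 B2).
exists E; split => //.
  apply: le_trans PE; rewrite lee_fin.
  have e1 : expR (- (1 * N%:R * dbar%:R * rbar%:R ^+ 2 * ln N%:R)) = expR (- Q) by rewrite mul1r.
  rewrite e1; have := @expR_ge0 R (- (1 * N%:R ^+ 3 * dbar%:R * rbar%:R ^+ 2 * ln N%:R)).
  have : expR (- Q) * 2 <= expR (- Q) * N%:R by rewrite ler_wpM2l ?expR_ge0.
  have := expR_ge0 (- Q); lra.
move=> w Ew t; have {}init := init w.
pose b := Num.sqrt (2 * gamma ^+ 2 * K * (L + Q)).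
pose tau := 2 * b / m%:R.
have tau0 : 0 <= tau by rewrite divr_ge0 ?mulr_ge0 ?sqrtr_ge0.
have ht2 : tau ^+ 2 * m%:R = 8 * (gamma ^+ 2 * (1 + delta) * (L + Q)).
  rewrite /tau expr_div_n exprMn sqr_sqrtr; last first.
    by rewrite mulr_ge0 ?addr_ge0// mulr_ge0// mulr_ge0// sqr_ge0.
  by rewrite /K; field; rewrite gt_eqF.
have noise (c c' : @cores R d r) : `|mxdot (A (tangent_sum c c')) (eps w)| <=
    m%:R * tau * tnorm (@tangent_sum R d r N c c').
  have := hE w Ew (@tangent_cores R d r N c c'); rewrite TT_tangent//.
  by rewrite /tau (mulrC m%:R) divfK// gt_eqF.
pose G2 := gamma ^+ 2; have G0 : 0 <= G2 by exact: sqr_ge0.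
rewrite -/G2 in ht2 hm *; clearbody G2.
have hm' : C * (N%:R ^+ 5 * (dbar%:R * rbar%:R ^+ 3 * l * G2) * (sb / sl) ^+ 2) / sl ^+ 2 <= m%:R.
  apply: le_trans hm; rewrite -/l le_eqVlt; apply/orP; left; apply/eqP.
  by congr (C * _ / _); ring.
have Br : B <= rbar%:R by rewrite ge_min lexx.
have BD : B <= D by rewrite ge_min lexx orbT.
(* 8 * 33 * 37 / 30 = 325.6: the 8 from tau, 33 from [LQ], 37 / 30 from 1 + delta. In [t2] the
   factor 1 + delta is kept, which leaves 8 * 33 = 264. *)
have t1 : tau ^+ 2 * m%:R <= 326 * N%:R * (dbar%:R * rbar%:R ^+ 3 * l * G2).
  rewrite ht2.
  have h1 : L + Q <= 33 * Q * rbar%:R.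
    by apply: le_trans LQ _; rewrite ler_wpM2l// mulr_ge0.
  have h2 : G2 * (1 + delta) * (L + Q) <= G2 * (37 / 30) * (33 * Q * rbar%:R).
    apply: ler_pM => //; [by rewrite mulr_ge0 ?(ltW d10)|by rewrite addr_ge0|].
    by apply: ler_wpM2l => //; lra.
  have -> : 326 * N%:R * (dbar%:R * rbar%:R ^+ 3 * l * G2) = 326 * (G2 * (Q * rbar%:R)).
    by rewrite /Q; ring.
  have : 0 <= G2 * (Q * rbar%:R) by rewrite mulr_ge0// mulr_ge0.
  lra.
have t2 : (sb / sl) ^+ 2 * tau ^+ 2 * m%:R <=
    264 * N%:R * ((1 + delta) * dbar%:R * rbar%:R ^+ 2 * l * (sb / sl) ^+ 2 * G2) * D.
  rewrite -mulrA ht2.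
  have h1 : L + Q <= 33 * Q * D by apply: le_trans LQ _; rewrite ler_wpM2l// mulr_ge0.
  have -> : 264 * N%:R * ((1 + delta) * dbar%:R * rbar%:R ^+ 2 * l * (sb / sl) ^+ 2 * G2) * D =
    (sb / sl) ^+ 2 * (8 * (G2 * (1 + delta) * (33 * Q * D))) by rewrite /Q; ring.
  rewrite ler_wpM2l ?sqr_ge0// ler_wpM2l// ler_wpM2l// mulr_ge0 ?(ltW d10)//.
have k20 : 0 < (sb / sl) ^+ 2 by rewrite exprn_gt0// divr_gt0// (lt_le_trans sl0).
have a0 : 0 <= 1050 :> R by rewrite ler0n.
have b0 : 0 < 145 :> R by rewrite ltr0n.
have c0 : 0 <= 264 :> R by rewrite ler0n.
have hs := steady_state_radius a0 b0 (large_constant R).1 NR0 mR (exprn_gt0 2 sl0)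
  (_ : 0 <= dbar%:R * rbar%:R ^+ 3 * l * G2) (ltW k20) t1 hm'.
have {}hs := hs ltac:(by rewrite !mulr_ge0).
have he : 1050 * N%:R * (sb / sl) ^+ 2 * tau ^+ 2 <=
    C * ((N%:R + mu) * D * (1 + delta) * N%:R ^+ 2 * dbar%:R * rbar%:R ^+ 2 * l * (sb / sl) ^+ 2 * G2)
    / (m%:R * (7 - 30 * delta)).
  have c7 : 0 <= 7 :> R by [].
  set W := _ * G2 in t2.
  have W0 : 0 <= W.
    rewrite /W; apply: mulr_ge0 => //; apply: mulr_ge0; last exact: ltW k20.
    by rewrite !mulr_ge0 ?(ltW d10).
  have := steady_state_error a0 c0 c7 (large_constant R).2 N1 mR mu0 eta0 eta7 D1 W0 t2.
  rewrite mulrA => /le_trans; apply; rewrite le_eqVlt; apply/orP; left; apply/eqP.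
  by congr (C * _ / _); rewrite /W; ring.
have rho_le : (7 - 30 * delta) / (1280 * D * (sb / sl) ^+ 2) * mu <=
    mu * sl ^+ 2 / (N%:R * sb ^+ 2) / 50.
  have := rate_le NR0 ND k20 mu0 (ltW eta0) eta7.
  have -> : mu / (N%:R * (sb / sl) ^+ 2) = mu * sl ^+ 2 / (N%:R * sb ^+ 2).
    by field; rewrite !gt_eqF// (lt_le_trans sl0).
  by [].
have rho1 := rate_le1 N2 sl0 slb delta0 mu0 mub.
have rgdw : RGD (sensing_loss A (A (tt_tensor Xstar) + eps w)) sb mu (X w).
  by rewrite -TX; exact: rgd.
have conv := dist2_convergence N2 r0 rN sl0 slb oXs gXs m0 rip rk4 delta0 delta1 mu0 tau0 mub
  rgdw (oX0 w) noise hs init.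
have [_ h1] := conv t.+1; have [h2 _] := conv 0%N.
apply: le_trans h1 _; apply: lerD he.
have base_le : 1 - mu * sl ^+ 2 / (N%:R * sb ^+ 2) / 50 <=
    1 - (7 - 30 * delta) / (1280 * D * (sb / sl) ^+ 2) * mu by rewrite lerD2l lerN2; exact: rho_le.
have base0 : 0 <= 1 - mu * sl ^+ 2 / (N%:R * sb ^+ 2) / 50 by rewrite subr_ge0; exact: rho1.
apply: ler_wpM2r; first exact: h2.
by apply: lerXn2r => [||]; [exact: base0|exact: le_trans base0 base_le|exact: base_le].
Qed.
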